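(* Let $\varepsilon>0$ be an arbitrarily small constant and let $G\in\mathcal G(n,r,2)$ with $r\ge(1+\varepsilon)r_c$. Then a.a.s. $\tau_{cov}(G)=\Theta(n\log n)$.
   Context: Random geometric graph: for integers $d,n\ge1$ and real $r>0$ (possibly depending on $n$), $\mathcal G(n,r,d)$ is the random graph whose vertex set is a Poisson point process of intensity $1$ on $\Lambda_n=[-n^{1/d}/2,\,n^{1/d}/2]^d$, two vertices being adjacent iff their Euclidean distance is at most $r$. $V_d$ is the volume of the unit ball in $\mathbb R^d$ and $r_c=(\log n/V_d)^{1/d}$ (so for $d=2$, $r_c^2=\log n/\pi$). An event holds a.a.s. if its probability tends to $1$ as $n\to\infty$. For a finite connected graph $H=(V,E)$, $\tau_{cov}(H)=\max_{v\in V}\mathbb E_v[\min\{t\ge0:\{X_0,\dots,X_t\}=V\}]$ for simple random walk $(X_t)$ on $H$ started at $v$ (a.a.s. $G$ is connected in this regime). *)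

(* Defs.v *)
From HB Require Import structures.
From mathcomp Require Import all_boot all_order all_algebra.
From mathcomp Require Import all_classical all_reals all_analysis.
Set Implicit Arguments. Unset Strict Implicit. Unset Printing Implicit Defensive.
Import Order.TTheory GRing.Theory Num.Theory.
Local Open Scope ring_scope.
Local Open Scope classical_set_scope.

Section CoverTime.
Variable R : realType.
Variable T : finType.
Variable adj : rel T.

Definition deg (x : T) : nat := #|[set y | adj x y]|.

(* one-step transition probability of simple random walk; an isolated vertex
   is absorbing (convention; it only matters for disconnected graphs, whose
   cover time is then +oo as it should be). *)
Definition srw_step (x y : T) : R :=
  if deg x == 0%N then (x == y)%:R else (adj x y)%:R / (deg x)%:R.

Definition path_prob (t : nat) (p : {ffun 'I_t.+1 -> T}) : R :=
  \prod_(i < t) srw_step (p (inord i)) (p (inord i.+1)).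

Definition covers (t : nat) (p : {ffun 'I_t.+1 -> T}) : bool :=
  [forall y : T, [exists i, p i == y]].

Definition not_covered_prob (v : T) (t : nat) : R :=
  \sum_(p : {ffun 'I_t.+1 -> T} | (p ord0 == v) && ~~ covers p) path_prob p.

(* E_v[T_cov] = sum_{t >= 0} P_v[T_cov > t]  (in [0, +oo]) *)
Definition exp_cover_time (v : T) : \bar R :=
  (\sum_(0 <= t <oo) (not_covered_prob v t)%:E)%E.

Definition cover_time : \bar R :=
  (\big[Order.max/0%E]_(v : T) exp_cover_time v)%E.
End CoverTime.

Section RGG.
Variable R : realType.

Definition rgg_adj (m : nat) (pts : 'I_m -> R * R) (r : R) : rel 'I_m :=
  fun i j => (i != j) &&
    (((pts i).1 - (pts j).1) ^+ 2 + ((pts i).2 - (pts j).2) ^+ 2 <= r ^+ 2).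

Definition box (n : nat) : set (R * R) :=
  [set x | `|x.1| <= Num.sqrt n%:R / 2 /\ `|x.2| <= Num.sqrt n%:R / 2].

Definition leb2 : set (R * R) -> \bar R :=
  ((@lebesgue_measure R) \x (@lebesgue_measure R))%E.

(* (N n, (X n i)_{i < N n}) is, for every n, a Poisson point process of
   intensity 1 on Lambda_n: N n ~ Poisson(|Lambda_n|) = Poisson(n) and,
   given N n = k, the points X n 0, ..., X n (k-1) are i.i.d. uniform on
   Lambda_n.  Stated through the joint law on measurable product sets. *)
Definition poisson_rgg_model (d : measure_display) (Om : measurableType d)
    (P : probability Om R) (N : nat -> Om -> nat) (X : nat -> nat -> Om -> R * R) :=
  (forall n k, measurable [set w | N n w = k]) /\
  (forall n i, measurable_fun setT (X n i)) /\
  (forall n k (B : nat -> set (R * R)), (forall i, measurable (B i)) ->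
    P [set w | N n w = k /\ forall i, (i < k)%N -> B i (X n i w)] =
    ((expR (- n%:R) * n%:R ^+ k / k`!%:R)%:E *
      \prod_(i < k) (leb2 (B i `&` box n) * (n%:R^-1)%:E))%E).
End RGG.

(* Main.v *)
(* Upper bound: if h y dominates the hitting times of y and is at most K, the
   walk misses y for time t with probability at most 2 (1 - 1/(2K))^t, so the
   cover time is O(K log m). Hitting times are at most (total degree) * Rf as
   soon as every function h satisfies (h x - h y)^2 <= Rf * E(h), E being the
   Dirichlet energy. Lower bound: commute times are at least
   (total degree) / (2 * degree), and H(u,v) - H(v,u) is a difference of
   potentials, so a positive fraction of the vertices has pairwise hitting times
   of order n; Matthews' argument then gives a further factor log n.

   Hence it suffices that degrees are of order rho^2, rho = min(r, sqrt n), and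
   that Rf = O(1/rho^2). Cut the box into cells of side about rho/b. A set of
   cells of total area A is sparse (few points in each) with probability
   n^(-A/log n) roughly, so a.a.s. no bounded window has sparse cells of area
   pi rho^2; near a side the bound is half of that, and near a corner there are
   no sparse cells at all. After reflecting the box in its sides, every window
   has less than a full disc of sparse cells. The dense cells of a window are
   then connected: long strips free of large sparse clusters exist on all four
   sides, and a component of dense cells enclosed by them would be surrounded
   by four quarter discs of sparse cells, a full disc. So the dense cells
   inherit the resistance O(log n) of the planar grid, which Polya's urn flow
   bounds; each edge between cells being a bundle of order rho^4 edges, this
   gives Rf = O(1/rho^2 + log n / rho^4). *)

Require Import Defs.
From HB Require Import structures.
From mathcomp Require Import all_boot all_order all_algebra.
From mathcomp Require Import all_classical all_reals all_analysis.
From mathcomp Require Import zify ring lra.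
Set Implicit Arguments. Unset Strict Implicit. Unset Printing Implicit Defensive.
Import Order.TTheory GRing.Theory Num.Theory.

(** * Connectivity of dense cells inside a window *)

(** At the threshold sparse cells cannot be avoided: a cell has a small fixed multiple of [log n] as
    its area, so it is sparse with probability a small negative power of [n], and polynomially many
    sparse cells are expected. The argument must therefore be sharp in the constant. A full disc has
    area [(1 + eps)^2 log n], so it is sparse with probability about [n^(-(1 + eps)^2)], which beats
    the at most [n] windows. Only about [n^(1/2)] windows meet a side and boundedly many meet a
    corner; this is why half a disc suffices near a side and a single cell near a corner. Reflection
    turns the three cases into one. All losses (counting cells instead of area, few points instead
    of none, rounding to cells) are paid out of [eps] by taking [b] large. Then [b] depends on [eps]
    alone, a window has boundedly many cells, and subsets of a window, lengths of chains and
    overlaps of windows cost only constants. Finally [log n = O(rho^2)], so the term [log n / rho^4]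
    is absorbed and hitting times are [O(n)]. *)

Lemma connect_homo (T T' : finType) (e : rel T) (e' : rel T') (f : T -> T') x y :
  (forall x y, e x y -> e' (f x) (f y)) -> connect e x y -> connect e' (f x) (f y).
Proof.
move=> h /connectP[p]; elim: p x => [|z p IH] x /=; first by move=> _ ->.
move=> /andP[xz pz] ey; apply: connect_trans (IH z pz ey); exact/connect1/h.
Qed.

Lemma connect_ind (T : finType) (e : rel T) (Q : T -> Prop) u :
  Q u -> (forall x y, connect e u x -> Q x -> e x y -> Q y) -> forall p, connect e u p -> Q p.
Proof.
move=> Qu H p /connectP[s]; elim/last_ind: s p => [|s z IH] p /=; first by move=> _ ->.
rewrite rcons_path last_rcons => /andP[ps ez] ->.
by apply: (H (last u s)) => //; [apply/connectP; exists s|apply: IH].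
Qed.

Lemma sum_card_disjoint (T I : finType) (A : {set T}) (F : I -> pred T) :
  (forall i j x, F i x -> F j x -> i = j) ->
  (\sum_i #|[set x in A | F i x]| <= #|A|)%N.
Proof.
move=> dF.
have -> : (\sum_i #|[set x in A | F i x]| = \sum_(x in A) \sum_(i | F i x) 1)%N.
  rewrite (exchange_big_dep predT) //=; apply: eq_bigr => i _.
  by rewrite -sum1_card; apply: eq_bigl => x; rewrite inE.
rewrite -sum1_card; apply: leq_sum => x _; rewrite sum1_card.
by apply/card_le1_eqP => i j Fi Fj; exact: (dF j i x).
Qed.

(* All points of two such cells of side [s] are within [b * s] of each other. *)
Definition near_cells (b x y x' y' : nat) : bool :=
  (((x - x') + (x' - x)).+1 ^ 2 + ((y - y') + (y' - y)).+1 ^ 2 <= b ^ 2)%N.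

Lemma near_cellsC b x y x' y' : near_cells b x y x' y' = near_cells b x' y' x y.
Proof. by rewrite /near_cells addnC [(y' - y + _)%N]addnC [(x' - x + _)%N]addnC addnC. Qed.

Lemma near_cells_swap b x y x' y' : near_cells b y x y' x' = near_cells b x y x' y'.
Proof. by rewrite /near_cells addnC. Qed.

Lemma near_cells_lt b x y x' y' : near_cells b x y x' y' ->
  [/\ (x < x' + b)%N, (x' < x + b)%N, (y < y' + b)%N & (y' < y + b)%N].
Proof.
rewrite /near_cells => h.
have h1 : ((x - x' + (x' - x)).+1 <= b)%N.
  by rewrite -leq_sqr; apply: leq_trans h; exact: leq_addr.
have h2 : ((y - y' + (y' - y)).+1 <= b)%N.
  by rewrite -leq_sqr; apply: leq_trans h; exact: leq_addl.
by split; lia.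
Qed.

Lemma near_cells_le b x y x' y' A B : (x - x' <= A)%N -> (x' - x <= A)%N ->
  (y - y' <= B)%N -> (y' - y <= B)%N -> (A.+1 ^ 2 + B.+1 ^ 2 <= b ^ 2)%N -> near_cells b x y x' y'.
Proof.
move=> h1 h2 h3 h4; apply: leq_trans; apply: leq_add; rewrite leq_sqr ltnS; lia.
Qed.

(** The two axes are left out so that the four reflected copies are disjoint; this costs only [O(b)]
    of about [pi * b ^ 2 / 4] cells. *)
Definition quarter (b : nat) : {set 'I_b * 'I_b} :=
  [set p : 'I_b * 'I_b | [&& (0 < p.1)%N, (0 < p.2)%N & (p.1.+1 ^ 2 + p.2.+1 ^ 2 <= b ^ 2)%N]].

Lemma quarter_gt0 e : (0 < e)%N -> (0 < #|quarter (4 * e)|)%N.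
Proof.
move=> e_gt0; have b1 : (1 < 4 * e)%N by lia.
apply/card_gt0P; exists (Ordinal b1, Ordinal b1).
by rewrite inE /=; nia.
Qed.

Section Window.
Variables (e L : nat).
(** In units of [b = 4 * e] the side [544 * e] is [136 = 2 + 64 + 4 + 64 + 2]: a margin, 64
    candidate strips, the inner square, 64 candidate strips, a margin. The margins leave room for
    the quarter discs. *)
Hypotheses (e_gt0 : (0 < e)%N) (Le : L.+1 = (544 * e)%N).
Local Notation b := (4 * e)%N.
Local Notation W := ('I_L.+1 * 'I_L.+1)%type.

Definition bad_cells (bad : nat -> nat -> bool) : {set W} := [set p : W | bad p.1 p.2].
Definition cell_edge (bad : nat -> nat -> bool) : rel W :=
  fun p p' => [&& ~~ bad p.1 p.2, ~~ bad p'.1 p'.2 & near_cells b p.1 p.2 p'.1 p'.2].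

Lemma cell_edge_sym bad : symmetric (cell_edge bad).
Proof. by move=> p p'; rewrite /cell_edge near_cellsC andbCA. Qed.

Lemma cell_conn_sym bad p p' : connect (cell_edge bad) p p' -> connect (cell_edge bad) p' p.
Proof. by rewrite (sym_connect_sym (@cell_edge_sym bad)). Qed.

(** The quarters do not overlap: offsets are positive, so two lie strictly right of [x1], two
    strictly left of [x2 <= x1], and on each side one is above and one below its centre. The heights
    [y1] and [y2] may differ. *)
Lemma four_quarters (bad : nat -> nat -> bool) x1 y1 x2 y2 :
  (x2 <= x1)%N -> (b <= x2)%N -> (x1 + b <= L.+1)%N ->
  (b <= y1)%N -> (y1 + b <= L.+1)%N -> (b <= y2)%N -> (y2 + b <= L.+1)%N ->
  (forall i j : 'I_b, (i, j) \in quarter b ->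
     [/\ bad (x1 + i)%N (y1 + j)%N, bad (x1 + i)%N (y1 - j)%N,
         bad (x2 - i)%N (y2 + j)%N & bad (x2 - i)%N (y2 - j)%N]) ->
  (4 * #|quarter b| <= #|bad_cells bad|)%N.
Proof.
move=> x21 bx2 x1L by1 y1L by2 y2L H.
pose A := finset.setX [set: bool * bool] (quarter b).
have -> : (4 * #|quarter b| = #|A|)%N by rewrite cardsX cardsT card_prod card_bool.
pose fx (s : bool) (i : nat) := (if s then x1 + i else x2 - i)%N.
pose fy (s t : bool) (j : nat) := (if s then (if t then y1 + j else y1 - j) else (if t then y2 + j else y2 - j))%N.
pose f (z : (bool * bool) * ('I_b * 'I_b)) : W :=
  (inord (fx z.1.1 z.2.1), inord (fy z.1.1 z.1.2 z.2.2)).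
have fxL s (i : 'I_b) : (fx s i < L.+1)%N by have := ltn_ord i; rewrite /fx; case: s; lia.
have fyL s t (i : 'I_b) : (fy s t i < L.+1)%N by have := ltn_ord i; rewrite /fy; case: s; case: t; lia.
rewrite -(card_in_imset (f := f)).
  apply: subset_leq_card; apply/fintype.subsetP => w /imsetP[[[s t] [i j]]].
  rewrite finset.in_setX => /andP[_ /= hq] ->; rewrite inE /= !inordK //.
  by have [] := H i j hq; rewrite /fx /fy; case: s; case: t.
move=> [[s t] [i j]] [[s' t'] [i' j']]; rewrite !finset.in_setX /= !inE /=.
move=> /and3P[i0 j0 _] /and3P[i0' j0' _] [/(congr1 val) + /(congr1 val)].
rewrite /= !inordK // /fx /fy => e1 e2.
have hi := ltn_ord i; have hj := ltn_ord j; have hi' := ltn_ord i'; have hj' := ltn_ord j'.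
have [es [et [ei ej]]] : s = s' /\ t = t' /\ i = i' :> nat /\ j = j' :> nat.
  by move: e1 e2; case: s; case: t; case: s'; case: t'; intuition lia.
by rewrite es et (val_inj ei) (val_inj ej).
Qed.

Lemma four_quarters_ext (bad : nat -> nat -> bool) (p p' : W) : (p'.1 <= p.1)%N ->
  (2 * b <= p.1)%N -> (p.1 + 2 * b <= L.+1)%N -> (2 * b <= p.2)%N -> (p.2 + 2 * b <= L.+1)%N ->
  (2 * b <= p'.1)%N -> (p'.1 + 2 * b <= L.+1)%N -> (2 * b <= p'.2)%N -> (p'.2 + 2 * b <= L.+1)%N ->
  (forall x y, (x < L.+1)%N -> (y < L.+1)%N -> near_cells b p.1 p.2 x y -> (p.1 < x)%N -> bad x y) ->
  (forall x y, (x < L.+1)%N -> (y < L.+1)%N -> near_cells b p'.1 p'.2 x y -> (x < p'.1)%N -> bad x y) ->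
  (4 * #|quarter b| <= #|bad_cells bad|)%N.
Proof.
move: p p' => [x1 y1] [x2 y2] /= h1 h2 h3 h4 h5 h6 h7 h8 h9 H H'.
apply: (@four_quarters bad x1 y1 x2 y2) => //; try by clear -h1 h2 h3 h4 h5 h6 h7 h8 h9 e_gt0; lia.
move=> i j; rewrite inE /= => /and3P[i0 j0 hij].
have hi := ltn_ord i; have hj := ltn_ord j.
have nr (x y x' y' : nat) : (x - x' <= i)%N -> (x' - x <= i)%N -> (y - y' <= j)%N -> (y' - y <= j)%N ->
  near_cells b x y x' y' by move=> *; apply: (@near_cells_le _ _ _ _ _ i j).
clear hij; split; [apply: H|apply: H|apply: H'|apply: H'].
all: try (apply: nr); try clear H; try clear H'; try clear nr; lia.
Qed.

Definition hstrip_bad bad y0 : {set W} := [set p in bad_cells bad | (y0 <= p.2 < y0 + b)%N].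

(* 64 disjoint strips share fewer than [4 * b ^ 2 = 64 * e ^ 2] bad cells. *)
Lemma exists_clean_hstrip bad Y : (#|bad_cells bad| < 4 * #|quarter b|)%N ->
  exists2 k, (k < 64)%N & (#|hstrip_bad bad (Y + k * b)| < e ^ 2)%N.
Proof.
move=> hb; apply: contrapT => H.
have ge (k : 'I_64) : (e ^ 2 <= #|hstrip_bad bad (Y + k * b)|)%N.
  by rewrite leqNgt; apply/negP => h; apply: H; exists k.
have := @sum_card_disjoint W 'I_64 (bad_cells bad)
  (fun k p => (Y + k * b <= p.2 < Y + k * b + b)%N).
have dj : forall (i j : 'I_64) (x : W), (Y + i * b <= x.2 < Y + i * b + b)%N ->
   (Y + j * b <= x.2 < Y + j * b + b)%N -> i = j.
  move=> i j x /andP[h1 h2] /andP[h3 h4]; apply: val_inj => /=; nia.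
move=> /(_ dj).
have : (\sum_(k < 64) e ^ 2 <= \sum_(k < 64) #|hstrip_bad bad (Y + k * b)|)%N by apply: leq_sum.
rewrite sum_nat_const card_ord => h1 h2.
have hq : (#|quarter b| <= b * b)%N.
  by apply: leq_trans (max_card _) _; rewrite card_prod !card_ord.
have : (64 * e ^ 2 < 4 * (b * b))%N.
  by apply: leq_ltn_trans (leq_trans h1 h2) _; apply: leq_trans hb _; rewrite leq_mul2l.
nia.
Qed.

Lemma clean_square (bad : nat -> nat -> bool) y0 x1 y1 : (#|hstrip_bad bad y0| < e ^ 2)%N ->
  (x1 + e <= L.+1)%N -> (y0 <= y1)%N -> (y1 + e <= y0 + b)%N -> (y0 + b <= L.+1)%N ->
  exists p : W, [/\ ~~ bad p.1 p.2, (x1 <= p.1 < x1 + e)%N & (y1 <= p.2 < y1 + e)%N].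
Proof.
move=> hb xL y01 y1b y0L; apply: contrapT => H.
have : (e ^ 2 <= #|hstrip_bad bad y0|)%N; last by rewrite leqNgt hb.
pose f (z : 'I_e * 'I_e) : W := (inord (x1 + z.1), inord (y1 + z.2)).
have fL1 (i : 'I_e) : (x1 + i < L.+1)%N by have := ltn_ord i; lia.
have fL2 (i : 'I_e) : (y1 + i < L.+1)%N by have := ltn_ord i; lia.
have -> : (e ^ 2 = #|[set: 'I_e * 'I_e]|)%N by rewrite cardsT card_prod card_ord mulnn.
rewrite -(card_in_imset (f := f)).
  apply: subset_leq_card; apply/fintype.subsetP => w /imsetP[[i j] _ ->].
  have := ltn_ord i; have := ltn_ord j => hj hi.
  rewrite !inE /= !inordK //; apply/andP; split; last by lia.
  apply: contrapT => /negP h; apply: H; exists (f (i, j)).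
  by rewrite /= !inordK //; split => //; lia.
move=> [i j] [i' j'] _ _ [/(congr1 val) + /(congr1 val)].
rewrite /= !inordK // => /addnI e1 /addnI e2; by rewrite (val_inj e1) (val_inj e2).
Qed.

(** No [e] by [e] square of the strip is entirely bad, so the squares of its second row of height
    [e] carry a chain of good cells. Neighbouring squares need [(2e)^2 + e^2 <= b^2], and reaching
    the chain from anywhere in the strip needs [e^2 + (3e)^2 <= b^2]; both hold as [b = 4 * e]. *)
Lemma clean_hstrip_connected (bad : nat -> nat -> bool) y0 : (#|hstrip_bad bad y0| < e ^ 2)%N -> (y0 + b <= L.+1)%N ->
  forall p p' : W, ~~ bad p.1 p.2 -> ~~ bad p'.1 p'.2 ->
    (y0 <= p.2 < y0 + b)%N -> (y0 <= p'.2 < y0 + b)%N -> connect (cell_edge bad) p p'.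
Proof.
move=> hb y0L.
have [z [zg zx zy]] : exists p : W, [/\ ~~ bad p.1 p.2, (0 <= p.1 < 0 + e)%N & (y0 + e <= p.2 < y0 + e + e)%N].
  by apply: clean_square hb _ _ _ _; lia.
have mid k : (k < 544)%N -> forall g : W, ~~ bad g.1 g.2 -> (k * e <= g.1 < k * e + e)%N ->
   (y0 + e <= g.2 < y0 + e + e)%N -> connect (cell_edge bad) g z.
  elim: k => [|k IH] hk g gg gx gy.
    apply: connect1; rewrite /cell_edge gg zg /=.
    by apply: (@near_cells_le _ _ _ _ _ e e); try lia; nia.
  have [g' [gg' gx' gy']] : exists p : W, [/\ ~~ bad p.1 p.2, (k * e <= p.1 < k * e + e)%N
     & (y0 + e <= p.2 < y0 + e + e)%N].
    by apply: clean_square hb _ _ _ _; nia.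
  apply: connect_trans (IH (ltnW hk) g' gg' gx' gy').
  apply: connect1; rewrite /cell_edge gg gg' /=.
  by apply: (@near_cells_le _ _ _ _ _ (2 * e - 1) (e - 1)); try lia; nia.
have all (p : W) : ~~ bad p.1 p.2 -> (y0 <= p.2 < y0 + b)%N -> connect (cell_edge bad) p z.
  move=> pg py; pose k := (p.1 %/ e)%N.
  have k1 : (k * e <= p.1)%N by rewrite /k leq_divM.
  have k2 : (p.1 < k * e + e)%N by rewrite -mulSnr /k ltn_ceil.
  have hk : (k < 544)%N.
    by rewrite /k ltn_divLR // -Le ltn_ord.
  have [g [gg gx gy]] : exists p : W, [/\ ~~ bad p.1 p.2, (k * e <= p.1 < k * e + e)%N
     & (y0 + e <= p.2 < y0 + e + e)%N].
    by apply: clean_square hb _ _ _ _; nia.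
  apply: connect_trans (mid k hk g gg gx gy).
  apply: connect1; rewrite /cell_edge pg gg /=.
  by apply: (@near_cells_le _ _ _ _ _ (e - 1) (3 * e - 1)); try lia; nia.
move=> p p' pg pg' py py'; apply: connect_trans (all p pg py) _.
exact/cell_conn_sym/all.
Qed.

Definition swapb (bad : nat -> nat -> bool) x y := bad y x.

Lemma card_bad_swap bad : #|bad_cells (swapb bad)| = #|bad_cells bad|.
Proof.
have sw bad' : (#|bad_cells (swapb bad')| <= #|bad_cells bad'|)%N.
  pose f (p : W) : W := (p.2, p.1).
  rewrite -(card_imset _ (f := f)); last by move=> [a c] [a' c'] [-> ->].
  apply: subset_leq_card; apply/fintype.subsetP => w /imsetP[[i j]].
  by rewrite !inE /= => h ->.
by apply/eqP; rewrite eqn_leq sw (sw (swapb bad)).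
Qed.

Lemma clean_vstrip_connected (bad : nat -> nat -> bool) x0 : (#|hstrip_bad (swapb bad) x0| < e ^ 2)%N -> (x0 + b <= L.+1)%N ->
  forall p p' : W, ~~ bad p.1 p.2 -> ~~ bad p'.1 p'.2 ->
    (x0 <= p.1 < x0 + b)%N -> (x0 <= p'.1 < x0 + b)%N -> connect (cell_edge bad) p p'.
Proof.
move=> hb x0L [p1 p2] [p1' p2'] /= pg pg' px px'.
have := @clean_hstrip_connected (swapb bad) x0 hb x0L (p2, p1) (p2', p1') pg pg' px px'.
apply: (connect_homo (f := fun p : W => (p.2, p.1))) => -[a c] [a' c'].
by rewrite /cell_edge /swapb /= near_cells_swap.
Qed.

Section FewBad.
Variable bad : nat -> nat -> bool.
Hypothesis few_bad : (#|bad_cells bad| < 4 * #|quarter b|)%N.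

(** Otherwise the four quarter discs around the centre would all be bad. The cell found here becomes
    the representative of the centre. *)
Lemma exists_good_near : exists p : W, ~~ bad p.1 p.2 /\ near_cells b (68 * b) (68 * b) p.1 p.2.
Proof.
apply: contrapT => H.
have : (4 * #|quarter b| <= #|bad_cells bad|)%N; last by rewrite leqNgt few_bad.
have cL : (68 * b + b <= L.+1)%N by lia.
have key x y : (x < L.+1)%N -> (y < L.+1)%N -> near_cells b (68 * b) (68 * b) x y -> bad x y.
  move=> hx hy hn; apply: contrapT => /negP h; apply: H; exists (inord x, inord y).
  by rewrite /= !inordK.
apply: (@four_quarters bad (68 * b) (68 * b) (68 * b) (68 * b)); try lia.
move=> i j; rewrite inE /= => /and3P[i0 j0 hij].
have hi := ltn_ord i; have hj := ltn_ord j.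
by split; apply: key; try lia; apply: (@near_cells_le _ _ _ _ _ i j) => //; lia.
Qed.

Definition inner (p : W) := [/\ (66 * b <= p.1)%N, (p.1 < 70 * b)%N, (66 * b <= p.2)%N & (p.2 < 70 * b)%N].

(* Clean strips on the four sides of the inner square lie in one component. A good
   cell outside of it has its component enclosed by these strips, and the quarter
   discs beyond the leftmost and the rightmost cell of this component are bad. *)
Lemma inner_connected (u v : W) : ~~ bad u.1 u.2 -> ~~ bad v.1 v.2 -> inner u -> inner v ->
  connect (cell_edge bad) u v.
Proof.
have few_bad' : (#|bad_cells (swapb bad)| < 4 * #|quarter b|)%N by rewrite card_bad_swap.
have [kt hkt ct] := exists_clean_hstrip (70 * b) few_bad.
have [kb hkb cb] := exists_clean_hstrip (2 * b) few_bad.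
have [kr hkr cr] := exists_clean_hstrip (70 * b) few_bad'.
have [kl hkl cl] := exists_clean_hstrip (2 * b) few_bad'.
move: ct cb cr cl.
set yt := (70 * b + kt * b)%N; set yb := (2 * b + kb * b)%N.
set xr := (70 * b + kr * b)%N; set xl := (2 * b + kl * b)%N => ct cb cr cl.
have ytL : (yt + 3 * b <= L.+1)%N by rewrite /yt; nia.
have xrL : (xr + 3 * b <= L.+1)%N by rewrite /xr; nia.
have ybL : (yb + b <= 66 * b)%N by rewrite /yb; nia.
have xlL : (xl + b <= 66 * b)%N by rewrite /xl; nia.
have yb2 : (2 * b <= yb)%N by rewrite /yb leq_addr.
have xl2 : (2 * b <= xl)%N by rewrite /xl leq_addr.
have yt2 : (70 * b <= yt)%N by rewrite /yt leq_addr.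
have xr2 : (70 * b <= xr)%N by rewrite /xr leq_addr.
have [z [zg zx zy]] : exists p : W, [/\ ~~ bad p.1 p.2, (xl <= p.1 < xl + e)%N & (yb <= p.2 < yb + e)%N].
  by apply: clean_square cb _ _ _ _; lia.
have [wt [wtg wtx wty]] : exists p : W, [/\ ~~ bad p.1 p.2, (xl <= p.1 < xl + e)%N & (yt <= p.2 < yt + e)%N].
  by apply: clean_square ct _ _ _ _; lia.
have [wr [wrg wrx wry]] : exists p : W, [/\ ~~ bad p.1 p.2, (xr <= p.1 < xr + e)%N & (yb <= p.2 < yb + e)%N].
  by apply: clean_square cb _ _ _ _; lia.
have toB (p : W) : ~~ bad p.1 p.2 -> (yb <= p.2 < yb + b)%N -> connect (cell_edge bad) p z.
  by move=> pg py; apply: (clean_hstrip_connected cb) => //; lia.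
have toL (p : W) : ~~ bad p.1 p.2 -> (xl <= p.1 < xl + b)%N -> connect (cell_edge bad) p z.
  by move=> pg py; apply: (clean_vstrip_connected cl) => //; lia.
have toT (p : W) : ~~ bad p.1 p.2 -> (yt <= p.2 < yt + b)%N -> connect (cell_edge bad) p z.
  move=> pg py; apply: (@connect_trans _ _ wt); last by apply: toL => //; lia.
  by apply: (clean_hstrip_connected ct) => //; lia.
have toR (p : W) : ~~ bad p.1 p.2 -> (xr <= p.1 < xr + b)%N -> connect (cell_edge bad) p z.
  move=> pg py; apply: (@connect_trans _ _ wr); last by apply: toB => //; lia.
  by apply: (clean_vstrip_connected cr) => //; lia.
suff main (w : W) : ~~ bad w.1 w.2 -> inner w -> connect (cell_edge bad) w z.
  by move=> ug vg ui vi; apply: connect_trans (main u ug ui) (cell_conn_sym (main v vg vi)).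
move=> wg [w1 w2 w3 w4]; apply: contrapT => nz.
pose Q (p : W) := ~~ bad p.1 p.2 /\ [/\ (xl + b <= p.1)%N, (p.1 < xr)%N, (yb + b <= p.2)%N & (p.2 < yt)%N].
(* An edge moves by less than [b] in each coordinate, so the component cannot jump over a strip of
   width [b]; landing on a good cell of a strip would connect it to [z]. *)
have SQ : forall p, connect (cell_edge bad) w p -> Q p.
  apply: connect_ind; first by split => //; split; lia.
  clear ct cb cr cl few_bad few_bad' wtx wty wrx wry zx zy hkt hkb hkr hkl ytL xrL ybL xlL w1 w2 w3 w4.
  move=> x y wx [_ [x1 x2 x3 x4]] xy; have /and3P[_ yg hn] := xy.
  have [n1 n2 n3 n4] := near_cells_lt hn.
  clear hn.
  have wy : connect (cell_edge bad) w y by apply: connect_trans wx (connect1 xy).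
  have no : ~ connect (cell_edge bad) y z by move=> yz; apply: nz; apply: connect_trans wy yz.
  split => //; split.
  - rewrite leqNgt; apply/negP => h; apply: no; apply: toL => //; rewrite h andbT.
    by rewrite -(leq_add2r b); apply: leq_trans x1 (ltnW n1).
  - rewrite ltnNge; apply/negP => h; apply: no; apply: toR => //; rewrite h /=.
    by apply: ltn_trans n2 _; rewrite ltn_add2r.
  - rewrite leqNgt; apply/negP => h; apply: no; apply: toB => //; rewrite h andbT.
    by rewrite -(leq_add2r b); apply: leq_trans x3 (ltnW n3).
  - rewrite ltnNge; apply/negP => h; apply: no; apply: toT => //; rewrite h /=.
    by apply: ltn_trans n4 _; rewrite ltn_add2r.
case: (@arg_maxnP _ w (connect (cell_edge bad) w) (fun p : W => p.1 : nat) (connect0 _ _)) => p wp pmax.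
case: (@arg_minnP _ w (connect (cell_edge bad) w) (fun p : W => p.1 : nat) (connect0 _ _)) => p' wp' pmin.
have [pg [p1 p2 p3 p4]] := SQ p wp; have [pg' [p1' p2' p3' p4']] := SQ p' wp'.
have : (4 * #|quarter b| <= #|bad_cells bad|)%N; last by rewrite leqNgt few_bad.
(* A good cell near the component belongs to it, so beyond its extremal columns every near cell is
   bad. *)
have bd (s : W) x y : connect (cell_edge bad) w s -> ~~ bad s.1 s.2 -> (x < L.+1)%N -> (y < L.+1)%N ->
   near_cells b s.1 s.2 x y -> (p.1 < x)%N || (x < p'.1)%N -> bad x y.
  move=> ws sg hx hy hn hor; apply: contrapT => /negP h.
  have wt' : connect (cell_edge bad) w (inord x, inord y).
    by apply: connect_trans ws (connect1 _); rewrite /cell_edge /= !inordK // sg h.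
  have := pmax _ wt'; have := pmin _ wt'; rewrite /= !inordK // => m1 m2.
  by case/orP: hor => h1; have := leq_trans h1 _; [move/(_ _ m2)|move/(_ _ m1)]; rewrite ltnn.
have lo (x y : nat) : (2 * b <= x)%N -> (x + b <= y)%N -> (2 * b <= y)%N.
  by move=> h1 h2; apply: leq_trans h1 (leq_trans (leq_addr _ _) h2).
have hi (x y : nat) : (x < y)%N -> (y + 3 * b <= L.+1)%N -> (x + 2 * b <= L.+1)%N.
  by clear; lia.
apply: (@four_quarters_ext bad p p'); [exact: pmin|apply: lo xl2 _|apply: hi _ xrL|apply: lo yb2 _
  |apply: hi _ ytL|apply: lo xl2 _|apply: hi _ xrL|apply: lo yb2 _|apply: hi _ ytL| |] => //.
  by move=> x y hx hy hn h; apply: (bd p) => //; rewrite h.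
by move=> x y hx hy hn h; apply: (bd p') => //; rewrite h orbT.
Qed.
End FewBad.
End Window.

Local Open Scope ring_scope.

(** * Cover times of simple random walk *)

Section Walk.
Variables (R : realType) (T : finType) (adj : rel T).
Local Notation step := (srw_step R adj).

Lemma degE x : deg adj x = #|adj x|.
Proof. rewrite /deg; apply: eq_card => y; apply/idP/idP; by rewrite in_setE. Qed.

Lemma srw_step_ge0 x y : 0 <= step x y.
Proof. by rewrite /srw_step; case: ifP => _; rewrite ?divr_ge0 ?ler0n. Qed.

Lemma sum_srw_step x : \sum_y step x y = 1.
Proof.
case: (boolP (deg adj x == 0%N)) => [d0|d0].
  under eq_bigr do rewrite /srw_step d0.
  by rewrite (bigD1 x) //= eqxx big1 ?addr0 // => y; rewrite eq_sym => /negbTE->.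
under eq_bigr do rewrite /srw_step (negbTE d0).
rewrite -mulr_suml -natr_sum (_ : (\sum_y adj x y = deg adj x)%N) ?divff ?pnatr_eq0 //.
by rewrite degE -sum1_card [RHS]big_mkcond; apply: eq_bigr => y _; rewrite unfold_in; case: (adj x y).
Qed.

Lemma srw_step_sum x (g : T -> R) : (0 < deg adj x)%N ->
  \sum_z step x z * g z = (\sum_(z | adj x z) g z) / (deg adj x)%:R.
Proof.
move=> d0; rewrite [RHS]mulr_suml [RHS]big_mkcond /=; apply: eq_bigr => z _.
rewrite /srw_step gtn_eqF //; case: ifP => _; last by rewrite !mul0r.
by rewrite mul1r mulrC.
Qed.

(* [ncov t x S] is the probability that the walk from [x] has not visited all of [S] by time [t]. *)
Fixpoint ncov (t : nat) (x : T) (S : {set T}) : R :=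
  if t is t'.+1 then \sum_z step x z * ncov t' z (S :\ x)
  else (S :\ x != finset.set0)%:R.

Lemma covers_recl t (p : {ffun 'I_t.+2 -> T}) (S : {set T}) :
  [forall y in S, exists i, p i == y] =
  [forall y in S :\ p ord0, exists i : 'I_t.+1, p (lift ord0 i) == y].
Proof.
apply/forall_inP/forall_inP => H y.
  rewrite !inE => /andP[yp /H/existsP[i]].
  case: (unliftP ord0 i) => [j ->|-> /eqP e]; last by rewrite -e eqxx in yp.
  by move=> e; apply/existsP; exists j.
move=> yS; case: (eqVneq (p ord0) y) => [<-|ne]; first by apply/existsP; exists ord0.
have /existsP[i e] : [exists i : 'I_t.+1, p (lift ord0 i) == y].
  by apply: H; rewrite !inE eq_sym ne.
by apply/existsP; exists (lift ord0 i).
Qed.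

Definition ffcons t (x : T) (q : {ffun 'I_t.+1 -> T}) : {ffun 'I_t.+2 -> T} :=
  [ffun i => if unlift ord0 i is Some j then q j else x].
Definition fftail t (p : {ffun 'I_t.+2 -> T}) : {ffun 'I_t.+1 -> T} :=
  [ffun i => p (lift ord0 i)].

Lemma path_prob_ffcons t x (q : {ffun 'I_t.+1 -> T}) :
  path_prob R adj (ffcons x q) = step x (q ord0) * path_prob R adj q.
Proof.
have E (i : nat) (hi : (i < t.+1)%N) : ffcons x q (inord i.+1) = q (inord i).
  have -> : inord i.+1 = lift ord0 (inord i : 'I_t.+1) :> 'I_t.+2.
    by apply: val_inj; rewrite /= !inordK.
  by rewrite ffunE liftK.
rewrite /path_prob big_ord_recl /=; congr (_ * _).
  rewrite E //; have -> : inord 0 = ord0 :> 'I_t.+1.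
    by apply: val_inj; rewrite /= inordK.
  congr (step _ _).
  rewrite ffunE; have -> : inord 0 = ord0 :> 'I_t.+2.
    by apply: val_inj; rewrite /= inordK.
  by rewrite unlift_none.
by apply: eq_bigr => i _; have := ltn_ord i; rewrite /bump /= !add1n => hi; rewrite !E //; lia.
Qed.

(** This is the Markov property: splitting off the first vertex of a path removes it from the set
    still to be visited. The set is arbitrary because the recursion shrinks it. *)
Lemma sum_path_prob_ncov t v (S : {set T}) :
  \sum_(p : {ffun 'I_t.+1 -> T} | (p ord0 == v) && ~~ [forall y in S, exists i, p i == y])
     path_prob R adj p = ncov t v S.
Proof.
elim: t v S => [|t IH] v S.
  have pv (p : {ffun 'I_1 -> T}) : path_prob R adj p = 1 by rewrite /path_prob big_ord0.

  pose p0 : {ffun 'I_1 -> T} := [ffun=> v].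
  transitivity (\sum_(p : {ffun 'I_1 -> T} | p == p0) (S :\ v != finset.set0)%:R : R);
    last by rewrite big_pred1_eq.
  rewrite [LHS]big_mkcond [RHS]big_mkcond /=; apply: eq_bigr => p _; rewrite pv.
  case: (eqVneq p p0) => [->|pp0]; last first.
    case: eqP => //= e; case/eqP: pp0; apply/ffunP => i.
    by rewrite ffunE (ord1 i).
  rewrite ffunE eqxx /=.
  suff -> : [forall y in S, exists i, p0 i == y] = (S :\ v == finset.set0) by case: eqP.
  apply/forall_inP/eqP => [H|H y yS].
    apply/setP => y; rewrite !inE; apply/negP => /andP[yv /H/existsP[i]].
    by rewrite ffunE eq_sym (negbTE yv).
  apply/existsP; exists ord0; rewrite ffunE; apply/negPn/negP => ne.
  have yS' : y \in S :\ v by rewrite !inE yS eq_sym ne.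
  by rewrite H finset.in_set0 in yS'.
rewrite /=.
transitivity (\sum_z \sum_(q : {ffun 'I_t.+1 -> T} |
    (q ord0 == z) && ~~ [forall y in S :\ v, exists i, q i == y]) step v z * path_prob R adj q);
  last by apply: eq_bigr => z _; rewrite -mulr_sumr IH.
rewrite (reindex_onto (@ffcons t v) (@fftail t)) /=; last first.
  move=> p /andP[/eqP pv _]; apply/ffunP => i; rewrite ffunE.
  by case: unliftP => [j ->|->]; rewrite ?ffunE.
rewrite (eq_bigl (fun q : {ffun 'I_t.+1 -> T} => ~~ [forall y in S :\ v, exists i, q i == y])).
  rewrite (partition_big (fun q : {ffun 'I_t.+1 -> T} => q ord0) predT) //=.
  apply: eq_bigr => z _; rewrite (eq_bigl _ _ (fun q => andbC _ _)).
  by apply: eq_bigr => q /andP[/eqP <- _]; rewrite path_prob_ffcons.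
move=> q /=; have e0 : ffcons v q ord0 = v by rewrite ffunE unlift_none.
have -> : fftail (ffcons v q) = q by apply/ffunP => i; rewrite !ffunE liftK.
rewrite e0 !eqxx andbT /= covers_recl e0; congr (~~ _).
apply: eq_forallb => y; congr (_ ==> _); apply: eq_existsb => i.
by rewrite ffunE liftK.
Qed.

Lemma not_covered_prob_ncov v t : not_covered_prob R adj v t = ncov t v [set: T].
Proof.
rewrite -sum_path_prob_ncov; apply: eq_bigl => p; congr (_ && ~~ _).
by apply: eq_forallb => y; rewrite inE.
Qed.

Lemma ncov_ge0 t x S : 0 <= ncov t x S.
Proof.
elim: t x S => [|t IH] x S /=; first exact: ler0n.
by apply: sumr_ge0 => z _; rewrite mulr_ge0 ?srw_step_ge0.
Qed.

Lemma ncov_le1 t x S : ncov t x S <= 1.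
Proof.
elim: t x S => [|t IH] x S /=; first by case: (_ != _); rewrite ?ler01.
rewrite -(sum_srw_step x); apply: ler_sum => z _.
by rewrite ler_piMr ?srw_step_ge0.
Qed.

Lemma ncov_subset t x (S S' : {set T}) : S \subset S' -> ncov t x S <= ncov t x S'.
Proof.
elim: t x S S' => [|t IH] x S S' sS /=.
  rewrite ler_nat; case: (eqVneq (S' :\ x) finset.set0) => [e|_]; last by case: (_ != _).
  have : S :\ x \subset S' :\ x by exact: finset.setSD.
  by rewrite e finset.subset0 => ->.
apply: ler_sum => z _; rewrite ler_wpM2l ?srw_step_ge0 //; apply: IH; exact: finset.setSD.
Qed.

Lemma ncov_setD1 t x (S S' : {set T}) : S :\ x = S' :\ x -> ncov t x S = ncov t x S'.
Proof. by move=> e; case: t => [|t] /=; rewrite e. Qed.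

Lemma ncov_set0 t x : ncov t x finset.set0 = 0.
Proof.
elim: t x => [|t IH] x /=; first by rewrite finset.set0D eqxx.
by rewrite big1 // => z _; rewrite finset.set0D IH mulr0.
Qed.

(* [h y] dominates the mean hitting times of [y], and off [y] one step of the walk
   multiplies [1 + h y / K] by at most [lam]: geometric decay without restarts. *)
Section Upper.
Variables (h : T -> T -> R) (K : R).
Hypothesis K1 : 1 <= K.
Hypothesis h_ge0 : forall y x, 0 <= h y x.
Hypothesis h_le : forall y x, h y x <= K.
Hypothesis h_step : forall y x, x != y -> \sum_z step x z * h y z <= h y x - 1.
Let lam : R := 1 - (2 * K)^-1.

Let K0 : 0 < K. Proof. exact: lt_le_trans K1. Qed.

Let lam_ge0 : 0 <= lam.
Proof.
have K2 : 0 < 2 * K by rewrite mulr_gt0.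
by rewrite /lam subr_ge0 invf_le1 //; move: K1; lra.
Qed.

Lemma ncov_le_sum t x (S : {set T}) :
  ncov t x S <= \sum_(y in S :\ x) (1 + h y x / K) * lam ^+ t.
Proof.
have w1 y z : 1 <= 1 + h y z / K by rewrite lerDl divr_ge0 // ltW.
elim: t x S => [|t IH] x S /=.
  case: (set_0Vmem (S :\ x)) => [->|[y yS]]; first by rewrite eqxx big_set0.
  have -> : S :\ x != finset.set0 by apply/set0Pn; exists y.
  rewrite (bigD1 y) //= expr0 mulr1; apply: (le_trans (w1 y x)); rewrite lerDl.
  by apply: sumr_ge0 => z _; rewrite mulr1; apply: le_trans (w1 z x); exact: ler01.
apply: (@le_trans _ _ (\sum_z step x z * \sum_(y in S :\ x) (1 + h y z / K) * lam ^+ t)).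
  apply: ler_sum => z _; rewrite ler_wpM2l ?srw_step_ge0 //.
  apply: (le_trans (IH _ _)).
  rewrite [leRHS](big_setID [set z]) /= lerDr; apply: sumr_ge0 => y _.
  by rewrite mulr_ge0 ?exprn_ge0 // (le_trans ler01).
rewrite (eq_bigr _ (fun z _ => mulr_sumr _ _ _ _)).
rewrite exchange_big /=; apply: ler_sum => y; rewrite !inE => /andP[yx _].
under eq_bigr do rewrite mulrA.
rewrite -mulr_suml exprS mulrA ler_wpM2r ?exprn_ge0 //.
have -> : \sum_z step x z * (1 + h y z / K) = 1 + (\sum_z step x z * h y z) / K.
  under eq_bigr do rewrite mulrDr mulr1 mulrA.
  by rewrite big_split /= sum_srw_step -mulr_suml.
have xy : x != y by rewrite eq_sym.
have := h_step xy; move: (\sum_z _) => s hs.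
(* One step costs the weight [1 + h y x / K] an amount [1 / K]; as the weight is at most 2, this is
   at least its fraction [1 / (2 * K)]. *)
have hh : s / K <= h y x / K - K^-1.
  have -> : h y x / K - K^-1 = (h y x - 1) / K by rewrite mulrBl mul1r.
  by rewrite ler_pM2r ?invr_gt0.
have hK1 : h y x / K <= 1 by rewrite ler_pdivrMr // mul1r.
rewrite /lam invfM.
have iK : 0 < K^-1 by rewrite invr_gt0.
move: hh hK1; move: (h y x / K) (s / K) (K^-1) iK => a c k k0 h1 h2; nra.
Qed.

Lemma ncov_le_geom t x S : ncov t x S <= 2 * #|T|%:R * lam ^+ t.
Proof.
apply: (le_trans (ncov_le_sum t x S)).
apply: (@le_trans _ _ (\sum_(y in S :\ x) 2 * lam ^+ t)).
  apply: ler_sum => y _; rewrite ler_wpM2r ?exprn_ge0 //.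
  by have : h y x / K <= 1; [rewrite ler_pdivrMr // mul1r|lra].
rewrite sumr_const -[leLHS]mulr_natr mulrAC ler_wpM2r ?exprn_ge0 //.
by rewrite ler_pM2l // ler_nat max_card.
Qed.

(** Up to a time [t0] near [2 * K * ln #|T|] the probabilities are bounded by 1. Afterwards the
    factor [#|T|] has been used up, and the rest is a geometric series [2 * lam ^+ i] of sum at most
    [4 * K]. *)
Lemma exp_cover_time_le v : (0 < #|T|)%N ->
  (exp_cover_time R adj v <= (2 * K * ln #|T|%:R + 1 + 4 * K)%:E)%E.
Proof.
move=> T0; rewrite /exp_cover_time.
have lnT : 0 <= ln (#|T|%:R : R) by rewrite ln_ge0 // ler1n.
have aux0 : 0 <= 2 * K * ln (#|T|%:R : R) by rewrite mulr_ge0 // mulr_ge0 // ltW.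
have [t0 t0lo t0hi] : exists2 t0 : nat, 2 * K * ln #|T|%:R <= t0%:R & t0%:R <= 2 * K * ln #|T|%:R + 1.
  exists (Num.truncn (2 * K * ln (#|T|%:R : R))).+1; first by rewrite ltW // truncnS_gt.
  by rewrite -natr1 lerD2r truncn_le.
have lamt0 : #|T|%:R * lam ^+ t0 <= 1.
  have l1 : lam <= expR (- (2 * K)^-1) by apply: le_trans (expR_ge1Dx _); rewrite /lam.
  have : lam ^+ t0 <= expR (- (2 * K)^-1) ^+ t0 by rewrite lerXn2r // nnegrE // expR_ge0.
  rewrite -expRM_natr => l2.
  have l3 : expR (- (2 * K)^-1 * t0%:R) <= expR (- ln #|T|%:R).
    rewrite ler_expR mulNr lerN2 mulrC ler_pdivlMr ?mulr_gt0 //; first by rewrite mulrC.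
  have := le_trans l2 l3; rewrite expRN lnK ?posrE ?ltr0n // => l4.
  by rewrite mulrC -ler_pdivlMr ?ltr0n // mul1r.
apply: lime_le.
  by apply: is_cvg_nneseries => n _ _; rewrite lee_fin not_covered_prob_ncov ncov_ge0.
apply: nearW => n; rewrite sumEFin lee_fin.
under eq_bigr do rewrite not_covered_prob_ncov.
have geo k : \sum_(0 <= i < k) lam ^+ i <= 2 * K.
  have := subrX1 lam k; rewrite big_mkord => e.
  have lam1 : lam - 1 = - (2 * K)^-1 by rewrite /lam addrAC subrr add0r.
  have iK : 0 < (2 * K)^-1 by rewrite invr_gt0 mulr_gt0.
  have lk : 0 <= lam ^+ k by rewrite exprn_ge0.
  have -> : \sum_(i < k) lam ^+ i = 2 * K * (1 - lam ^+ k).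

    have kn : 2 * K != 0 by rewrite gt_eqF // mulr_gt0.
    have h1 : (2 * K) * (lam ^+ k - 1) = - \sum_(i < k) lam ^+ i.
      by rewrite e lam1 !mulNr mulrN mulVKf.
    by rewrite -opprB mulrN h1 opprK.
  by rewrite ler_piMr ?gerBl // mulr_ge0 // ltW.
have split k : \sum_(0 <= i < t0 + k) ncov i v [set: T] <= t0%:R + 4 * K.
  rewrite (@big_cat_nat _ _ _ t0) //= ?leq_addr //; apply: lerD.
    apply: (@le_trans _ _ (\sum_(0 <= i < t0) 1)); first by apply: ler_sum => i _; exact: ncov_le1.
    by rewrite sumr_const_nat subn0.
  rewrite -{1}[t0]add0n big_addn addKn.
  apply: (@le_trans _ _ (\sum_(0 <= i < k) 2 * lam ^+ i)).
    apply: ler_sum => i _; apply: (le_trans (ncov_le_geom _ _ _)).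
    have -> : 2 * #|T|%:R * lam ^+ (i + t0) = 2 * (#|T|%:R * lam ^+ t0 * lam ^+ i).
      by rewrite addnC exprD -!mulrA.
    rewrite ler_pM2l // -[leRHS]mul1r ler_wpM2r // exprn_ge0 //.
  by rewrite -mulr_sumr (_ : 4 * K = 2 * (2 * K)) ?ler_pM2l // mulrA -natrM.
apply: (@le_trans _ _ (\sum_(0 <= i < t0 + n) ncov i v [set: T])).
  rewrite (@big_cat_nat _ _ _ n 0 (t0 + n)) //= ?leq_addl // lerDl.
  by apply: sumr_ge0 => i _; exact: ncov_ge0.
by apply: (le_trans (split n)); rewrite lerD2r.
Qed.
End Upper.
End Walk.

(** * Matthews' lower bound for truncated cover times *)

Section Matthews.
Variables (R : realType) (T : finType) (adj : rel T).
Local Notation step := (srw_step R adj).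
Local Notation ncov := (ncov R adj).

(** The expectation of the cover time of [S] truncated at [t]. Truncation keeps it finite, so that
    two of them can be subtracted. *)
Definition ecov (t : nat) (x : T) (S : {set T}) : R := \sum_(s < t) ncov s x S.

Lemma ecovS t x S :
  ecov t.+1 x S = (S :\ x != finset.set0)%:R + \sum_z step x z * ecov t z (S :\ x).
Proof.
rewrite /ecov big_ord_recl /=; congr (_ + _).
under [RHS]eq_bigr do rewrite mulr_sumr.
by rewrite exchange_big.
Qed.

Lemma ecov_ge0 t x S : 0 <= ecov t x S.
Proof. by apply: sumr_ge0 => s _; exact: ncov_ge0. Qed.

Lemma ecov_mono t t' x S : (t <= t')%N -> ecov t x S <= ecov t' x S.
Proof.
move=> /subnKC <-; rewrite /ecov big_split_ord /= lerDl.
by apply: sumr_ge0 => s _; exact: ncov_ge0.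
Qed.

Lemma ecov_setD1 t x (S S' : {set T}) : S :\ x = S' :\ x -> ecov t x S = ecov t x S'.
Proof. by move=> e; apply: eq_bigr => s _; exact: ncov_setD1. Qed.

Lemma ecov_set0 t x : ecov t x finset.set0 = 0.
Proof. by rewrite /ecov big1 // => s _; exact: ncov_set0. Qed.

(* The probability that by time [t] the walk from [x] has visited all of [S] but [y]. *)
Fixpoint lastv (y : T) (t : nat) (x : T) (S : {set T}) : R :=
  if (x == y) || (y \notin S) then 0
  else if S \subset [set x; y] then 1
  else if t is t'.+1 then \sum_z step x z * lastv y t' z (S :\ x) else 0.

Lemma lastv_ge0 y t x S : 0 <= lastv y t x S.
Proof.
elim: t x S => [|t IH] x S /=; case: ifP => // _; case: ifP => // _.
by apply: sumr_ge0 => z _; rewrite mulr_ge0 ?srw_step_ge0.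
Qed.

(* Once the walk has visited all of [S] but [y], it still has to reach [y] from a
   point of [A], which takes at least [theta]. *)
Lemma ecov_setD1_ge (A : {set T}) y theta t0 (ht : forall a, a \in A -> a != y -> theta <= ecov t0 a [set y])
  t x (S : {set T}) : S \subset A -> (x \in A) || ~~ (S \subset [set x; y]) ->
  theta * lastv y t x S <= ecov (t + t0) x S - ecov (t + t0) x (S :\ y).
Proof.
elim: t x S => [|t IH] x S SA xA /=.
all: case: ifPn => [/orP[/eqP->|yS]|].
1,4: rewrite mulr0 subr_ge0 (@ecov_setD1 _ y (S :\ y) S) //; apply/setP => z; rewrite !inE; by case: (z == y).
1,3: rewrite mulr0 subr_ge0 (_ : S :\ y = S) //; apply/setP => z; rewrite !inE; case: eqP => // ->; exact/esym/negbTE.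
all: rewrite negb_or negbK => /andP[xy yS]; case: ifPn => Sxy.
1,3: rewrite mulr1; have xA' : x \in A by move: xA; rewrite Sxy orbF.
1,2: have e1 : S :\ x = [set y] :\ x.
1,3: apply/setP => z; rewrite !inE; case: eqP => //= zx; apply/idP/eqP => [zS|->//];
  by move/fintype.subsetP: Sxy => /(_ z zS); rewrite !inE (introF eqP zx) => /eqP.
1,2: have e2 : (S :\ y) :\ x = finset.set0 :\ x.
1,3: apply/setP => z; rewrite !inE; case: eqP => //= zx; apply/negP => /andP[zy zS];
  by move/fintype.subsetP: Sxy => /(_ z zS); rewrite !inE (introF eqP zx) (negbTE zy).
1,2: rewrite (ecov_setD1 _ e1) (ecov_setD1 _ e2) ecov_set0 subr0.
1,2: by apply: le_trans (ht _ xA' xy) (ecov_mono _ _ _); rewrite ?add0n ?leq_addl.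
- rewrite mulr0 subr_ge0; apply: ler_sum => s _; apply: ncov_subset; exact: finset.subsetDl.
have [w wS] : exists2 w, w \in S & w \notin [set x; y].
  by move/fintype.subsetPn: Sxy => [w]; exists w.
rewrite !inE negb_or => /andP[wx wy].
rewrite addSn !ecovS.
have -> : S :\ x != finset.set0 by apply/set0Pn; exists w; rewrite !inE wx.
have -> : S :\ y :\ x != finset.set0 by apply/set0Pn; exists w; rewrite !inE wx wy.
rewrite opprD addrACA subrr add0r -sumrB mulr_sumr; apply: ler_sum => z _.
rewrite mulrCA -mulrBr ler_wpM2l ?srw_step_ge0 //.
have -> : S :\ y :\ x = S :\ x :\ y by apply/setP => u; rewrite !inE andbCA.
apply: IH; first by apply: fintype.subset_trans SA; exact: finset.subsetDl.
(* If the walk has just completed all of [S] but [y] at [z], then [z] is the remaining point [w] of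
   [S], hence lies in [A]: the condition on the starting point is restored. *)
case: (boolP (S :\ x \subset [set z; y])) => [/fintype.subsetP H|]; last by rewrite orbT.
have : w \in [set z; y] by apply: H; rewrite !inE wx.
rewrite !inE (negbTE wy) orbF => /eqP <-.
by rewrite (fintype.subsetP SA).
Qed.

(** If [S] is covered by time [t], some vertex [y] of [S :\ x] was visited last, and before that
    visit all of [S] but [y] had been visited. Summing over the candidates for [y] gives at least
    the probability of covering. *)
Lemma sum_lastv t x (S : {set T}) : S :\ x != finset.set0 ->
  1 - ncov t x S <= \sum_(y in S :\ x) lastv y t x S.
Proof.
elim: t x S => [|t IH] x S S0.
  by rewrite /= S0 subrr; apply: sumr_ge0 => y _; exact: (lastv_ge0 y 0).
case: (set_0Vmem (S :\ x)) => [e|[y yS]]; first by rewrite e eqxx in S0.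
have := yS; rewrite !inE => /andP[yx yS'].
case: (boolP (S \subset [set x; y])) => Sxy.
  rewrite (bigD1 y) //= eq_sym (negbTE yx) yS' /= Sxy.
  apply: ler_wpDr; last by rewrite gerBl; exact: (ncov_ge0 R adj t.+1).
  by apply: sumr_ge0 => z _; exact: (lastv_ge0 z t.+1).
have nS z : z \in S :\ x -> ~~ (S \subset [set x; z]).
  rewrite !inE => /andP[zx zS]; case: (eqVneq z y) => [->//|zy].
  apply/fintype.subsetPn; exists y => //; by rewrite !inE (negbTE yx) eq_sym (negbTE zy).
have -> : \sum_(z in S :\ x) lastv z t.+1 x S =
          \sum_u step x u * \sum_(z in S :\ x) lastv z t u (S :\ x).
  under [RHS]eq_bigr do rewrite mulr_sumr.
  rewrite [RHS]exchange_big /=; apply: eq_bigr => z zS.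
  have := zS; rewrite !inE => /andP[zx zS'].
  by rewrite eq_sym (negbTE zx) zS' /= (negbTE (nS z zS)).
rewrite /= -{1}(sum_srw_step R adj x) -sumrB; apply: ler_sum => u _.
rewrite -{1}[step x u]mulr1 -mulrBr ler_wpM2l ?srw_step_ge0 //.
have u0 : S :\ x :\ u != finset.set0.
  apply/set0Pn; case: (eqVneq y u) => [yu|yu]; last by exists y; rewrite !inE yu yx.
  move/fintype.subsetPn: (nS y yS) => [w wS]; rewrite !inE negb_or => /andP[wx wy].
  by exists w; rewrite !inE -yu wy wx.
apply: (le_trans (IH _ _ u0)).
rewrite [leRHS](big_setID [set u]) /= lerDr.
by apply: sumr_ge0 => z _; exact: lastv_ge0.
Qed.

(** Adding back [y] costs [theta] times the probability that [y] comes last. These probabilities sum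
    to at least 1/2, so averaging over the [k.+1] choices of [y] gains [theta / (2 * k.+1)].
    Averaging replaces the random order in Matthews' proof. One [t0] is allowed for visiting all but
    [y], the other for reaching [y]. *)
Lemma ecov_ge_harmonic (A : {set T}) (theta : R) t0
  (theta0 : (0 : R) <= theta)
  (ht : forall y a, y \in A -> a \in A -> a != y -> theta <= ecov t0 a [set y])
  (hn : forall x (S : {set T}), ncov t0 x S <= 2^-1) k :
  forall x (S : {set T}), x \in A -> S \subset A -> #|S :\ x| = k ->
  theta / 2 * \sum_(j < k) j.+1%:R^-1 <= ecov (t0 + t0) x S.
Proof.
elim: k => [|k IH] x S xA SA Sk; first by rewrite big_ord0 mulr0 ecov_ge0.
have S0 : S :\ x != finset.set0 by rewrite -card_gt0 Sk.
set H := theta / 2 * _.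
have key y : y \in S :\ x -> theta / 2 * \sum_(j < k) j.+1%:R^-1 + theta * lastv y t0 x S
     <= ecov (t0 + t0) x S.
  move=> yS; have := yS; rewrite !inE => /andP[yx yS'].
  have yA : y \in A by exact: (fintype.subsetP SA).
  have h1 := @ecov_setD1_ge A y theta t0 (fun a => @ht y a yA) t0 x S SA.
  rewrite xA /= in h1; have {}h1 := h1 isT.
  have h2 : theta / 2 * \sum_(j < k) j.+1%:R^-1 <= ecov (t0 + t0) x (S :\ y).
    apply: IH => //; first by apply: fintype.subset_trans SA; exact: finset.subsetDl.
    have := cardsD1 y (S :\ x); rewrite yS Sk add1n => -[->]; congr #|pred_of_set _|.
    by apply/setP => u; rewrite !inE andbCA.
  by move: h1 h2; lra.
have : \sum_(y in S :\ x) (theta / 2 * \sum_(j < k) j.+1%:R^-1 + theta * lastv y t0 x S) <=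
       \sum_(y in S :\ x) ecov (t0 + t0) x S by apply: ler_sum.
rewrite big_split /= !sumr_const Sk -mulr_sumr => h.
have h3 := sum_lastv t0 S0; have h4 := hn x S.
rewrite /H big_ord_recr /=.
have k0 : (0 : R) < k.+1%:R by rewrite ltr0n.
have h5 : theta / 2 <= theta * \sum_(y in S :\ x) lastv y t0 x S.
  by rewrite ler_wpM2l //; lra.
rewrite -(ler_pM2l k0).
have e : k.+1%:R * (k.+1%:R^-1 : R) = 1 by rewrite divff // gt_eqF.
have -> : k.+1%:R * (theta / 2 * (\sum_(i < k) i.+1%:R^-1 + k.+1%:R^-1)) =
   k.+1%:R * (theta / 2 * \sum_(i < k) i.+1%:R^-1) + theta / 2 * (k.+1%:R * k.+1%:R^-1) by ring.
rewrite e mulr1 mulr_natl [leRHS]mulr_natl.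
by apply: le_trans h; rewrite lerD2l.
Qed.

(** Optional stopping at time [t]: on the event that [y] has not been hit by then, the value of [h]
    still outstanding is at most [K]. *)
Lemma ecov_hitting (h : T -> R) (K : R) y : h y = 0 -> (forall x, h x <= K) ->
  (forall x, x != y -> h x <= 1 + \sum_z step x z * h z) ->
  forall t x, h x <= ecov t x [set y] + K * ncov t x [set y].
Proof.
move=> hy hK hs; elim=> [|t IH] x.
  rewrite /ecov big_ord0 add0r /=; case: (eqVneq x y) => [->|xy].
    by rewrite hy mulr_ge0 // -hy.
  rewrite (_ : [set y] :\ x != finset.set0) ?mulr1 //.
  by apply/set0Pn; exists y; rewrite !inE eq_sym xy eqxx.
case: (eqVneq x y) => [->|xy].
  by rewrite hy addr_ge0 ?ecov_ge0 // mulr_ge0 ?ncov_ge0 // -hy.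
apply: (le_trans (hs x xy)); rewrite ecovS.
have -> : [set y] :\ x = [set y].
  by apply/setP => z; rewrite !inE; case: eqVneq => //= ->; rewrite (negbTE xy).
have -> : [set y] != finset.set0 by apply/set0Pn; exists y; rewrite !inE.
rewrite /= (_ : [set y] :\ x = [set y]); last first.
  by apply/setP => z; rewrite !inE; case: eqVneq => //= ->; rewrite (negbTE xy).
rewrite -addrA lerD2l mulr_sumr -big_split /=; apply: ler_sum => z _.
by rewrite mulrCA -mulrDr ler_wpM2l ?srw_step_ge0.
Qed.

Lemma ecov_le_exp_cover_time t x S : ((ecov t x S)%:E <= exp_cover_time R adj x)%E.
Proof.
rewrite /exp_cover_time; apply: (@le_trans _ _ (\sum_(0 <= i < t) (not_covered_prob R adj x i)%:E)%E).
  rewrite sumEFin lee_fin /ecov big_mkord; apply: ler_sum => i _.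
  by rewrite not_covered_prob_ncov; apply: ncov_subset; apply/fintype.subsetP => z; rewrite inE.
by apply: nneseries_lim_ge => n _ _; rewrite lee_fin not_covered_prob_ncov ncov_ge0.
Qed.

End Matthews.

Lemma ln_le_harmonic (R : realType) k : ln (k.+1%:R : R) <= \sum_(j < k) j.+1%:R^-1.
Proof.
elim: k => [|k IH]; first by rewrite ln1 big_ord0.
rewrite big_ord_recr /=; apply: le_trans (lerD IH (lexx _)).
have k0 : (0 : R) < k.+1%:R^-1 by rewrite invr_gt0.
have -> : (k.+2%:R : R) = k.+1%:R * (1 + k.+1%:R^-1).
  by rewrite mulrDr mulr1 divff // natr1.
rewrite lnM ?posrE ?ltr0n // ?addr_gt0 // lerD2l le_ln1Dx //.
by apply: lt_trans k0; rewrite ltrN10.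
Qed.

Lemma harmonic_le_ln (R : realType) k : \sum_(j < k) j.+2%:R^-1 <= ln (k.+1%:R : R).
Proof.
elim: k => [|k IH]; first by rewrite ln1 big_ord0.
rewrite big_ord_recr /=; apply: (le_trans (lerD IH (lexx _))).
have k0 : (0 : R) < k.+2%:R^-1 by rewrite invr_gt0.
have k1 : k.+2%:R^-1 < (1 : R) by rewrite invf_lt1 ?ltr1n.
have -> : (k.+1%:R : R) = k.+2%:R * (1 - k.+2%:R^-1).
  by rewrite mulrBr mulr1 divff // -[k.+2%:R]natr1 addrK.
rewrite lnM ?posrE ?ltr0n // ?subr_gt0 // -addrA gerDl -lerBrDr sub0r.
by rewrite le_ln1Dx // ltrN2.
Qed.

(** * Electrical network bounds *)

(** By Lagrange's identity the difference of the two sides is half a double sum of the squares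
    [(a i - a j) ^+ 2]. *)
Lemma weighted_cauchy_schwarz (R : realFieldType) (I : finType) (P : pred I) (w a : I -> R) :
  (forall i, P i -> 0 <= w i) ->
  (\sum_(i | P i) w i * a i) ^+ 2 <= (\sum_(i | P i) w i) * \sum_(i | P i) w i * a i ^+ 2.
Proof.
move=> w0.
have : 0 <= \sum_(i | P i) \sum_(j | P j) w i * w j * (a i - a j) ^+ 2.
  apply: sumr_ge0 => i Pi; apply: sumr_ge0 => j Pj; apply: mulr_ge0 (sqr_ge0 _).
  by rewrite mulr_ge0 ?w0.
have -> : \sum_(i | P i) \sum_(j | P j) w i * w j * (a i - a j) ^+ 2 =
  2 * ((\sum_(i | P i) w i) * \sum_(i | P i) w i * a i ^+ 2 - (\sum_(i | P i) w i * a i) ^+ 2).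
  set S0 := \sum_(i | P i) w i; set S1 := \sum_(i | P i) w i * a i.
  set S2 := \sum_(i | P i) w i * a i ^+ 2.
  have -> : 2 * (S0 * S2 - S1 ^+ 2) = S0 * S2 + S2 * S0 - 2 * (S1 * S1) by ring.
  rewrite !big_distrlr /= mulr_sumr -big_split -sumrB /=; apply: eq_bigr => i _.
  by rewrite mulr_sumr -big_split -sumrB /=; apply: eq_bigr => j _; ring.
lra.
Qed.

Lemma cauchy_schwarz_card (R : realFieldType) (I : finType) (P : pred I) (a : I -> R) :
  (\sum_(i | P i) a i) ^+ 2 <= #|P|%:R * \sum_(i | P i) a i ^+ 2.
Proof.
have := @weighted_cauchy_schwarz R I P (fun=> 1) a (fun _ _ => ler01).
under eq_bigr do rewrite mul1r.
under [X in _ <= _ * X]eq_bigr do rewrite mul1r.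
by rewrite sumr_const.
Qed.

Section Network.
Variables (R : realType) (m : nat) (adj : rel 'I_m).
Hypothesis adj_sym : symmetric adj.
Hypothesis deg_gt0 : forall x, (0 < deg adj x)%N.
Implicit Types (g h : 'I_m -> R).

Definition lap h x := \sum_(y | adj x y) (h x - h y).
(** Every edge is counted in both orientations, so [dform h h] is twice the usual energy; hence the
    factors 2 below. *)
Definition dform g h := \sum_x \sum_(y | adj x y) (g x - g y) * (h x - h y).

Lemma dformC g h : dform g h = dform h g.
Proof. by apply: eq_bigr => x _; apply: eq_bigr => y _; rewrite mulrC. Qed.

Lemma dform_lap g h : dform g h = 2 * \sum_x g x * lap h x.
Proof.
rewrite /dform /lap.
have e : \sum_x \sum_(y | adj x y) g y * (h x - h y) = - \sum_x \sum_(y | adj x y) g x * (h x - h y).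
  rewrite (exchange_big_dep predT) //= -sumrN; apply: eq_bigr => x _.
  rewrite -sumrN; apply: eq_big => [y|y _]; first by rewrite adj_sym.
  by rewrite -mulrN opprB.
under eq_bigr do under eq_bigr do rewrite mulrBl.
under eq_bigr do rewrite sumrB.
rewrite sumrB e opprK mulr_natl mulr2n.
by congr (_ + _); apply: eq_bigr => x _; rewrite mulr_sumr.
Qed.

Lemma dform_local h x : \sum_(y | adj x y) (h x - h y) ^+ 2 <= dform h h.
Proof.
rewrite /dform [leRHS](bigD1 x) //=; apply: ler_wpDr.
  by apply: sumr_ge0 => z _; apply: sumr_ge0 => y _; rewrite -expr2 sqr_ge0.
by apply: ler_sum => y _; rewrite expr2.
Qed.

Lemma sum_lap h : \sum_x lap h x = 0.
Proof.
have := dform_lap (fun=> 1) h; rewrite /dform.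
rewrite big1 => [|x _]; last by rewrite big1 // => y _; rewrite subrr mul0r.
by under [X in 2 * X]eq_bigr do rewrite mul1r; lra.
Qed.

Lemma lapE h x : lap h x = (deg adj x)%:R * h x - \sum_(y | adj x y) h y.
Proof.
rewrite /lap sumrB sumr_const degE -[X in X - _]mulr_natl; congr (_%:R * _ - _).
Qed.

Lemma step_lap h x : \sum_z srw_step R adj x z * h z = h x - lap h x / (deg adj x)%:R.
Proof.
rewrite srw_step_sum // lapE mulrBl mulrAC divff ?mul1r ?opprB 1?addrC ?subrK //.
by rewrite pnatr_eq0 -lt0n.
Qed.

Definition total_deg : R := \sum_x (deg adj x)%:R.

Lemma total_deg_ge0 : 0 <= total_deg.
Proof. by apply: sumr_ge0 => x _; exact: ler0n. Qed.

(** * Hitting and commute times as solutions of Laplace equations *)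

Section Resistance.
Variable Rf : R.
Hypothesis Rf_ge0 : 0 <= Rf.
Hypothesis resistance : forall h x y, (h x - h y) ^+ 2 <= Rf * dform h h.

(** Off [v], the equation says that [h x] is 1 plus the mean of [h] over the neighbours of [x]. The
    square linear system is solvable because it is injective: a solution of the homogeneous system
    has energy zero, so by the resistance bound it is constant, and it vanishes at [v]. *)
Lemma exists_hitting v : exists h, h v = 0 /\ forall x, x != v -> lap h x = (deg adj x)%:R.
Proof.
pose A : 'M[R]_m := \matrix_(i, x) (if x == v then (i == v)%:R
   else (i == x)%:R * (deg adj x)%:R - (adj x i)%:R).
have AE (u : 'rV[R]_m) x : (u *m A) ord0 x =
    if x == v then u ord0 v else lap (fun y => u ord0 y) x.
  rewrite !mxE; case: eqVneq => [->|xv].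
    under eq_bigr do rewrite !mxE eqxx.
    rewrite (bigD1 v) //= eqxx mulr1 big1 ?addr0 // => i /negbTE->; by rewrite mulr0.
  under eq_bigr do rewrite !mxE (negbTE xv) mulrBr.
  rewrite sumrB lapE; congr (_ - _).
    rewrite (bigD1 x) //= eqxx mul1r big1 ?addr0 1?mulrC // => i /negbTE->.
    by rewrite mul0r mulr0.
  rewrite [RHS]big_mkcond; apply: eq_bigr => i _.
  by case: (adj x i); rewrite ?mulr1 ?mulr0.
have Aunit : A \in unitmx.
  rewrite -row_free_unit -kermx_eq0; apply/rowV0P => u /sub_kermxP uA.
  have u0 x : (u *m A) ord0 x = 0 by rewrite uA mxE.
  have uv : u ord0 v = 0 by have := u0 v; rewrite AE eqxx.
  have D0 : dform (fun y => u ord0 y) (fun y => u ord0 y) = 0.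
    rewrite dform_lap big1 ?mulr0 // => x _.
    case: (eqVneq x v) => [->|xv]; first by rewrite uv mul0r.
    by have := u0 x; rewrite AE (negbTE xv) => ->; rewrite mulr0.
  apply/rowP => x; rewrite mxE.
  have := resistance (fun y => u ord0 y) x v; rewrite D0 mulr0 uv subr0 => le0.
  by apply/eqP; rewrite -sqrf_eq0 eq_le le0 sqr_ge0.
pose b : 'rV[R]_m := \row_x (if x == v then 0 else (deg adj x)%:R).
pose u := b *m invmx A.
have uA : u *m A = b by rewrite mulmxKV.
exists (fun y => u ord0 y); split.
  by have := AE u v; rewrite uA mxE eqxx.
by move=> x xv; have := AE u x; rewrite uA mxE (negbTE xv).
Qed.

Definition hit v : 'I_m -> R := projT1 (cid (exists_hitting v)).

Lemma hit_self v : hit v v = 0.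
Proof. by case: (projT2 (cid (exists_hitting v))). Qed.

(** The value at [v] is forced, since a Laplacian sums to zero. *)
Lemma lap_hit v x : lap (hit v) x = (deg adj x)%:R - total_deg * (x == v)%:R.
Proof.
have H y : y != v -> lap (hit v) y = (deg adj y)%:R.
  by case: (projT2 (cid (exists_hitting v))) => _; apply.
case: (eqVneq x v) => [->|xv]; last by rewrite mulr0 subr0 H.
rewrite mulr1.
have := sum_lap (hit v); rewrite (bigD1 v) //= (eq_bigr _ (fun y yv => H y yv)).
by rewrite /total_deg [X in _ - X](bigD1 v) //=; lra.
Qed.

Lemma hit_step v x : x != v -> \sum_z srw_step R adj x z * hit v z = hit v x - 1.
Proof.
move=> xv; rewrite step_lap lap_hit (negbTE xv) mulr0 subr0 divff //.
by rewrite pnatr_eq0 -lt0n.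
Qed.

(** Minimum principle: at a minimum the Laplacian is at most 0, whereas off [v] it equals the
    positive degree. *)
Lemma hit_ge0 v x : 0 <= hit v x.
Proof.
case: (@arg_minP _ _ _ v xpredT (hit v) isT) => x0 _ x0min.
case: (eqVneq x0 v) => [e|ne]; first by have := x0min x isT; rewrite e hit_self.
have := lap_hit v x0; rewrite (negbTE ne) mulr0 subr0 => e.
have : lap (hit v) x0 <= 0.
  by apply: sumr_le0 => y _; rewrite subr_le0 x0min.
by rewrite e lern0 eqn0Ngt deg_gt0.
Qed.

(* The energy of [h = hit v] is [2 <h, lap h>], at most [2 * max h * total_deg]. *)
Lemma hit_le v x : hit v x <= 2 * Rf * total_deg.
Proof.
case: (@arg_maxP _ _ _ v xpredT (hit v) isT) => x0 _ x0max.
have {}x0max y : hit v y <= hit v x0 by exact: x0max.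
apply: (le_trans (x0max x)).
have := resistance (hit v) x0 v; rewrite hit_self subr0 dform_lap.
move=> h1.
have h2 : \sum_y hit v y * lap (hit v) y <= hit v x0 * total_deg.
  rewrite /total_deg mulr_sumr; apply: ler_sum => y _; rewrite lap_hit.
  case: (eqVneq y v) => [->|yv]; first by rewrite hit_self mul0r mulr_ge0 ?hit_ge0.
  by rewrite mulr0 subr0 ler_wpM2r ?x0max.
case: (eqVneq (hit v x0) 0) => [->|ne].
  by rewrite mulr_ge0 ?total_deg_ge0 // mulr_ge0.
have p : 0 < hit v x0 by rewrite lt_neqAle eq_sym ne hit_ge0.
rewrite -(ler_pM2r p) -expr2; apply: (le_trans h1).
have := ler_wpM2l (mulr_ge0 (ler0n R 2) Rf_ge0) h2; lra.
Qed.

(** The mean hitting time of [u] from the stationary distribution, which is proportional to the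
    degree. *)
Definition pot u := (\sum_x (deg adj x)%:R * hit u x) / total_deg.

Lemma total_deg_gt0 (v : 'I_m) : 0 < total_deg.
Proof.
rewrite /total_deg (bigD1 v) //=; apply: ltr_pwDl; rewrite ?ltr0n ?deg_gt0 //.
by apply: sumr_ge0.
Qed.

Lemma pot_ge0 u : 0 <= pot u.
Proof.
by rewrite /pot divr_ge0 ?sumr_ge0 // => x _; rewrite mulr_ge0 ?hit_ge0.
Qed.

Lemma pot_le u K : (forall x, hit u x <= K) -> pot u <= K.
Proof.
move=> hK; rewrite /pot ler_pdivrMr ?total_deg_gt0 // mulr_sumr.
by apply: ler_sum => x _; rewrite mulrC ler_wpM2r.
Qed.

(** Green's identity: pairing [hit u] with the Laplacian of [hit v] is symmetric in [u] and [v]. *)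
Lemma hit_sub u v : hit u v - hit v u = pot u - pot v.
Proof.
have D0 := total_deg_gt0 u.
have := dformC (hit u) (hit v); rewrite !dform_lap.
under eq_bigr do rewrite lap_hit mulrBr mulrCA.
under [X in _ = _ * X]eq_bigr do rewrite lap_hit mulrBr mulrCA.
rewrite !sumrB -!mulr_sumr.
have e (w z : 'I_m) : \sum_i hit w i * (i == z)%:R = hit w z.
  rewrite (bigD1 z) //= eqxx mulr1 big1 ?addr0 // => i /negbTE->; by rewrite mulr0.
rewrite !e => H.
rewrite /pot -mulrBl; apply/eqP; rewrite eq_sym -(inj_eq (mulIf (lt0r_neq0 D0))) mulfVK ?lt0r_neq0 //.
under eq_bigr do rewrite mulrC.
under [X in _ - X]eq_bigr do rewrite mulrC.
by apply/eqP; move: H; lra.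
Qed.

(** [hit v - hit u] is the potential of a flow of strength [total_deg] from [u] to [v], with energy
    [2 * total_deg] times the commute time. The flow leaves [u] through [deg adj u] edges, and
    Cauchy-Schwarz on these alone bounds the energy from below. *)
Lemma commute_ge u v : u != v -> total_deg <= 2 * (deg adj u)%:R * (hit u v + hit v u).
Proof.
move=> uv; have D0 := total_deg_gt0 u.
pose g x := hit v x - hit u x.
have lg x : lap g x = total_deg * ((x == u)%:R - (x == v)%:R).
  have -> : lap g x = lap (hit v) x - lap (hit u) x.
    by rewrite /lap -sumrB; apply: eq_bigr => y _; rewrite /g; ring.
  by rewrite !lap_hit; ring.
have dg : dform g g = 2 * total_deg * (hit u v + hit v u).
  rewrite dform_lap; under eq_bigr do rewrite lg mulrCA.
  rewrite -mulr_sumr -mulrA; congr (_ * (_ * _)).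
  under eq_bigr do rewrite mulrBr.
  rewrite sumrB (bigD1 u) //= eqxx mulr1 big1 => [|i /negbTE->]; last by rewrite mulr0.
  rewrite (bigD1 v) //= eqxx mulr1 big1 => [|i /negbTE->]; last by rewrite mulr0.
  rewrite /g !hit_self; ring.
have := cauchy_schwarz_card (adj u) (fun y => g u - g y).
have -> : \sum_(y | adj u y) (g u - g y) = total_deg.
  by rewrite -/(lap g u) lg eqxx (negbTE uv) subr0 mulr1.
have h := dform_local g u; rewrite -degE.
move=> h1; have h2 := le_trans h1 (ler_wpM2l (ler0n R _) h).
rewrite dg in h2; rewrite -(ler_pM2l D0) -expr2.
by apply: (le_trans h2); rewrite le_eqVlt; apply/orP; left; apply/eqP; ring.
Qed.

End Resistance.
End Network.

Lemma exists_large_fiber (m J : nat) (f : 'I_m -> 'I_J) : (0 < m)%N ->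
  exists j, (m <= J * #|[set u | f u == j]|)%N.
Proof.
move=> m0; apply: contrapT => H.
have J0 : (0 < J)%N by apply: leq_ltn_trans (leq0n _) (ltn_ord (f (Ordinal m0))).
have lt j : (J * #|[set u | f u == j]| <= m.-1)%N.
  by rewrite -ltnS prednK // ltnNge; apply/negP => h; apply: H; exists j.
have : (\sum_j J * #|[set u | f u == j]| <= \sum_(j < J) m.-1)%N by apply: leq_sum.
rewrite -big_distrr /= sum_nat_const card_ord leq_pmul2l //.
have -> : (\sum_(j < J) #|[set u | f u == j]| = m)%N.
  rewrite -[RHS]card_ord -sum1_card (partition_big f predT) //=.
  by apply: eq_bigr => j _; rewrite -sum1_card; apply: eq_bigl => u; rewrite inE.
by move=> h; move: m0 h; case: (m) => // k _; rewrite ltnn.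
Qed.

Lemma exists_expr_lt (R : realType) (z e : R) : 0 <= z -> z < 1 -> 0 < e -> exists k, z ^+ k < e.
Proof.
move=> z0 z1 e0; have := @cvg_expr R z; rewrite ger0_norm // => /(_ z1).
move/cvgrPdist_lt => /(_ e e0) [k _ /(_ k (leqnn k)) /=].
by rewrite sub0r normrN ger0_norm ?exprn_ge0 // => h; exists k.
Qed.

(** * Cover time from degree and resistance bounds *)

Section Bounds.
Variables (R : realType) (m : nat) (adj : rel 'I_m) (dlo dhi J : nat) (Rf K c : R).
Hypotheses (adj_sym : symmetric adj) (m_gt0 : (0 < m)%N).
Hypotheses (dlo_gt0 : (0 < dlo)%N) (deg_ge : forall x, (dlo <= deg adj x)%N)
  (deg_le : forall x, (deg adj x <= dhi)%N).
Hypothesis Rf_ge0 : 0 <= Rf.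
Hypothesis resistance : forall (h : 'I_m -> R) x y, (h x - h y) ^+ 2 <= Rf * dform adj h h.
Hypotheses (K_ge1 : 1 <= K) (K_ge : 2 * Rf * (m%:R * dhi%:R) <= K).

Let deg_gt0 x : (0 < deg adj x)%N.
Proof. exact: leq_trans (deg_ge x). Qed.

Let hitR := hit adj_sym resistance.

Let hitR_le v x : hitR v x <= K.
Proof.
apply: (le_trans (hit_le adj_sym deg_gt0 Rf_ge0 resistance v x)); apply: le_trans K_ge.
rewrite ler_wpM2l ?mulr_ge0 // /total_deg.
apply: (@le_trans _ _ (\sum_(x < m) dhi%:R)); last by rewrite sumr_const card_ord mulr_natl.
by apply: ler_sum => y _; rewrite ler_nat.
Qed.

Lemma cover_time_le : (cover_time R adj <= (2 * K * ln m%:R + 1 + 4 * K)%:E)%E.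
Proof.
have K0 : 0 <= K by apply: le_trans K_ge1.
have m1 : (1 : R) <= m%:R by rewrite ler1n.
apply: bigmax_le.
  by rewrite lee_fin !addr_ge0 ?mulr_ge0 // ln_ge0.
move=> v _.
have := @exp_cover_time_le R 'I_m adj hitR K K_ge1
  (fun y x => hit_ge0 adj_sym deg_gt0 resistance y x) hitR_le _ v.
rewrite card_ord; apply => // y x xy.
by rewrite /hitR hit_step.
Qed.

Hypotheses (c_gt0 : 0 < c) (c_le : 2 * dhi%:R * c <= m%:R * dlo%:R).
Hypotheses (J_gt : K < J%:R * (c / 2)).

(* [hit u v - hit v u = pot u - pot v]: inside a bucket of potentials of width [c / 2]
   both hitting times are at least [c / 4], as their sum is at least [c]. *)
Lemma cover_time_ge : ((c / 16 * ln (m%:R / J%:R))%:E <= cover_time R adj)%E.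
Proof.
have K0 : 0 < K by apply: lt_le_trans K_ge1.
have c2 : 0 < c / 2 by rewrite divr_gt0.
have J0 : (0 < J)%N.
  case: (posnP J) => // J0; move: J_gt; rewrite J0 mul0r => h.
  by have := lt_trans K0 h; rewrite ltxx.
have D_ge : m%:R * dlo%:R <= total_deg R adj.
  apply: (@le_trans _ _ (\sum_(x < m) dlo%:R)); first by rewrite sumr_const card_ord mulr_natl.
  by apply: ler_sum => y _; rewrite ler_nat.
have comm u v : u != v -> c <= hitR u v + hitR v u.
  move=> uv; have := commute_ge adj_sym deg_gt0 resistance uv.
  rewrite -/hitR => h1.
  have s0 : 0 <= hitR u v + hitR v u by rewrite addr_ge0 // hit_ge0.
  have d0 : 0 < dhi%:R :> R by rewrite ltr0n (leq_trans (deg_gt0 u)).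
  have h2 : 2 * (deg adj u)%:R * (hitR u v + hitR v u) <= 2 * dhi%:R * (hitR u v + hitR v u).
    by rewrite ler_wpM2r // ler_wpM2l // ler_nat.
  rewrite -(@ler_pM2l _ (2 * dhi%:R)) ?mulr_gt0 //.
  by apply: le_trans c_le _; apply: le_trans D_ge _; apply: le_trans h1 h2.
pose p u := pot adj_sym resistance u.
have p0 u : 0 <= p u by exact: pot_ge0.
have pK u : p u <= K by apply: pot_le => // x; exact: hitR_le.
have ltJ u : (Num.truncn (p u / (c / 2)) < J)%N.
  rewrite -(ltr_nat R); apply: le_lt_trans (_ : p u / (c / 2) < _).
    by rewrite truncn_le divr_ge0 // ltW.
  by rewrite ltr_pdivrMr //; apply: le_lt_trans J_gt.
pose f u : 'I_J := Ordinal (ltJ u).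
have [j hj] := exists_large_fiber f m_gt0.
set A := [set u | f u == j] in hj.
have A0 : (0 < #|A|)%N.
  by rewrite lt0n; apply/eqP => e; move: hj m_gt0; rewrite e muln0 leqn0 => /eqP->.
have [v vA] : exists v, v \in A by move/card_gt0P: A0.
have close u w : u \in A -> w \in A -> p u - p w < c / 2.
  rewrite !inE => /eqP/(congr1 val)/= fu /eqP/(congr1 val)/= fw.
  have := truncnS_gt (p u / (c / 2)); rewrite ltr_pdivrMr // fu => h1.
  have : (Num.truncn (p w / (c / 2)))%:R <= p w / (c / 2).
    by rewrite truncn_le divr_ge0 // ltW.
  rewrite ler_pdivlMr // fw => h2.
  by move: h1 h2; rewrite -natr1 mulrDl mul1r; lra.
have hitA y a : y \in A -> a \in A -> a != y -> c / 4 <= hitR y a.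
  move=> yA aA ay; have h1 := comm a y ay; have h2 := close a y aA yA.
  have := hit_sub adj_sym deg_gt0 resistance a y; rewrite -/hitR -/(p a) -/(p y) => h3.
  lra.
pose lam : R := 1 - (2 * K)^-1.
have K2 : 1 < 2 * K by move: K_ge1; lra.
have K20 : 0 < 2 * K by lra.
have lam0 : 0 <= lam by rewrite /lam subr_ge0 invf_le1 // ltW.
have lam1 : lam < 1 by rewrite /lam gtrDl oppr_lt0 invr_gt0.
have m0R : 0 < m%:R :> R by rewrite ltr0n.
(* The bound 1/2 is what the averaging over last vertices requires. The bound [c / (8 * K)] makes
   truncation at [t0] cost a hitting time at most [c / 8], so that [c / 8] of the original [c / 4]
   remains. *)
pose e : R := Num.min (2^-1) (c / (8 * K)).
have e0 : 0 < e by rewrite lt_min invr_gt0 ltr0n divr_gt0 // mulr_gt0.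
have [t0 ht0] : exists t0, lam ^+ t0 < e / (2 * m%:R).
  by apply: exists_expr_lt => //; rewrite divr_gt0 // mulr_gt0.
have ncov_e x (S : {set 'I_m}) : ncov R adj t0 x S <= e.
  apply: (@le_trans _ _ (2 * m%:R * lam ^+ t0)).
    have := @ncov_le_geom R 'I_m adj hitR K K_ge1
     (fun y x => hit_ge0 adj_sym deg_gt0 resistance y x) hitR_le _ t0 x S.
    by rewrite card_ord; apply => y z zy; rewrite /hitR hit_step.
  by rewrite mulrC -ler_pdivlMr ?mulr_gt0 // ltW.
have ecA y a : y \in A -> a \in A -> a != y -> c / 8 <= ecov R adj t0 a [set y].
  move=> yA aA ay.

  have h1 : K * ncov R adj t0 a [set y] <= c / 8.
    apply: (@le_trans _ _ (K * (c / (8 * K)))).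
      rewrite ler_pM2l //; apply: (le_trans (ncov_e _ _)).
      by rewrite /e ge_min lexx orbT.
    by rewrite le_eqVlt; apply/orP; left; apply/eqP; field; rewrite gt_eqF.
  have h2 := hitA y a yA aA ay.
  have h : hitR y a <= ecov R adj t0 a [set y] + K * ncov R adj t0 a [set y].
    apply: ecov_hitting => [|x|x xy]; [exact: hit_self|exact: hitR_le|].
    by rewrite /hitR hit_step // addrC subrK.
  lra.
have main : c / 8 / 2 * \sum_(j0 < #|A :\ v|) j0.+1%:R^-1 <= ecov R adj (t0 + t0) v A.
  have c8 : 0 <= c / 8 by rewrite divr_ge0 // ltW.
  apply: (@ecov_ge_harmonic R 'I_m adj A (c / 8) t0 c8 ecA _ #|A :\ v| v A vA _ erefl) => //.
  by move=> x S; apply: (le_trans (ncov_e _ _)); rewrite /e ge_min lexx.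
apply: (@le_trans _ _ (exp_cover_time R adj v)); last exact: le_bigmax.
apply: (@le_trans _ _ (ecov R adj (t0 + t0) v A)%:E); last exact: ecov_le_exp_cover_time.
rewrite lee_fin; apply: le_trans main.
have -> : c / 8 / 2 = c / 16 by field.
rewrite ler_wpM2l ?divr_ge0 ?(ltW c_gt0) //.
apply: le_trans (ln_le_harmonic R _).
have -> : #|A :\ v|.+1 = #|A| by rewrite (cardsD1 v A) vA.
have J0R : 0 < J%:R :> R by rewrite ltr0n.
rewrite ler_ln ?posrE ?divr_gt0 ?ltr0n // ler_pdivrMr // mulrC -natrM ler_nat //.
Qed.
End Bounds.

(** * Resistance of the reflected square grid *)

Definition nbr1 (x y x' y' : nat) : bool :=
  ((x - x') + (x' - x) + ((y - y') + (y' - y)) <= 1)%N.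

Section Polya.
Variables (R : realType).
Implicit Types (u D : nat -> nat -> R).

Definition antidiag u k : R := (\sum_(i < k.+1) u i (k - i)%N) / k.+1%:R.

(* Polya's urn gives the unit flow from the corner that is uniform on every antidiagonal. *)
Lemma antidiagS u k : antidiag u k.+1 - antidiag u k =
  \sum_(i < k.+1) (i.+1%:R * (u i.+1 (k - i)%N - u i (k - i)%N) +
     (k - i).+1%:R * (u i (k - i).+1 - u i (k - i)%N)) / (k.+1%:R * k.+2%:R).
Proof.
rewrite -mulr_suml.
have -> : \sum_(i < k.+1) (i.+1%:R * (u i.+1 (k - i)%N - u i (k - i)%N) +
     (k - i).+1%:R * (u i (k - i).+1 - u i (k - i)%N)) =
   k.+1%:R * (\sum_(i < k.+2) u i (k.+1 - i)%N) - k.+2%:R * \sum_(i < k.+1) u i (k - i)%N.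
  have e1 : \sum_(i < k.+1) i.+1%:R * u i.+1 (k - i)%N = \sum_(i < k.+2) i%:R * u i (k.+1 - i)%N.
    rewrite [RHS]big_ord_recl /= mul0r add0r; apply: eq_bigr => i _.
    by rewrite /bump /= add1n subSS.
  have e2 : \sum_(i < k.+1) (k - i).+1%:R * u i (k - i).+1 = \sum_(i < k.+2) (k.+1 - i)%:R * u i (k.+1 - i)%N.
    rewrite [RHS]big_ord_recr /= subnn mul0r addr0; apply: eq_bigr => i _.
    by rewrite subSn // -ltnS.
  have e3 : k.+1%:R * (\sum_(i < k.+2) u i (k.+1 - i)%N) =
     \sum_(i < k.+1) i.+1%:R * u i.+1 (k - i)%N + \sum_(i < k.+1) (k - i).+1%:R * u i (k - i).+1.
    rewrite e1 e2 mulr_sumr -big_split /=; apply: eq_bigr => i _.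
    by rewrite -mulrDl -natrD subnKC // -ltnS.
  rewrite e3 mulr_sumr -big_split -sumrB /=; apply: eq_bigr => i _.
  have -> : (k.+2%:R : R) = i.+1%:R + (k - i).+1%:R.
    by rewrite -natrD; congr (_%:R); have := ltn_ord i; lia.
  ring.
rewrite /antidiag.
have k1 : (k.+1%:R : R) != 0 by rewrite pnatr_eq0.
have k2 : (k.+2%:R : R) != 0 by rewrite pnatr_eq0.
move: (\sum_(i < k.+2) _) (\sum_(i < k.+1) _) (k.+1%:R : R) (k.+2%:R : R) k1 k2 => a b p q p0 q0.
by field; rewrite p0 q0.
Qed.

(** The weights [i.+1 / k.+2] and [(k - i).+1 / k.+2] sum to 1, so each summand is a mean of two
    increments divided by [k.+1], and Cauchy-Schwarz runs over the [k.+1] cells of the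
    antidiagonal. *)
Lemma antidiagS_sqr u D k :
  (forall i, (i <= k)%N -> (u i.+1 (k - i)%N - u i (k - i)%N) ^+ 2 <= D i (k - i)%N /\
     (u i (k - i).+1 - u i (k - i)%N) ^+ 2 <= D i (k - i)%N) ->
  (antidiag u k.+1 - antidiag u k) ^+ 2 <= k.+1%:R^-1 * \sum_(i < k.+1) D i (k - i)%N.
Proof.
move=> h; rewrite antidiagS.
have k1 : (0 : R) < k.+1%:R by rewrite ltr0n.
have k2 : (0 : R) < k.+2%:R by rewrite ltr0n.
apply: (le_trans (cauchy_schwarz_card _ _)); rewrite card_ord.

have -> : k.+1%:R^-1 * \sum_(i < k.+1) D i (k - i)%N =
   k.+1%:R * \sum_(i < k.+1) D i (k - i)%N / k.+1%:R ^+ 2.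
  by rewrite -mulr_suml; field; rewrite lt0r_neq0.
rewrite ler_pM2l //; apply: ler_sum => i _.
have [ha hb] := h i (ltn_ord i).
move: ha hb.
set a := _ - _; set b := _ - _; set d := D _ _ => ha hb.
have d0 : 0 <= d by apply: le_trans (sqr_ge0 _) ha.
have e : (k.+2%:R : R) = i.+1%:R + (k - i).+1%:R.
  by rewrite -natrD; congr (_%:R); have := ltn_ord i; lia.
rewrite expr_div_n ler_pdivrMr ?exprn_gt0 ?mulr_gt0 //.
have -> : d / k.+1%:R ^+ 2 * (k.+1%:R * k.+2%:R) ^+ 2 = d * k.+2%:R ^+ 2.
  by field; rewrite lt0r_neq0.
rewrite e.
have p0 : (0 : R) <= i.+1%:R by rewrite ler0n.
have q0 : (0 : R) <= (k - i).+1%:R by rewrite ler0n.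
move: (i.+1%:R : R) ((k - i).+1%:R : R) p0 q0 => p q p0 q0.
have h1 : p * q * (2 * (a * b)) <= p * q * (2 * d).
  rewrite ler_wpM2l ?mulr_ge0 //; have := sqr_ge0 (a - b); rewrite sqrrB; lra.
have h2 : p ^+ 2 * a ^+ 2 <= p ^+ 2 * d by rewrite ler_wpM2l ?sqr_ge0.
have h3 : q ^+ 2 * b ^+ 2 <= q ^+ 2 * d by rewrite ler_wpM2l ?sqr_ge0.
have -> : (p * a + q * b) ^+ 2 = p ^+ 2 * a ^+ 2 + p * q * (2 * (a * b)) + q ^+ 2 * b ^+ 2 by ring.
have -> : d * (p + q) ^+ 2 = p ^+ 2 * d + p * q * (2 * d) + q ^+ 2 * d by ring.
lra.
Qed.

Lemma sum_antidiag_le D K : (forall i j, 0 <= D i j) ->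
  \sum_(k < K) \sum_(i < k.+1) D i (k - i)%N <= \sum_(i < K.+1) \sum_(j < K.+1) D i j.
Proof.
move=> D0.
have -> : \sum_(k < K) \sum_(i < k.+1) D i (k - i)%N =
   \sum_(k < K) \sum_(i < K | (i < k.+1)%N) D i (k - i)%N.
  by apply: eq_bigr => k _; rewrite (big_ord_widen K (fun i => D i (k - i)%N)).
rewrite (exchange_big_dep predT) //= big_ord_recr /=; apply: ler_wpDr; first by apply: sumr_ge0.
apply: ler_sum => i _.
have -> : \sum_(k < K | (i < k.+1)%N) D i (k - i)%N = \sum_(i <= k < K) D i (k - i)%N.

  rewrite -(big_mkord (fun k => (i < k.+1)%N) (fun k => D i (k - i)%N)).
  rewrite (@big_cat_nat _ _ _ i) //=; last exact: ltnW.
  rewrite big_nat_cond big1 ?add0r => [|k /andP[/andP[_ h1] h2]]; last by move: h1 h2; lia.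
  rewrite big_nat_cond [RHS]big_nat; apply: eq_bigl => k; lia.
rewrite -{1}[i : nat]add0n big_addn.
apply: (@le_trans _ _ (\sum_(0 <= j < K - i) D i j)).
  by rewrite le_eqVlt; apply/orP; left; apply/eqP; apply: eq_bigr => j _; rewrite addnK.
rewrite -(big_mkord xpredT (fun j => D i j)) (@big_cat_nat _ _ _ (K - i) 0 K.+1) //=; last lia.
by rewrite lerDl; apply: sumr_ge0.
Qed.

(** Telescoping over the antidiagonals, with Cauchy-Schwarz weights [1 / k.+1] because the flow
    spreads over [k.+1] cells. The sum of these weights is the logarithmic resistance of the
    plane. *)
Lemma antidiag_corner u D K : (forall i j, 0 <= D i j) ->
  (forall i j i' j', (i <= K)%N -> (j <= K)%N -> (i' <= K)%N -> (j' <= K)%N ->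
     nbr1 i j i' j' -> (u i j - u i' j') ^+ 2 <= D i j) ->
  (antidiag u K - u 0%N 0%N) ^+ 2 <=
     (\sum_(k < K) k.+1%:R^-1) * \sum_(i < K.+1) \sum_(j < K.+1) D i j.
Proof.
move=> D0 h.
have -> : antidiag u K - u 0%N 0%N = \sum_(k < K) k.+1%:R^-1 * (k.+1%:R * (antidiag u k.+1 - antidiag u k)).
  transitivity (\sum_(0 <= k < K) (antidiag u k.+1 - antidiag u k)).
    rewrite telescope_sumr //; congr (_ - _).
    by rewrite /antidiag big_ord_recl big_ord0 addr0 divr1.
  by rewrite big_mkord; apply: eq_bigr => k _; rewrite mulrA mulVf ?mul1r // pnatr_eq0.
apply: (le_trans (weighted_cauchy_schwarz _ _)); first by move=> k _; rewrite invr_ge0.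
apply: ler_wpM2l; first by apply: sumr_ge0 => k _; rewrite invr_ge0.
apply: le_trans (sum_antidiag_le K D0); apply: ler_sum => k _.
have k1 : (0 : R) < k.+1%:R by rewrite ltr0n.
have -> (d : R) : k.+1%:R^-1 * (k.+1%:R * d) ^+ 2 = k.+1%:R * d ^+ 2.
  by field; rewrite lt0r_neq0.
rewrite -ler_pdivlMl //.
apply: antidiagS_sqr => i ik; have kK := ltn_ord k.
by split; rewrite -[X in X <= _]sqrrN opprB; apply: h; rewrite /nbr1; lia.
Qed.

(** Both corners are compared with the mean over the main antidiagonal, which is its own image when
    the square is turned around. *)
Lemma polya u D K : (forall i j, 0 <= D i j) ->
  (forall i j i' j', (i <= K)%N -> (j <= K)%N -> (i' <= K)%N -> (j' <= K)%N ->
     nbr1 i j i' j' -> (u i j - u i' j') ^+ 2 <= D i j) ->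
  (u 0%N 0%N - u K K) ^+ 2 <=
     4 * ((\sum_(k < K) k.+1%:R^-1) * \sum_(i < K.+1) \sum_(j < K.+1) D i j).
Proof.
move=> D0 h.
have h1 := antidiag_corner D0 h.
pose u' i j := u (K - i)%N (K - j)%N; pose D' i j := D (K - i)%N (K - j)%N.
have h2 : (antidiag u' K - u' 0%N 0%N) ^+ 2 <=
     (\sum_(k < K) k.+1%:R^-1) * \sum_(i < K.+1) \sum_(j < K.+1) D' i j.
  apply: antidiag_corner => [i j|i j i' j' iK jK iK' jK' ij]; first exact: D0.
  by apply: h; rewrite ?leq_subr //; move: ij; rewrite /nbr1; lia.
have e1 : antidiag u' K = antidiag u K.
  rewrite /antidiag; congr (_ / _); rewrite (reindex_inj rev_ord_inj) /=.
  apply: eq_bigr => i _; rewrite /u' subSS; have := ltn_ord i => hi.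
  by congr (u _ _); lia.
have e2 : \sum_(i < K.+1) \sum_(j < K.+1) D' i j = \sum_(i < K.+1) \sum_(j < K.+1) D i j.
  rewrite (reindex_inj rev_ord_inj) /=; apply: eq_bigr => i _.
  rewrite (reindex_inj rev_ord_inj) /=; apply: eq_bigr => j _.
  by rewrite /D' !subSS; have := ltn_ord i; have := ltn_ord j => hj hi; congr (D _ _); lia.
move: h2; rewrite e1 e2 /u' !subn0 => h2.
move: h1 h2; set B := _ * _; set a := antidiag u K; move: (u 0%N 0%N) (u K K) => p q h1 h2.
have := sqr_ge0 ((a - p) + (a - q)); nra.
Qed.

End Polya.

(* Reflection of the three copies [0,M), [M,2M), [2M,3M) of a segment onto [0,M). *)
Definition fold (M X : nat) : nat :=
  (if X < M then M.-1 - X else if X < 2 * M then X - M else (3 * M).-1 - X)%N.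

Ltac fold_lia := rewrite /fold; repeat case: ifP => ?; lia.

Lemma fold_lt M X : (X < 3 * M)%N -> (fold M X < M)%N.
Proof. by fold_lia. Qed.

Lemma fold_mid M x : (x < M)%N -> fold M (M + x) = x.
Proof. by fold_lia. Qed.

Lemma fold_dist M X Y : (X < 3 * M)%N -> (Y < 3 * M)%N ->
  (fold M X - fold M Y <= (X - Y) + (Y - X))%N.
Proof. by fold_lia. Qed.

Lemma fold_absdiff M X Y : (X < 3 * M)%N -> (Y < 3 * M)%N ->
  (fold M X - fold M Y + (fold M Y - fold M X) <= (X - Y) + (Y - X))%N.
Proof.
move=> hX hY; have h1 := fold_dist hX hY; have := fold_dist hY hX; rewrite addnC => h2.
by case: (leqP (fold M X) (fold M Y)) => [|/ltnW] h; rewrite (eqP h) ?addn0.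
Qed.

Lemma fold_nbr1 M X Y X' Y' : (X < 3 * M)%N -> (Y < 3 * M)%N -> (X' < 3 * M)%N -> (Y' < 3 * M)%N ->
  nbr1 X Y X' Y' -> nbr1 (fold M X) (fold M Y) (fold M X') (fold M Y').
Proof. by move=> hX hY hX' hY'; apply: leq_trans; apply: leq_add; exact: fold_absdiff. Qed.

Section Grid.
Variable R : realType.
Implicit Types a : nat -> R.

Lemma sum_fold M a : \sum_(X < 3 * M) a (fold M X) = 3 * \sum_(x < M) a x.
Proof.
rewrite -(big_mkord xpredT (fun X => a (fold M X))).
rewrite (@big_cat_nat _ _ _ M) //=; last lia.
rewrite [X in _ + X](@big_cat_nat _ _ _ (2 * M)) //=; [|lia|lia].
have e1 : \sum_(0 <= i < M) a (fold M i) = \sum_(x < M) a x.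
  rewrite big_mkord (reindex_inj rev_ord_inj) /=; apply: eq_bigr => i _.
  by have := ltn_ord i => hi; congr a; fold_lia.
have e2 : \sum_(M <= i < 2 * M) a (fold M i) = \sum_(x < M) a x.
  rewrite -{1}[M]add0n big_addn (_ : (2 * M - M)%N = M); last lia.
  rewrite big_mkord; apply: eq_bigr => i _.
  by have := ltn_ord i => hi; congr a; fold_lia.
have e3 : \sum_(2 * M <= i < 3 * M) a (fold M i) = \sum_(x < M) a x.
  rewrite -{1}[(2 * M)%N]add0n big_addn (_ : (3 * M - 2 * M)%N = M); last lia.
  rewrite big_mkord (reindex_inj rev_ord_inj) /=; apply: eq_bigr => i _.
  by have := ltn_ord i => hi; congr a; fold_lia.
by rewrite e1 e2 e3; ring.
Qed.

Lemma sum_shift_le a X K n : (forall x, 0 <= a x) -> (X + K < n)%N ->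
  \sum_(i < K.+1) a (X + i)%N <= \sum_(x < n) a x.
Proof.
move=> a0 h; rewrite -(big_mkord xpredT a) -(big_mkord xpredT (fun i => a (X + i)%N)).
have XK : (X <= X + K.+1)%N by exact: leq_addr.
have Xn : (X + K.+1 <= n)%N by lia.
rewrite [leRHS](@big_cat_nat _ _ _ X) ?(leq_trans XK) //=.
rewrite [X in _ <= _ + X](@big_cat_nat _ _ _ (X + K.+1)) //=.
have -> : \sum_(X <= i < X + K.+1) a i = \sum_(0 <= i < K.+1) a (X + i)%N.
  by rewrite -{1}[X]add0n big_addn addKn; apply: eq_bigr => i _; rewrite addnC.
by rewrite addrCA lerDl addr_ge0 // sumr_ge0.
Qed.

Lemma sum_rshift_le a Y K n : (forall x, 0 <= a x) -> (K <= Y)%N -> (Y < n)%N ->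
  \sum_(i < K.+1) a (Y - i)%N <= \sum_(x < n) a x.
Proof.
move=> a0 h hn.
have -> : \sum_(i < K.+1) a (Y - i)%N = \sum_(i < K.+1) a ((Y - K) + i)%N.
  rewrite (reindex_inj rev_ord_inj) /=; apply: eq_bigr => i _.
  by have := ltn_ord i => hi; congr a; lia.
by apply: sum_shift_le => //; lia.
Qed.

Variables (M : nat) (G D : nat -> nat -> R).
Hypothesis D_ge0 : forall x y, 0 <= D x y.
Hypothesis G_nbr : forall x y x' y', (x < M)%N -> (y < M)%N -> (x' < M)%N -> (y' < M)%N ->
  nbr1 x y x' y' -> (G x y - G x' y') ^+ 2 <= D x y.

Let H := \sum_(k < 3 * M) (k.+1%:R^-1 : R).
Let S := \sum_(x < M) \sum_(y < M) D x y.
Let u X Y := G (fold M X) (fold M Y).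
Let DX X Y := D (fold M X) (fold M Y).

Let S_ge0 : 0 <= S.
Proof. by apply: sumr_ge0 => x _; apply: sumr_ge0. Qed.

Let sumDX : \sum_(X < 3 * M) \sum_(Y < 3 * M) DX X Y = 9 * S.
Proof.
rewrite /S /DX.
under eq_bigr do rewrite (sum_fold M (D _)).
by rewrite -mulr_sumr (sum_fold M (fun x => \sum_(y < M) D x y)); ring.
Qed.

Let u_nbr X Y X' Y' : (X < 3 * M)%N -> (Y < 3 * M)%N -> (X' < 3 * M)%N -> (Y' < 3 * M)%N ->
  nbr1 X Y X' Y' -> (u X Y - u X' Y') ^+ 2 <= DX X Y.
Proof. by move=> hX hY hX' hY' hn; apply: G_nbr; rewrite ?fold_lt // fold_nbr1. Qed.

Let harm_le K : (K <= 3 * M)%N -> \sum_(k < K) (k.+1%:R^-1 : R) <= H.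
Proof.
move=> hK; rewrite /H -(big_mkord xpredT (fun k => k.+1%:R^-1)).
rewrite -(big_mkord xpredT (fun k => k.+1%:R^-1)) (@big_cat_nat _ _ _ K 0 (3 * M)) //=.
by rewrite lerDl; apply: sumr_ge0 => k _; rewrite invr_ge0.
Qed.

Let harm_ge0 K : 0 <= \sum_(k < K) (k.+1%:R^-1 : R).
Proof. by apply: sumr_ge0 => k _; rewrite invr_ge0. Qed.

(** The factor is [36 = 4 * 9]: 4 from the two corners, 9 from the nine reflected copies of the
    energy. *)
Let diag X Y K : (X + K < 3 * M)%N -> (Y + K < 3 * M)%N ->
  (u X Y - u (X + K)%N (Y + K)%N) ^+ 2 <= 36 * H * S.
Proof.
move=> hX hY.
have := @polya R (fun i j => u (X + i)%N (Y + j)%N) (fun i j => DX (X + i)%N (Y + j)%N) K.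
rewrite !addn0 => h; apply: (le_trans (h _ _)).
- by move=> i j; exact: D_ge0.
- move=> i j i' j' hi hj hi' hj' hn.
  by apply: u_nbr; [apply: leq_ltn_trans hX|apply: leq_ltn_trans hY|apply: leq_ltn_trans hX
    |apply: leq_ltn_trans hY|]; rewrite ?leq_add2l // /nbr1 !subnDl.
rewrite -[36]/(4 * 9)%:R natrM -!mulrA ler_pM2l // mulrCA -sumDX.
apply: ler_pM => //; first by apply: sumr_ge0 => i _; apply: sumr_ge0 => j _; exact: D_ge0.
  by apply: harm_le; lia.
apply: (@le_trans _ _ (\sum_(i < K.+1) \sum_(Z < 3 * M) DX (X + i)%N Z)).
  by apply: ler_sum => i _; apply: (sum_shift_le (a := DX (X + i)%N)) => // x; exact: D_ge0.
apply: (sum_shift_le (a := fun Z => \sum_(Z' < 3 * M) DX Z Z')) => // x.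
by apply: sumr_ge0 => j _; exact: D_ge0.
Qed.

Let antid X Y K : (X + K < 3 * M)%N -> (K <= Y)%N -> (Y < 3 * M)%N ->
  (u X Y - u (X + K)%N (Y - K)%N) ^+ 2 <= 36 * H * S.
Proof.
move=> hX hK hY.
have := @polya R (fun i j => u (X + i)%N (Y - j)%N) (fun i j => DX (X + i)%N (Y - j)%N) K.
rewrite !addn0 subn0 => h; apply: (le_trans (h _ _)).
- by move=> i j; exact: D_ge0.
- move=> i j i' j' hi hj hi' hj' hn.
  apply: u_nbr; [apply: leq_ltn_trans hX|apply: leq_ltn_trans hY|apply: leq_ltn_trans hX
    |apply: leq_ltn_trans hY|]; rewrite ?leq_add2l ?leq_subr //.
  rewrite /nbr1 !subnDl; move: hn; rewrite /nbr1.
  have hj1 := leq_trans hj hK; have hj2 := leq_trans hj' hK; clear -hj1 hj2; lia.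
rewrite -[36]/(4 * 9)%:R natrM -!mulrA ler_pM2l // mulrCA -sumDX.
apply: ler_pM => //; first by apply: sumr_ge0 => i _; apply: sumr_ge0 => j _; exact: D_ge0.
  by apply: harm_le; lia.
apply: (@le_trans _ _ (\sum_(i < K.+1) \sum_(Z < 3 * M) DX (X + i)%N Z)).
  by apply: ler_sum => i _; apply: (sum_rshift_le (a := DX (X + i)%N)) => // x; exact: D_ge0.
apply: (sum_shift_le (a := fun Z => \sum_(Z' < 3 * M) DX Z Z')) => // x.
by apply: sumr_ge0 => j _; exact: D_ge0.
Qed.

Let diag_sym X Y X' Y' : (X < 3 * M)%N -> (Y < 3 * M)%N -> (X' < 3 * M)%N -> (Y' < 3 * M)%N ->
  (X' + Y = X + Y')%N -> (u X Y - u X' Y') ^+ 2 <= 36 * H * S.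
Proof.
move=> hX hY hX' hY' e; case: (leqP X X') => le.
  have := @diag X Y (X' - X); rewrite (_ : Y + (X' - X) = Y')%N ?subnKC //; last lia.
  exact.
rewrite -sqrrN opprB.
have := @diag X' Y' (X - X'); rewrite (_ : Y' + (X - X') = Y)%N ?(subnKC (ltnW le)) //; last lia.
exact.
Qed.

Let antid_sym X Y X' Y' : (X < 3 * M)%N -> (Y < 3 * M)%N -> (X' < 3 * M)%N -> (Y' < 3 * M)%N ->
  (X + Y = X' + Y')%N -> (u X Y - u X' Y') ^+ 2 <= 36 * H * S.
Proof.
move=> hX hY hX' hY' e; case: (leqP X X') => le.
  have := @antid X Y (X' - X); rewrite (_ : Y - (X' - X) = Y')%N ?subnKC //; last lia.
  by apply => //; lia.
rewrite -sqrrN opprB.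
have := @antid X' Y' (X - X'); rewrite (_ : Y' - (X - X') = Y)%N ?(subnKC (ltnW le)) //; last lia.
by apply => //; lia.
Qed.

Let sqr_tri (p q r A B : R) : (p - q) ^+ 2 <= A -> (q - r) ^+ 2 <= B -> (p - r) ^+ 2 <= 2 * A + 2 * B.
Proof. by move=> h1 h2; have := sqr_ge0 ((p - q) - (q - r)); nra. Qed.

(* Two cells of the same colour are two bishop moves apart in the reflected grid. *)
Let bishop X Y X' Y' : (M <= X < 2 * M)%N -> (M <= Y < 2 * M)%N ->
  (M <= X' <= 2 * M)%N -> (M <= Y' < 2 * M)%N -> ~~ odd (X + Y + X' + Y') ->
  (u X Y - u X' Y') ^+ 2 <= 144 * H * S.
Proof.
move=> hX hY hX' hY' ev.
have -> : 144 * H * S = 2 * (36 * H * S) + 2 * (36 * H * S) by ring.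
(* The diagonal through [(X, Y)] and the antidiagonal through [(X', Y')] meet in [(A, B)]. This cell
   may leave the middle copy, but not the three by three copies. *)
pose A := ((X + X' + Y' - Y)./2)%N; pose B := ((Y + X' + Y' - X)./2)%N.
have eA : (2 * A = X + X' + Y' - Y)%N.
  by rewrite mul2n /A; have := odd_double_half (X + X' + Y' - Y); lia.
have eB : (2 * B = Y + X' + Y' - X)%N.
  by rewrite mul2n /B; have := odd_double_half (Y + X' + Y' - X); lia.
apply: (@sqr_tri _ (u A B)); [apply: diag_sym; lia | apply: antid_sym; lia].
Qed.

Lemma grid_resistance (a1 b c d : nat) : (a1 < M)%N -> (b < M)%N -> (c < M)%N -> (d < M)%N ->
  (G a1 b - G c d) ^+ 2 <= 290 * H * S.
Proof.
move=> ha hb hc hd.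
have uG x y : (x < M)%N -> (y < M)%N -> G x y = u (M + x)%N (M + y)%N.
  by move=> hx hy; rewrite /u !fold_mid.
rewrite (uG a1 b) // (uG c d) //.
have M0 : (0 < M)%N by lia.
have H1 : 1 <= H.
  have -> : 1 = \sum_(k < 1) (k.+1%:R^-1 : R) by rewrite big_ord1 invr1.
  by apply: harm_le; lia.
have HS : S <= H * S by rewrite ler_peMl.
case: (boolP (odd ((M + a1) + (M + b) + (M + c) + (M + d)))) => od; last first.
  apply: (@le_trans _ _ (144 * H * S)); first by apply: bishop => //; lia.
  by move: HS S_ge0; nra.
apply: (@le_trans _ _ (2 * (144 * H * S) + 2 * S)); last first.
  by move: HS; rewrite -!mulrA; lra.
(* For opposite colours, a neighbour of the target has the right colour; it may lie just past the
   middle copy, hence the bound [X' <= 2 * M] for bishop moves. The total is [290 = 2 * 144 + 2],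
   using [1 <= H]. *)
apply: (@sqr_tri _ (u (M + c).+1 (M + d)%N)); first by apply: bishop => //; lia.
have cD : DX (M + c)%N (M + d)%N <= S.
  rewrite /DX !fold_mid // /S (bigD1 (Ordinal hc)) //= (bigD1 (Ordinal hd)) //= -addrA lerDl.
  by rewrite addr_ge0 ?sumr_ge0 // => i _; apply: sumr_ge0.
apply: le_trans cD; rewrite -sqrrN opprB; apply: u_nbr; rewrite /nbr1; lia.
Qed.
End Grid.

(** * Resistance of a point configuration *)

Lemma connect_bound (R : realType) (T : finType) (ed : rel T) (G : T -> R) (B : R) u v :
  0 <= B -> (forall x y, ed x y -> `|G x - G y| <= B) -> connect ed u v ->
  `|G u - G v| <= #|T|%:R * B.
Proof.
move=> B0 hB /connectP[p0 p0p ->]; case/shortenP: p0p => p pp up _.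
have sp : (size p <= #|T|)%N.
  by apply: leq_trans (max_card (mem (u :: p))); rewrite (card_uniqP up) /= leqnSn.
apply: (@le_trans _ _ ((size p)%:R * B)); last by rewrite ler_wpM2r // ler_nat.
elim: p u pp {up sp} => [|z p IH] u /=; first by rewrite subrr normr0 mul0r.
move=> /andP[uz pz]; rewrite -[(size p).+1]add1n natrD mulrDl mul1r.
rewrite -(subrKA (G z)); apply: (le_trans (ler_normD _ _)).
by apply: lerD; [exact: hB|exact: IH].
Qed.

Definition dist_le (l x c : nat) : bool := (x - c <= l)%N && (c - x <= l)%N.

Lemma near_cells_fold b M X Y X' Y' : (X < 3 * M)%N -> (Y < 3 * M)%N -> (X' < 3 * M)%N -> (Y' < 3 * M)%N ->
  near_cells b X Y X' Y' -> near_cells b (fold M X) (fold M Y) (fold M X') (fold M Y').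
Proof.
move=> hX hY hX' hY'; rewrite /near_cells; apply: leq_trans.
have h1 := fold_dist hX hX'; have h2 := fold_dist hX' hX.
have h3 := fold_dist hY hY'; have h4 := fold_dist hY' hY.
by apply: leq_add; rewrite leq_sqr ltnS; lia.
Qed.

(** * Reflected windows and a dense representative for every cell *)

Section Cells.
Variables (e M : nat).
Hypothesis e_gt0 : (0 < e)%N.
Local Notation b := (4 * e)%N.
Local Notation l := (68 * b)%N.
Local Notation L := (544 * e).-1.
Local Notation W := ('I_L.+1 * 'I_L.+1)%type.
Variable badc : nat -> nat -> bool.

Definition near_wall (l M x : nat) : bool := (x < l)%N || (M <= x + l)%N.

Definition window_bad (c1 c2 : nat) : {set 'I_M * 'I_M} :=
  [set p : 'I_M * 'I_M | [&& badc p.1 p.2, dist_le l p.1 c1 & dist_le l p.2 c2]].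

(* A window meeting one wall (resp. a corner) is seen twice (resp. four times) by reflection. *)
Definition bad_limit (c1 c2 : nat) : nat :=
  if near_wall l M c1 then (if near_wall l M c2 then 1 else 2 * #|quarter b|)
  else (if near_wall l M c2 then 2 * #|quarter b| else 4 * #|quarter b|)%N.

Hypothesis few_bad_cells : forall c1 c2, (c1 < M)%N -> (c2 < M)%N ->
  (#|window_bad c1 c2| < bad_limit c1 c2)%N.

Let Le : L.+1 = (544 * e)%N. Proof. by rewrite prednK // muln_gt0. Qed.

Let ltL (i : 'I_L.+1) : (i < 544 * e)%N. Proof. exact: leq_trans (ltn_ord i) (eq_leq Le). Qed.

Let ext_bad c1 c2 (i j : nat) := badc (fold M (M + c1 - l + i)) (fold M (M + c2 - l + j)).

(** As [2 * l <= M], in each direction the window meets the middle copy and at most one other. A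
    reflected cell is thus determined by its folded position and one bit per coordinate telling
    whether it lies in the middle copy; away from the walls that bit is constant. *)
Let card_ext_bad c1 c2 : (2 * l <= M)%N -> (c1 < M)%N -> (c2 < M)%N ->
  (#|bad_cells L (ext_bad c1 c2)| < 4 * #|quarter b|)%N.
Proof.
move=> lM h1 h2.
pose A (w : bool) : {set bool} := if w then [set: bool] else [set true].
have cA w : #|A w| = (if w then 2 else 1)%N by case: w; rewrite /A ?cardsT ?card_bool ?cards1.
pose T := finset.setX (finset.setX (A (near_wall l M c1)) (A (near_wall l M c2))) (window_bad c1 c2).
have cT : (#|T| < 4 * #|quarter b|)%N.
  rewrite !cardsX !cA; have := few_bad_cells h1 h2; have := quarter_gt0 e_gt0; rewrite /bad_limit.
  by case: (near_wall l M c1); case: (near_wall l M c2); lia.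
apply: leq_ltn_trans cT; clear few_bad_cells.
pose X (w : W) := (M + c1 - l + w.1)%N; pose Y (w : W) := (M + c2 - l + w.2)%N.
have Xr w : (M + c1 - l <= X w < M + c1 + l)%N by have := ltL w.1; rewrite /X; clear -lM; lia.
have Yr w : (M + c2 - l <= Y w < M + c2 + l)%N by have := ltL w.2; rewrite /Y; clear -lM; lia.
have lt3 (c Z : nat) : (c < M)%N -> (M + c - l <= Z < M + c + l)%N -> (Z < 3 * M)%N by clear -lM; lia.
have Xlt w := lt3 _ _ h1 (Xr w); have Ylt w := lt3 _ _ h2 (Yr w).
pose mid Z := (M <= Z < 2 * M)%N.
pose f (w : W) := ((mid (X w), mid (Y w)), (Ordinal (fold_lt (Xlt w)), Ordinal (fold_lt (Ylt w)))).
rewrite -(card_in_imset (f := f)).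
  apply: subset_leq_card; apply/fintype.subsetP => z /imsetP[w]; rewrite inE => wb ->.
  have inA (c Z : nat) : (c < M)%N -> (M + c - l <= Z < M + c + l)%N -> mid Z \in A (near_wall l M c).
    move=> hc hZ; rewrite /A; case: ifPn; first by rewrite inE.
    by rewrite /near_wall inE /mid => hn; apply/eqP; clear -hn hZ hc lM; lia.
  have inw (c Z : nat) : (c < M)%N -> (M + c - l <= Z < M + c + l)%N -> dist_le l (fold M Z) c.
    move=> hc hZ; have Z3 := lt3 _ _ hc hZ; have c3 : (M + c < 3 * M)%N by clear -hc; lia.
    rewrite /dist_le -{1 2}(fold_mid hc).
    by apply/andP; split; apply: (leq_trans (fold_dist _ _)) => //; clear -hZ; lia.
  rewrite finset.in_setX; apply/andP; split.
    by rewrite finset.in_setX; apply/andP; split; apply: inA.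
  by rewrite inE /=; apply/and3P; split; [exact: wb|apply: inw|apply: inw].
move=> w w' _ _ [e1 e2 e3 e4].
have inj (c Z Z' : nat) : (c < M)%N -> (M + c - l <= Z < M + c + l)%N -> (M + c - l <= Z' < M + c + l)%N ->
    mid Z = mid Z' -> fold M Z = fold M Z' -> Z = Z'.
  by clear -lM; rewrite /mid /fold => hc hZ hZ'; repeat case: ifP => ?; lia.
have eX : X w = X w' by apply: (inj c1).
have eY : Y w = Y w' by apply: (inj c2).
have i1 : w.1 = w'.1 by apply: val_inj; move: eX; rewrite /X => /addnI.
have i2 : w.2 = w'.2 by apply: val_inj; move: eY; rewrite /Y => /addnI.
by case: (w) (w') i1 i2 => [a1 a2] [a1' a2'] /= -> ->.
Qed.

(** The chain of dense cells between neighbouring representatives is used only through telescoping,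
    so it is stated for an arbitrary function with bounded increments. The chain stays within the
    window of [(c1, c2)], so energy can be charged locally. *)
Lemma good_cell_selection (R : realType) : exists g : nat -> nat -> nat * nat,
  (forall c1 c2, (c1 < M)%N -> (c2 < M)%N ->
     [/\ ((g c1 c2).1 < M)%N, ((g c1 c2).2 < M)%N, ~~ badc (g c1 c2).1 (g c1 c2).2
       & near_cells b c1 c2 (g c1 c2).1 (g c1 c2).2]) /\
  (forall c1 c2 c1' c2', (c1 < M)%N -> (c2 < M)%N -> (c1' < M)%N -> (c2' < M)%N ->
     nbr1 c1 c2 c1' c2' -> forall (F : nat -> nat -> R) (B : R), 0 <= B ->
     (forall x y x' y', (x < M)%N -> (y < M)%N -> (x' < M)%N -> (y' < M)%N ->
        ~~ badc x y -> ~~ badc x' y' -> near_cells b x y x' y' ->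
        dist_le l x c1 -> dist_le l y c2 -> dist_le l x' c1 -> dist_le l y' c2 ->
        `|F x y - F x' y'| <= B) ->
     `|F (g c1 c2).1 (g c1 c2).2 - F (g c1' c2').1 (g c1' c2').2| <= ((544 * e) ^ 2)%:R * B).
Proof.
(* In a small grid every cell is near a wall in both directions, so the limit is 1 and there are no
   bad cells at all. *)
case: (leqP (2 * l) M) => lM; last first.
  have good c1 c2 : (c1 < M)%N -> (c2 < M)%N -> ~~ badc c1 c2.
    move=> h1 h2; apply/negP => hb; have := few_bad_cells h1 h2.
    have nw x : near_wall l M x by rewrite /near_wall; lia.
    rewrite /bad_limit !nw ltnS leqn0 cards_eq0 => /eqP e0.
    suff : (Ordinal h1, Ordinal h2) \in window_bad c1 c2 by rewrite e0 finset.in_set0.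
    by rewrite inE /= hb /dist_le !subnn.
  exists (fun c1 c2 => (c1, c2)); split => [c1 c2 h1 h2|c1 c2 c1' c2' h1 h2 h1' h2' hn F B B0 hF] /=.
    split => //; first exact: good.
    by apply: (@near_cells_le _ _ _ _ _ 0 0); rewrite ?subnn //; nia.
  apply: (@le_trans _ _ B); last first.
    by rewrite ler_peMl // ler1n expn_gt0 muln_gt0 e_gt0.
  move: hn; rewrite /nbr1 => hn.
  apply: hF; rewrite ?good // /dist_le; try lia.
  by apply: (@near_cells_le _ _ _ _ _ 1 1); rewrite //; try lia; nia.
have ext3 (c i : nat) : (c < M)%N -> (i < 544 * e)%N -> (M + c - l + i < 3 * M)%N by clear -lM; lia.
have mid3 (c : nat) : (c < M)%N -> (M + c < 3 * M)%N by clear; lia.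
have dist1 (c i : nat) : (M + c - (M + c - l + i) = l - i)%N by clear -lM e_gt0; lia.
have dist2 (c i : nat) : ((M + c - l + i) - (M + c) = i - l)%N by clear -lM e_gt0; lia.
have ex c1 c2 : exists p : W, (c1 < M)%N -> (c2 < M)%N ->
   ~~ ext_bad c1 c2 p.1 p.2 /\ near_cells b l l p.1 p.2.
  case: (ltnP c1 M) => h1; last by exists (ord0, ord0).
  case: (ltnP c2 M) => h2; last by exists (ord0, ord0).
  by have [p hp] := exists_good_near e_gt0 Le (card_ext_bad lM h1 h2); exists p.
pose P c1 c2 : W := projT1 (cid (ex c1 c2)).
have PP c1 c2 : (c1 < M)%N -> (c2 < M)%N ->
   ~~ ext_bad c1 c2 (P c1 c2).1 (P c1 c2).2 /\ near_cells b l l (P c1 c2).1 (P c1 c2).2.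
  exact: (projT2 (cid (ex c1 c2))).
exists (fun c1 c2 => (fold M (M + c1 - l + (P c1 c2).1), fold M (M + c2 - l + (P c1 c2).2))%N).
split => [c1 c2 h1 h2|c1 c2 c1' c2' h1 h2 h1' h2' hn F B B0 hF] /=.
  have [Pb Pn] := PP c1 c2 h1 h2.
  have X3 := ext3 _ _ h1 (ltL (P c1 c2).1); have Y3 := ext3 _ _ h2 (ltL (P c1 c2).2).
  split; [exact: fold_lt|exact: fold_lt|exact: Pb|].
  rewrite -{1}(fold_mid h1) -{1}(fold_mid h2).
  by apply: near_cells_fold; rewrite ?mid3 // /near_cells !dist1 !dist2.
have [Pb Pn] := PP c1 c2 h1 h2; have [n1 n2 n3 n4] := near_cells_lt Pn.
have [Pb' Pn'] := PP c1' c2' h1' h2'; have [n1' n2' n3' n4'] := near_cells_lt Pn'.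
have [d1 d2 d3 d4] : [/\ (c1 <= c1'.+1)%N, (c1' <= c1.+1)%N, (c2 <= c2'.+1)%N & (c2' <= c2.+1)%N].
  by move: hn; rewrite /nbr1; clear; move=> h; split; lia.
have sh (c c' i : nat) : (l < i + b)%N -> (i < l + b)%N -> (c <= c'.+1)%N -> (c' <= c.+1)%N ->
    [/\ (i + c' - c < L.+1)%N, (66 * b <= i + c' - c)%N & (i + c' - c < 70 * b)%N].
  by rewrite Le; clear -e_gt0 => s1 s2 s3 s4; split; lia.
have [s1 s1' s1''] := sh c1 c1' _ n1' n2' d1 d2; have [s2 s2' s2''] := sh c2 c2' _ n3' n4' d3 d4.
(* The representative of the neighbouring cell in the coordinates of the window around [(c1, c2)];
   the shift by at most one keeps it in the inner square. *)
pose v : W := (inord ((P c1' c2').1 + c1' - c1), inord ((P c1' c2').2 + c2' - c2)).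
have v1 : v.1 = ((P c1' c2').1 + c1' - c1)%N :> nat by rewrite /v /= inordK.
have v2 : v.2 = ((P c1' c2').2 + c2' - c2)%N :> nat by rewrite /v /= inordK.
have co (c c' i : nat) : (66 * b <= i + c' - c)%N -> (M + c' - l + i = M + c - l + (i + c' - c))%N.
  by clear -lM e_gt0; lia.
have e1 := co _ _ _ s1'; have e2 := co _ _ _ s2'; rewrite -v1 in e1; rewrite -v2 in e2.
pose G (w : W) := F (fold M (M + c1 - l + w.1)) (fold M (M + c2 - l + w.2)).
rewrite e1 e2 -/(G v) -/(G (P c1 c2)).
have cW : #|{: W}| = ((544 * e) ^ 2)%N by rewrite card_prod !card_ord -mulnn -{3 4}Le.
have := @connect_bound R W (@cell_edge e L (ext_bad c1 c2)) G B (P c1 c2) v B0.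
rewrite cW; apply; last first.
  apply: (inner_connected e_gt0 Le (card_ext_bad lM h1 h2)) => //.
  - by move: Pb'; rewrite /ext_bad e1 e2.
  - by clear -n1 n2 n3 n4; split; lia.
  - by rewrite /inner v1 v2.
move=> x y /and3P[xg yg xy].
have wi (c : nat) (i : 'I_L.+1) : (c < M)%N -> dist_le l (fold M (M + c - l + i)) c.
  move=> hc; have Z3 := ext3 _ _ hc (ltL i); have := ltL i; move: (i : nat) Z3 => k Z3 hk.
  have e3 := dist1 c k; have e4 := dist2 c k; move: Z3 e3 e4.
  move: (M + c - l + k)%N => Z Z3 e3 e4; rewrite /dist_le -{1 2}(fold_mid hc).
  apply/andP; split; apply: (leq_trans (fold_dist _ _)); rewrite ?mid3 // e3 e4; clear -hk; lia.
apply: hF; rewrite ?fold_lt ?wi ?ext3 //.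
by apply: near_cells_fold; rewrite ?ext3 // /near_cells !subnDl.
Qed.
End Cells.

Lemma card_dist_le M l p : (#|[set c : 'I_M | dist_le l p c]| <= 2 * l + 1)%N.
Proof.
pose f (c : 'I_M) : 'I_(2 * l).+1 := inord (c + l - p).
rewrite addn1 -[leqRHS]card_ord -(card_in_imset (f := f)); first exact: max_card.
move=> c c'; rewrite !inE /dist_le => /andP[c1 c2] /andP[c1' c2'] /(congr1 val).
rewrite /f /= !inordK; [move=> h; apply: val_inj => /=; lia|lia|lia].
Qed.

(** * Resistance of the graph through averages over dense cells *)

Section Points.
Variables (R : realType) (m e M Lo : nat) (adj : rel 'I_m) (cx cy : 'I_m -> nat).
Hypotheses (e_gt0 : (0 < e)%N) (Lo_gt0 : (0 < Lo)%N).
Hypothesis adj_sym : symmetric adj.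
Hypotheses (cxM : forall i, (cx i < M)%N) (cyM : forall i, (cy i < M)%N).
Local Notation b := (4 * e)%N.
Local Notation l := (68 * b)%N.
Hypothesis near_adj : forall i j, i != j -> near_cells b (cx i) (cy i) (cx j) (cy j) -> adj i j.

Definition in_cell (x y : nat) : {set 'I_m} := [set i | (cx i == x) && (cy i == y)].
Definition sparse (x y : nat) : bool := (#|in_cell x y| < Lo)%N.
Hypothesis few_sparse : forall c1 c2, (c1 < M)%N -> (c2 < M)%N ->
  (#|window_bad e M sparse c1 c2| < bad_limit e M c1 c2)%N.

Let cell_avg (h : 'I_m -> R) (x y : nat) : R := (\sum_(i in in_cell x y) h i) / #|in_cell x y|%:R.

Let pair_energy (h : 'I_m -> R) (x y x' y' : nat) : R :=
  \sum_(i in in_cell x y) \sum_(j in in_cell x' y' | adj i j) (h i - h j) ^+ 2.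

Let pair_energy_ge0 h x y x' y' : 0 <= pair_energy h x y x' y'.
Proof. by apply: sumr_ge0 => i _; apply: sumr_ge0 => j _; exact: sqr_ge0. Qed.

Let LoR : (0 : R) < Lo%:R. Proof. by rewrite ltr0n. Qed.

Let cell_gt0 x y : ~~ sparse x y -> (0 : R) < #|in_cell x y|%:R.
Proof. by rewrite /sparse -leqNgt ltr0n; apply: leq_trans. Qed.

Let avg_sub (h : 'I_m -> R) x y (c : R) : ~~ sparse x y ->
  c - cell_avg h x y = (\sum_(j in in_cell x y) (c - h j)) / #|in_cell x y|%:R.
Proof.
move=> s; rewrite sumrB sumr_const mulrBl -[X in X / _]mulr_natr mulfK //.
by rewrite lt0r_neq0 // cell_gt0.
Qed.

Let avg_sub_sqr (h : 'I_m -> R) x y (c : R) : ~~ sparse x y ->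
  (c - cell_avg h x y) ^+ 2 <= Lo%:R^-1 * \sum_(j in in_cell x y) (c - h j) ^+ 2.
Proof.
move=> s; rewrite avg_sub // expr_div_n.
have n0 := cell_gt0 s.
rewrite ler_pdivrMr ?exprn_gt0 //.
apply: (le_trans (cauchy_schwarz_card _ _)).
have S0 : 0 <= \sum_(j in in_cell x y) (c - h j) ^+ 2 by apply: sumr_ge0 => j _; exact: sqr_ge0.
rewrite mulrAC ler_wpM2r // expr2 mulrA ler_peMl ?(ltW n0) //.
by rewrite mulrC ler_pdivlMr // mul1r ler_nat; move: s; rewrite /sparse -leqNgt.
Qed.

(** Two applications of Cauchy-Schwarz, one for each cell: the complete bundle of at least [Lo ^ 2]
    edges acts in parallel. If the cells coincide, the pairs [i = j] are no edges but contribute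
    zero. *)
Let avg_diff (h : 'I_m -> R) x y x' y' : ~~ sparse x y -> ~~ sparse x' y' ->
  near_cells b x y x' y' ->
  (cell_avg h x y - cell_avg h x' y') ^+ 2 <= (Lo%:R^-1) ^+ 2 * pair_energy h x y x' y'.
Proof.
move=> s s' nr.
rewrite -sqrrN opprB; apply: (le_trans (avg_sub_sqr h _ s)).
rewrite expr2 -mulrA ler_pM2l ?invr_gt0 // mulr_sumr; apply: ler_sum => i hi.
rewrite -sqrrN opprB; apply: (le_trans (avg_sub_sqr h _ s')).
rewrite ler_pM2l ?invr_gt0 //.
rewrite [leRHS]big_mkcondr /=; apply: ler_sum => j hj; case: ifPn => // nij.
case: (eqVneq i j) => [->|ij]; first by rewrite subrr expr0n.
move: hi hj; rewrite !inE => /andP[/eqP h1 /eqP h2] /andP[/eqP h3 /eqP h4].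
by rewrite near_adj // h1 h2 h3 h4 in nij.
Qed.

Let sum_cells (a : 'I_m -> R) : \sum_(p : 'I_M * 'I_M) \sum_(i in in_cell p.1 p.2) a i = \sum_i a i.
Proof.
rewrite (partition_big (fun i => (Ordinal (cxM i), Ordinal (cyM i))) predT) //=.
by apply: eq_bigr => -[p1 p2] _; apply: eq_bigl => i; rewrite inE xpair_eqE -!val_eqE.
Qed.

Let sum_pair_energy h :
  \sum_(p : 'I_M * 'I_M) \sum_(p' : 'I_M * 'I_M) pair_energy h p.1 p.2 p'.1 p'.2 = dform adj h h.
Proof.
rewrite /dform -[RHS]sum_cells; apply: eq_bigr => p _; rewrite /pair_energy exchange_big /=.
apply: eq_bigr => i _; rewrite [RHS]big_mkcond -[RHS]sum_cells; apply: eq_bigr => p' _.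
by rewrite big_mkcondr; apply: eq_bigr => j _; rewrite -expr2.
Qed.

Let loc (c1 c2 : nat) (p : 'I_M * 'I_M) : bool := dist_le l p.1 c1 && dist_le l p.2 c2.

Let local_energy h (c1 c2 : nat) : R :=
  \sum_(p : 'I_M * 'I_M | loc c1 c2 p) \sum_(p' : 'I_M * 'I_M | loc c1 c2 p') pair_energy h p.1 p.2 p'.1 p'.2.

Let local_energy_ge0 h c1 c2 : 0 <= local_energy h c1 c2.
Proof. by apply: sumr_ge0 => p _; apply: sumr_ge0. Qed.

(** A pair of cells lies in at most [(2 * l + 1) ^ 2] of the windows. *)
Let sum_local_energy h : \sum_(c1 < M) \sum_(c2 < M) local_energy h c1 c2 <=
  ((2 * l + 1) ^ 2)%:R * dform adj h h.
Proof.
rewrite pair_big /= /local_energy.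
under eq_bigr do rewrite big_mkcond.
rewrite exchange_big /= -sum_pair_energy mulr_sumr; apply: ler_sum => p _.
rewrite -big_mkcond /=.
apply: (@le_trans _ _ (\sum_(c : 'I_M * 'I_M | loc c.1 c.2 p) \sum_(p' : 'I_M * 'I_M) pair_energy h p.1 p.2 p'.1 p'.2)).
  apply: ler_sum => c _; rewrite big_mkcond /=; apply: ler_sum => p' _.
  by case: ifP => // _; exact: pair_energy_ge0.
rewrite sumr_const -[leLHS]mulr_natl ler_wpM2r ?sumr_ge0 // ler_nat.
apply: (@leq_trans #|finset.setX [set c : 'I_M | dist_le l p.1 c] [set c : 'I_M | dist_le l p.2 c]|).
  by apply: subset_leq_card; apply/fintype.subsetP => -[c1 c2]; rewrite finset.in_setX !inE.
by rewrite cardsX -mulnn leq_mul ?card_dist_le.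
Qed.

(** The square of the length of a chain inside a window, times the overlap of the windows. *)
Definition local_const : R := (((544 * e) ^ 2) ^ 2 * (2 * l + 1) ^ 2)%:R.
(** A path from [x] to [y] has three parts, hence the factor 3: two ends from a point to the average
    of its representative cell, costing [1 / Lo] each, and the walk through the grid of averages. *)
Definition resistance_bound : R := 3 * (2 * Lo%:R^-1 +
  290 * (\sum_(k < 3 * M) k.+1%:R^-1) * local_const * (Lo%:R^-1) ^+ 2).

Let g := projT1 (cid (@good_cell_selection e M e_gt0 sparse few_sparse R)).

Let gP c1 c2 : (c1 < M)%N -> (c2 < M)%N ->
     [/\ ((g c1 c2).1 < M)%N, ((g c1 c2).2 < M)%N, ~~ sparse (g c1 c2).1 (g c1 c2).2
       & near_cells b c1 c2 (g c1 c2).1 (g c1 c2).2].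
Proof. by case: (projT2 (cid (@good_cell_selection e M e_gt0 sparse few_sparse R))) => H _; exact: H. Qed.

(** The representative cell may contain [x] itself, hence [Lo.-1]. *)
Lemma deg_ge_density x : (Lo.-1 <= deg adj x)%N.
Proof.
have [g1 g2 g3 g4] := gP (cxM x) (cyM x).
set A := in_cell (g (cx x) (cy x)).1 (g (cx x) (cy x)).2.
have hA : (Lo <= #|A|)%N by rewrite leqNgt.
apply: (@leq_trans #|A :\ x|).
  rewrite (cardsD1 x A) in hA; move: hA; move: #|A :\ x| => k.
  by case: (x \in A); lia.
rewrite degE; apply: subset_leq_card; apply/fintype.subsetP => j.
rewrite !inE => /and3P[jx /eqP e1 /eqP e2]; rewrite unfold_in.
by apply: near_adj; rewrite 1?eq_sym // e1 e2.
Qed.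

Lemma resistance_le h x y : (h x - h y) ^+ 2 <= resistance_bound * dform adj h h.
Proof.
have vert z : (h z - cell_avg h (g (cx z) (cy z)).1 (g (cx z) (cy z)).2) ^+ 2 <= Lo%:R^-1 * dform adj h h.
  have [g1 g2 g3 g4] := gP (cxM z) (cyM z).
  apply: (le_trans (avg_sub_sqr h _ g3)); rewrite ler_pM2l ?invr_gt0 //.
  apply: le_trans (dform_local adj h z).
  rewrite big_mkcond [leRHS]big_mkcond /=; apply: ler_sum => j _; rewrite inE.
  case: ifPn => [/andP[/eqP e1 /eqP e2]|_]; last by case: ifP => // _; exact: sqr_ge0.
  case: (eqVneq z j) => [->|zj]; first by rewrite subrr expr0n; case: ifP.
  by rewrite near_adj // e1 e2.
pose K := ((544 * e) ^ 2)%:R : R.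
pose G c1 c2 := cell_avg h (g c1 c2).1 (g c1 c2).2.
(* Each link of a chain changes the average by at most the square root [B] of the scaled window
   energy, and there are at most [K] links. *)
pose D c1 c2 := K ^+ 2 * ((Lo%:R^-1) ^+ 2 * local_energy h c1 c2).
have D0 c1 c2 : 0 <= D c1 c2 by rewrite !mulr_ge0 ?sqr_ge0.
have GD c1 c2 c1' c2' : (c1 < M)%N -> (c2 < M)%N -> (c1' < M)%N -> (c2' < M)%N ->
  nbr1 c1 c2 c1' c2' -> (G c1 c2 - G c1' c2') ^+ 2 <= D c1 c2.
  move=> h1 h2 h1' h2' hn.
  have [_ H] := projT2 (cid (@good_cell_selection e M e_gt0 sparse few_sparse R)).
  pose B := Num.sqrt ((Lo%:R^-1) ^+ 2 * local_energy h c1 c2).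
  have Bsq : B ^+ 2 = (Lo%:R^-1) ^+ 2 * local_energy h c1 c2 by rewrite sqr_sqrtr // mulr_ge0 ?sqr_ge0.
  have := H c1 c2 c1' c2' h1 h2 h1' h2' hn (cell_avg h) B (sqrtr_ge0 _).
  move=> H'; rewrite /D -Bsq -exprMn -real_normK ?num_real //.
  rewrite lerXn2r ?nnegrE ?mulr_ge0 ?sqrtr_ge0 //; apply: H'.
  move=> a a2 a' a2' ha1 ha2 ha1' ha2' s s' nr w1 w2 w3 w4.
  rewrite -(@ler_pXn2r _ 2) ?nnegrE ?sqrtr_ge0 // real_normK ?num_real // Bsq.
  apply: (le_trans (avg_diff h s s' nr)); rewrite ler_pM2l ?exprn_gt0 ?invr_gt0 //.
  rewrite /local_energy (bigD1 (Ordinal ha1, Ordinal ha2)) /=; last by rewrite /loc /= w1.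
  rewrite (bigD1 (Ordinal ha1', Ordinal ha2')) /=; last by rewrite /loc /= w3.
  by rewrite -addrA lerDl addr_ge0 // sumr_ge0 // => p _; apply: sumr_ge0.
have := @grid_resistance R M G D D0 GD _ _ _ _ (cxM x) (cyM x) (cxM y) (cyM y).
set H := \sum_(k < 3 * M) _ => main.
have H0 : 0 <= H by apply: sumr_ge0 => k _; rewrite invr_ge0.
have SD : \sum_(x0 < M) \sum_(y0 < M) D x0 y0 <= local_const * (Lo%:R^-1) ^+ 2 * dform adj h h.
  rewrite /D; under eq_bigr do rewrite -mulr_sumr -mulr_sumr.
  rewrite -mulr_sumr -mulr_sumr.
  have -> : local_const * (Lo%:R^-1) ^+ 2 * dform adj h h =
     K ^+ 2 * ((Lo%:R^-1) ^+ 2 * (((2 * l + 1) ^ 2)%:R * dform adj h h)).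
    by rewrite /local_const /K natrM -natrX; ring.
  by rewrite ler_wpM2l ?sqr_ge0 // ler_wpM2l ?sqr_ge0.
have mid : (G (cx x) (cy x) - G (cx y) (cy y)) ^+ 2 <=
   290 * H * (local_const * (Lo%:R^-1) ^+ 2 * dform adj h h).
  by apply: (le_trans main); apply: ler_wpM2l SD; apply: mulr_ge0 H0; exact: ler0n.
have vx := vert x; have vy := vert y; rewrite -/(G (cx x) (cy x)) in vx; rewrite -/(G (cx y) (cy y)) in vy.
have -> : resistance_bound * dform adj h h = 3 * (Lo%:R^-1 * dform adj h h +
    290 * H * (local_const * (Lo%:R^-1) ^+ 2 * dform adj h h) + Lo%:R^-1 * dform adj h h).
  by rewrite /resistance_bound -/H; ring.
apply: (@le_trans _ _ (3 * ((h x - G (cx x) (cy x)) ^+ 2 + (G (cx x) (cy x) - G (cx y) (cy y)) ^+ 2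
    + (h y - G (cx y) (cy y)) ^+ 2))); last by rewrite ler_pM2l // !lerD.
move: (h x) (h y) (G (cx x) (cy x)) (G (cx y) (cy y)) => a1 a2 a3 a4.
have i1 := sqr_ge0 ((a1 - a3) - (a3 - a4)); have i2 := sqr_ge0 ((a3 - a4) - (a4 - a2)).
have i3 := sqr_ge0 ((a1 - a3) - (a4 - a2)); nra.
Qed.
End Points.

Import numFieldNormedType.Exports.

(** * Lattice points in a quarter disc *)

Section QuarterCount.
Variable R : realType.

(** The area under the unit quarter circle over the interval from 0 to [sin t]. *)
Let area (t : R) : R := (t + sin t * cos t) / 2.

(** The circle decreases, so a vertical strip lies in the rectangle of its left height. By the mean
    value theorem it suffices that the derivative [cos c * (cos s - cos c)] of the difference is
    nonnegative. *)
Lemma circle_chord (s t : R) : 0 <= s -> s <= t -> t <= pi / 2 ->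
  area t - area s <= cos s * (sin t - sin s).
Proof.
move=> s0 st tpi.
pose H (x : R) : R := cos s * sin x - (x + sin x * cos x) / 2.
pose dH (x : R) : R := cos s * cos x - cos x ^+ 2.
have dHP (x : R) : is_derive x 1 H (dH x).
  rewrite /H; apply: is_derive_eq.
  rewrite /dH /GRing.scale /=; have := cos2Dsin2 x; lra.
have [c cst e] : exists2 c, c \in `[s, t] & H t - H s = dH c * (t - s).
  apply: MVT_segment => //.
  by apply: derivable_within_continuous => x _; exact: (@ex_derive _ _ _ _ _ _ _ (dHP x)).
move: cst; rewrite in_itv /= => /andP[sc ct].
have pi0 := pi_gt0 R.
have c0 : 0 <= cos c by apply: cos_ge0_pihalf; lra.
have cc : cos c <= cos s.
  have [->//|sc'] := eqVneq s c.
  apply: ltW; rewrite ltr_cos ?in_itv /=; [rewrite lt_neqAle sc' sc //|lra|lra].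
have : 0 <= dH c * (t - s).
  rewrite mulr_ge0 ?subr_ge0 // /dH expr2; nra.
by rewrite -e /H /area; lra.
Qed.

Lemma riemann_circle (b : nat) : (0 < b)%N ->
  b%:R ^+ 2 * (pi / 4) <= \sum_(k < b) Num.sqrt (b%:R ^+ 2 - k%:R ^+ 2 : R).
Proof.
move=> b0; have bR : (0 : R) < b%:R by rewrite ltr0n.
have pi0 := pi_gt0 R.
pose th (k : nat) : R := asin (k%:R / b%:R).
have in01 k : (k <= b)%N -> -1 <= (k%:R / b%:R : R) <= 1.
  move=> kb; have : 0 <= k%:R / b%:R :> R by rewrite divr_ge0.
  have : k%:R / b%:R <= 1 :> R by rewrite ler_pdivrMr // mul1r ler_nat.
  by move=> h1 h2; apply/andP; split; lra.
have sth k : (k <= b)%N -> sin (th k) = k%:R / b%:R.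
  by move=> kb; rewrite /th asinK // in_itv /= in01.
have thpi k : (k <= b)%N -> - (pi / 2) <= th k <= pi / 2.
  by move=> kb; rewrite /th asin_geNpi2 ?asin_lepi2 ?in01.
have th0 : th 0%N = 0.
  have := @sinK R 0; rewrite sin0 /th mul0r; apply.
  by rewrite in_itv /=; apply/andP; split; lra.
have thb : th b = pi / 2.
  have := @sinK R (pi / 2); rewrite sin_pihalf /th divff ?lt0r_neq0 //; apply.
  by rewrite in_itv /=; apply/andP; split; lra.
have thS k : (k < b)%N -> th k <= th k.+1.
  move=> kb; rewrite leNgt; apply/negP => h.
  have : sin (th k.+1) < sin (th k) by rewrite ltr_sin ?in_itv /= ?thpi // ltnW.
  by rewrite !sth ?(ltnW kb) // ltr_pM2r ?invr_gt0 // ltr_nat ltnNge leqnSn.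
have thge k : (k <= b)%N -> 0 <= th k.
  by elim: k => [|k IH] kb; [rewrite th0|apply: le_trans (IH (ltnW kb)) (thS k kb)].
have step (k : 'I_b) : b%:R ^+ 2 * (area (th k.+1) - area (th k)) <= Num.sqrt (b%:R ^+ 2 - k%:R ^+ 2).
  have kb := ltn_ord k.
  have /andP[_ h1] := thpi k.+1 kb.
  have := circle_chord (thge k (ltnW kb)) (thS k kb) h1.
  rewrite !sth ?(ltnW kb) // /th cos_asin ?in01 ?(ltnW kb) // -/(th k) -/(th k.+1).
  have -> : (k.+1%:R / b%:R - k%:R / b%:R : R) = b%:R^-1 by rewrite -natr1; ring.
  move=> h2.
  have -> : Num.sqrt (b%:R ^+ 2 - k%:R ^+ 2 : R) = b%:R * Num.sqrt (1 - (k%:R / b%:R) ^+ 2).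
    rewrite -{2}(ger0_norm (ltW bR)) -sqrtr_sqr -sqrtrM ?sqr_ge0 //; congr Num.sqrt.
    by field; rewrite lt0r_neq0.
  apply: (@le_trans _ _ (b%:R ^+ 2 * (Num.sqrt (1 - (k%:R / b%:R) ^+ 2) / b%:R))).
    by rewrite ler_pM2l ?exprn_gt0.
  by rewrite le_eqVlt; apply/orP; left; apply/eqP; field; rewrite lt0r_neq0.
apply: le_trans (ler_sum _ (fun k _ => step k)).
rewrite -mulr_sumr ler_pM2l ?exprn_gt0 // -(big_mkord xpredT (fun k => area (th k.+1) - area (th k))).
rewrite telescope_sumr // th0 thb /area sin_pihalf cos_pihalf sin0; lra.
Qed.

(** Of the 2, one is for rounding the square root down and one for the excluded column 0. *)
Lemma quarter_row (b : nat) (i : 'I_b) : (0 < i)%N ->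
  Num.sqrt (b%:R ^+ 2 - i.+1%:R ^+ 2 : R) - 2 <= #|[set j : 'I_b | (i, j) \in quarter b]|%:R.
Proof.
move=> i0; have ib := ltn_ord i.
set Y : R := b%:R ^+ 2 - i.+1%:R ^+ 2.
have Y0 : 0 <= Y by rewrite subr_ge0 -!natrX ler_nat leq_sqr.
pose k := Num.truncn (Num.sqrt Y).
have k1 : Num.sqrt Y < k.+1%:R by exact: truncnS_gt.
have k2 : k%:R <= Num.sqrt Y by rewrite truncn_le sqrtr_ge0.
have kY : (k ^ 2 + i.+1 ^ 2 <= b ^ 2)%N.
  rewrite -(ler_nat R) natrD !natrX -lerBrDr -/Y -(sqr_sqrtr Y0).
  by rewrite lerXn2r // nnegrE ?sqrtr_ge0.
have kb : (k <= b)%N by rewrite -leq_sqr; apply: leq_trans kY; exact: leq_addr.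
have card_k : (k.-1 <= #|[set j : 'I_b | (i, j) \in quarter b]|)%N.
  have fb (j : 'I_k.-1) : (j.+1 < b)%N by have := ltn_ord j; lia.
  pose f (j : 'I_k.-1) : 'I_b := Ordinal (fb j).
  rewrite -[X in (X <= _)%N]card_ord -cardsT -(card_in_imset (f := f)).
    apply: subset_leq_card; apply/fintype.subsetP => w /imsetP[j _ ->].
    rewrite !inE /= i0 /=; apply: leq_trans kY; rewrite addnC leq_add2r leq_sqr.
    by have := ltn_ord j; lia.
  by move=> j j' _ _ [] /val_inj.
have : (k%:R - 1 : R) <= k.-1%:R.
  by case: (k) => [|k'] /=; [rewrite sub0r lerN10|rewrite -natr1 addrK].
move: card_k; rewrite -(ler_nat R); move: k1; rewrite -natr1; lra.
Qed.

(** Of the loss [4 * b], [2 * b] is the loss of 2 per row, [b] comes from using [i.+1] in place of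
    [i], and [b] from the excluded row 0. *)
Lemma quarter_ge (b : nat) : (0 < b)%N -> b%:R ^+ 2 * (pi / 4) - 4 * b%:R <= #|quarter b|%:R :> R.
Proof.
move=> b0.
have -> : #|quarter b| = (\sum_(i < b) #|[set j : 'I_b | (i, j) \in quarter b]|)%N.
  rewrite -sum1_card (partition_big (fun p : 'I_b * 'I_b => p.1) predT) //=.
  apply: eq_bigr => i _; rewrite -sum1_card (reindex_onto (fun j => (i, j)) (fun p => p.2)) /=.
    by apply: eq_bigl => j; rewrite [RHS]inE /= !eqxx !andbT.
  by move=> [p1 p2] /andP[_ /= /eqP->].
rewrite natr_sum.
have sq k : (k <= b)%N -> Num.sqrt (b%:R ^+ 2 - k%:R ^+ 2 : R) <= b%:R.
  move=> kb; rewrite -[leRHS]ger0_norm ?ler0n // -sqrtr_sqr ler_wsqrtr // gerBl.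
  exact: sqr_ge0.
have := riemann_circle b0.
have e : \sum_(k < b) Num.sqrt (b%:R ^+ 2 - k%:R ^+ 2 : R) <=
   b%:R + \sum_(i < b) Num.sqrt (b%:R ^+ 2 - i.+1%:R ^+ 2 : R).
  case: b b0 sq => // b _ sq; rewrite big_ord_recl /= lerD //.
    by have := sq 0%N isT.
  rewrite [leRHS]big_ord_recr /=; apply: ler_wpDr; first exact: sqrtr_ge0.
  by apply: ler_sum => i _; rewrite /bump /= add1n.
have e2 : \sum_(i < b) (Num.sqrt (b%:R ^+ 2 - i.+1%:R ^+ 2 : R) - 2) <=
   b%:R + \sum_(i < b) #|[set j : 'I_b | (i, j) \in quarter b]|%:R.
  case: b b0 sq {e} => // b _ sq; rewrite !big_ord_recl /=.
  have h1 : \sum_(i < b) (Num.sqrt (b.+1%:R ^+ 2 - (bump 0 i).+1%:R ^+ 2 : R) - 2) <=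
    \sum_(i < b) #|[set j : 'I_b.+1 | (lift ord0 i, j) \in quarter b.+1]|%:R.
    by apply: ler_sum => i _; exact: (quarter_row (i := lift ord0 i)).
  have h2 := sq 1%N isT.
  have h3 : (0 : R) <= #|[set j : 'I_b.+1 | (ord0, j) \in quarter b.+1]|%:R by exact: ler0n.
  lra.
rewrite sumrB sumr_const card_ord -[X in _ - X]mulr_natr in e2.
lra.
Qed.
End QuarterCount.

Local Open Scope classical_set_scope.

(** * Poisson tail bounds *)

Lemma measure_bigsetU_le (d : measure_display) (T : measurableType d) (R : realType)
  (mu : {measure set T -> \bar R}) (I : Type) (s : seq I) (Q : pred I) (F : I -> set T) :
  (forall i, Q i -> measurable (F i)) ->
  (mu (\big[setU/set0]_(i <- s | Q i) F i) <= \sum_(i <- s | Q i) mu (F i))%E.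
Proof.
move=> mF; elim: s => [|i s IH]; first by rewrite !big_nil measure0.
rewrite !big_cons; case: ifP => // Qi.
apply: (@le_trans _ _ (mu (F i) + mu (\big[setU/set0]_(i <- s | Q i) F i))%E).
  by apply: measureU2; [exact: mF|exact: bigsetU_measurable].
by apply: leeD.
Qed.

Lemma exp_partial_sum_le (R : realType) (x : R) n : 0 <= x ->
  \sum_(k < n) x ^+ k / k`!%:R <= expR x.
Proof.
move=> x0; have := @nondecreasing_cvgn_le R (series (exp_coeff x)) _ (is_cvg_series_exp_coeff x) n.
rewrite /series /= big_mkord; apply.
apply/nondecreasing_seqP => k; rewrite big_nat_recr //= lerDl; exact: exp_coeff_ge0.
Qed.

Section PoissonTail.
Context (R : realType) (d : measure_display) (Om : measurableType d) (P : probability Om R).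
Variables (N : nat -> Om -> nat) (X : nat -> nat -> Om -> R * R).
Hypothesis hPPP : poisson_rgg_model P N X.

Definition count_in (n : nat) (B : set (R * R)) (w : Om) : nat :=
  (\sum_(i < N n w) (`[< B (X n i w) >] : nat))%N.

Let sel (B : set (R * R)) k (I : {set 'I_k}) (i : nat) : set (R * R) :=
  if insub i is Some j then (if j \in I then B else ~` B) else setT.

Let ev n (B : set (R * R)) k (I : {set 'I_k}) : set Om :=
  [set w | N n w = k /\ forall i, (i < k)%N -> sel B I i (X n i w)].

Let msel B k I i : measurable B -> measurable (@sel B k I i).
Proof.
by move=> mB; rewrite /sel; case: insub => // j; case: ifP => // _; exact: measurableC.
Qed.

Let mev n B k I : measurable B -> measurable (@ev n B k I).
Proof.
move=> mB; case: hPPP => mN [mX _].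
have -> : ev n B I = [set w | N n w = k] `&`
    \bigcap_(i in [set i | (i < k.+1)%N]) ((fun w => X n i w) @^-1` (if (i < k)%N then sel B I i else setT)).
  apply/seteqP; split => w /=.
    by move=> [e h]; split => // i _ /=; case: ifP => // ik; exact: h.
  move=> [e h]; split => // i ik; have := h i (leqW ik); by rewrite /= ik.
apply: measurableI; first exact: mN.
apply: bigcap_measurable; first by exists 0%N.
move=> i _; rewrite -[X in measurable X]setTI; apply: mX => //.
by case: ifP => // _; exact: msel.
Qed.

(** The model gives probabilities of product sets only, so the event is split by the number of
    points and by the set [I] of indices falling into [B]. *)
Let count_ev n B (Q : pred nat) : [set w | Q (count_in n B w)] =
  \bigcup_k \big[setU/set0]_(I : {set 'I_k} | Q #|I|) ev n B I.
Proof.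
apply/seteqP; split => w /=.
  move=> Qw; exists (N n w) => //.
  pose I : {set 'I_(N n w)} := finset (fun i : 'I_(N n w) => `[< B (X n i w) >]).
  have cI : #|I| = count_in n B w.
    rewrite -sum1_card big_mkcond /=; apply: eq_bigr => i _; rewrite inE.
    by case: (asbool _).
  have : (\big[setU/set0]_(J : {set 'I_(N n w)} | Q #|J|) ev n B J) w.

    rewrite (bigD1 I) /=; last by rewrite cI.
    left; split => // i iN; rewrite /sel insubT /= inE.
    by case: asboolP.
  by [].
move=> [k _]; rewrite -bigcup_seq_cond => -[I /= /andP[_ QI] [e h]].
have -> // : count_in n B w = #|I|.
rewrite -sum1_card [RHS]big_mkcond /= /count_in; subst k; apply: eq_bigr => i _.
have := h i (ltn_ord i); rewrite /sel valK.
by case: ifP => _ hB; [rewrite asboolT|rewrite asboolF].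
Qed.

Lemma measurable_count n B (Q : pred nat) : measurable B -> measurable [set w | Q (count_in n B w)].
Proof.
move=> mB; rewrite count_ev; apply: bigcupT_measurable => k.
by apply: bigsetU_measurable => I _; exact: mev.
Qed.

(** Chernoff's bound: [expR (a * (z - 1))] is the generating function at [z] of a Poisson count of
    mean [a]. Leaving [z] free serves lower tails with [z < 1] and upper tails with [z > 1]. *)
Lemma poisson_tail n B (Q : pred nat) (a z c : R) : (0 < n)%N -> measurable B ->
  leb2 (B `&` box n) = a%:E -> leb2 (~` B `&` box n) = (n%:R - a)%:E ->
  0 <= a -> a <= n%:R -> 0 <= z -> 0 < c -> (forall k, Q k -> c <= z ^+ k) ->
  (P [set w | Q (count_in n B w)] <= (expR (a * (z - 1)) / c)%:E)%E.
Proof.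
move=> n0 mB hB hBc a0 an z0 c0 hQ.
have nR : (0 : R) < n%:R by rewrite ltr0n.
have PE k (I : {set 'I_k}) : P (ev n B I) =
   (expR (- n%:R) * n%:R ^+ k / k`!%:R * \prod_(i < k) (if i \in I then a / n%:R else (n%:R - a) / n%:R))%:E.
  case: hPPP => _ [_ ->]; last by move=> i; exact: msel.
  rewrite [RHS]EFinM; congr (_ * _)%E.
  rewrite (big_morph EFin (fun x y => EFinM x y) (erefl 1%:E)); apply: eq_bigr => i _.
  rewrite /sel valK.
  by case: ifP => _; rewrite ?hB ?hBc -EFinM.
(* [y / n] is the generating function of the indicator that one uniform point falls into [B]; its
   [k]-th power expands over the index sets [I]. *)
pose y := z * a + (n%:R - a).
have y0 : 0 <= y by rewrite addr_ge0 ?mulr_ge0 // subr_ge0.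
have Pk k : (P (\big[setU/set0]_(I : {set 'I_k} | Q #|I|) ev n B I) <=
    (c^-1 * expR (- n%:R) * (y ^+ k / k`!%:R))%:E)%E.
  apply: (le_trans (measure_bigsetU_le _ _ _)); first by move=> I _; exact: mev.
  rewrite (eq_bigr _ (fun I _ => PE k I)) sumEFin lee_fin -mulr_sumr.
  have -> : c^-1 * expR (- n%:R) * (y ^+ k / k`!%:R) =
     expR (- n%:R) * n%:R ^+ k / k`!%:R * (c^-1 * (y / n%:R) ^+ k).
    rewrite expr_div_n; field.
    by rewrite !lt0r_neq0 ?exprn_gt0 ?ltr0n ?fact_gt0.
  rewrite ler_wpM2l ?mulr_ge0 ?expR_ge0 ?exprn_ge0 ?invr_ge0 //.
  have -> : (y / n%:R) ^+ k = \sum_(I : {set 'I_k}) z ^+ #|I| *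
      \prod_(i < k) (if i \in I then a / n%:R else (n%:R - a) / n%:R).
    transitivity (\prod_(i < k) (z * (a / n%:R) + (n%:R - a) / n%:R)).
      by rewrite prodr_const card_ord; congr (_ ^+ _); rewrite /y; ring.
    rewrite bigA_distr; apply: eq_bigr => I _.
    rewrite -prodr_const [X in _ = X * _]big_mkcond -big_split /=; apply: eq_bigr => i _.
    by case: ifP => // _; rewrite mul1r.
  rewrite mulr_sumr [leLHS]big_mkcond; apply: ler_sum => I _.
  have p0 : 0 <= \prod_(i < k) (if i \in I then a / n%:R else (n%:R - a) / n%:R).
    by apply: prodr_ge0 => i _; case: ifP => _; rewrite divr_ge0 ?subr_ge0 // ltW.
  case: ifPn => [/hQ h|_]; last by rewrite !mulr_ge0 ?exprn_ge0 ?invr_ge0 ?(ltW c0).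
  by rewrite mulrA ler_peMl // mulrC ler_pdivlMr // mul1r.
rewrite count_ev.
apply: (le_trans (measure_sigma_subadditive _ _ _ (@subset_refl _ _))).
- by move=> k; apply: bigsetU_measurable => I _; exact: mev.
- by apply: bigcupT_measurable => k; apply: bigsetU_measurable => I _; exact: mev.
apply: lime_le; first by apply: is_cvg_nneseries => k _ _; exact: measure_ge0.
apply: nearW => m.
apply: (@le_trans _ _ (\sum_(0 <= k < m) (c^-1 * expR (- n%:R) * (y ^+ k / k`!%:R))%:E)%E).
  by apply: lee_sum => k _; exact: Pk.
rewrite sumEFin lee_fin -mulr_sumr big_mkord.
apply: (@le_trans _ _ (c^-1 * expR (- n%:R) * expR y)).
  by rewrite ler_wpM2l ?exp_partial_sum_le // mulr_ge0 ?invr_ge0 ?expR_ge0 // ltW.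
rewrite -mulrA -expRD mulrC; rewrite le_eqVlt; apply/orP; left; apply/eqP.
by congr (expR _ / c); rewrite /y; ring.
Qed.
End PoissonTail.

(** * Cells of the box *)

Lemma measure_disjoint_const (d : measure_display) (T : measurableType d) (R : realType)
  (mu : {measure set T -> \bar R}) (I : choiceType) (s : seq I) (F : I -> set T) (a : R) :
  uniq s -> (forall i, measurable (F i)) -> (forall i, mu (F i) = a%:E) ->
  (forall i j x, F i x -> F j x -> i = j) ->
  mu (\big[setU/set0]_(i <- s) F i) = ((size s)%:R * a)%:E.
Proof.
move=> us mF aF dF; elim: s us => [|i s IH] /=; first by rewrite big_nil measure0 mul0r.
move=> /andP[is_ us]; rewrite big_cons.
transitivity (mu (F i) + mu (\big[setU/set0]_(j <- s) F j))%E; last first.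
  by rewrite aF IH // -EFinD; congr (_%:E); rewrite -natr1; ring.
apply: measureU; first exact: mF.
  by apply: bigsetU_measurable => j _; exact: mF.
apply/seteqP; split => x //= -[Fx]; rewrite -bigcup_seq => -[j /= js Fjx].
by move: is_; rewrite (dF _ _ _ Fx Fjx) js.
Qed.

Section CellGeometry.
Context (R : realType).
Variables (n M : nat).
Hypotheses (n_gt0 : (0 < n)%N) (M_gt0 : (0 < M)%N).
Local Notation rt := (Num.sqrt n%:R : R).

Definition side : R := Num.sqrt n%:R / M%:R.

Lemma side_gt0 : 0 < side.
Proof. by rewrite /side divr_gt0 ?sqrtr_gt0 ?ltr0n. Qed.

Lemma side_M : M%:R * side = rt.
Proof. by rewrite /side mulrC divfK // pnatr_eq0 -lt0n. Qed.

Lemma side_sqr : M%:R ^+ 2 * side ^+ 2 = n%:R.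
Proof. by rewrite -exprMn side_M sqr_sqrtr. Qed.

Definition idx (t : R) : nat := Num.truncn ((t + rt / 2) / side).
(** Half-open, so that cells are disjoint. They miss the top and right edges of the box, a null
    set. *)
Definition cell_itv (k : nat) : interval R := `[- (rt / 2) + k%:R * side, - (rt / 2) + k.+1%:R * side[%R.
Definition cell (p : 'I_M * 'I_M) : set (R * R) := [set` cell_itv p.1] `*` [set` cell_itv p.2].

Lemma cell_itvP (k : nat) (t : R) : (t \in cell_itv k) = (k%:R <= (t + rt / 2) / side < k.+1%:R).
Proof.
have s0 := side_gt0.
rewrite /cell_itv in_itv /= ler_pdivlMr // ltr_pdivrMr //; congr (_ && _); lra.
Qed.

Lemma cell_itv_idx (k : nat) (t : R) : t \in cell_itv k -> idx t = k.
Proof.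
rewrite cell_itvP => /[dup] /andP[h _] H; apply/eqP; rewrite /idx truncn_eq //.
exact: le_trans h.
Qed.

Lemma cell_itv_dist (k k' : nat) (t t' : R) : t \in cell_itv k -> t' \in cell_itv k' ->
  (k <= k')%N -> `|t - t'| <= (k' - k).+1%:R * side.
Proof.
have s0 := side_gt0; rewrite !in_itv /= => /andP[h1 h2] /andP[h3 h4] kk.
move: h1 h2 h3 h4; rewrite -!natr1 natrB // !mulrDl mulNr !mul1r.
have kkR : k%:R * side <= k'%:R * side by rewrite ler_pM2r // ler_nat.
move: kkR; move: (k%:R * side) (k'%:R * side) => u v kkR h1 h2 h3 h4.
by rewrite ler_norml; apply/andP; split; lra.
Qed.

Lemma cell_itv_close (k k' : nat) (t t' : R) : t \in cell_itv k -> t' \in cell_itv k' ->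
  `|t - t'| <= ((k - k') + (k' - k)).+1%:R * side.
Proof.
move=> h h'; case: (leqP k k') => [kk|/ltnW kk].
  by rewrite (eqP kk) add0n; exact: cell_itv_dist.
by rewrite (eqP kk) addn0 distrC; exact: cell_itv_dist.
Qed.

Lemma cell_itv_far (k k' l : nat) (t t' : R) : t \in cell_itv k -> t' \in cell_itv k' ->
  `|t - t'| <= l%:R * side -> (k - k' <= l)%N.
Proof.
have s0 := side_gt0; rewrite !in_itv /= => /andP[h1 h2] /andP[h3 h4].
rewrite ler_norml => /andP[h5 h6]; rewrite leq_subLR -ltnS -(ltr_nat R) -(ltr_pM2r s0).
move: h1 h2 h3 h4; rewrite -!natr1 natrD !mulrDl !mul1r; lra.
Qed.

Lemma measurable_cell p : measurable (cell p).
Proof. by apply: measurableX; exact: measurable_itv. Qed.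

Lemma leb2_itvX (i j : interval R) (u v : R) : lebesgue_measure [set` i] = u%:E ->
  lebesgue_measure [set` j] = v%:E -> leb2 ([set` i] `*` [set` j]) = (u * v)%:E.
Proof.
move=> hi hj; rewrite /leb2 product_measure1E; [|exact: measurable_itv|exact: measurable_itv].
by rewrite EFinM -hi -hj.
Qed.

Lemma leb2_cell p : leb2 (cell p) = (side ^+ 2)%:E.
Proof.
have s0 := side_gt0; rewrite expr2; apply: leb2_itvX; rewrite lebesgue_measure_itv /= lte_fin.
all: rewrite ltrD2l ltr_pM2r // ltr_nat leqnn -EFinB; congr (_%:E); rewrite -natr1; ring.
Qed.

Lemma cell_inj p q x : cell p x -> cell q x -> p = q.
Proof.
move=> [/cell_itv_idx h1 /cell_itv_idx h2] [/cell_itv_idx h3 /cell_itv_idx h4].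
by case: p q h1 h2 h3 h4 => [p1 p2] [q1 q2] /= -> -> /val_inj -> /val_inj ->.
Qed.

Definition region (U : {set 'I_M * 'I_M}) : set (R * R) := \big[setU/set0]_(p <- enum U) cell p.

Lemma regionP U x : region U x <-> exists2 p, p \in U & cell p x.
Proof.
rewrite /region -bigcup_seq; split => [[p /= pU cx]|[p pU cx]]; exists p => //.
  by rewrite mem_enum in pU.
by rewrite /= mem_enum.
Qed.

Lemma measurable_region U : measurable (region U).
Proof. by apply: bigsetU_measurable => p _; exact: measurable_cell. Qed.

Lemma leb2_region U : leb2 (region U) = (#|U|%:R * side ^+ 2)%:E.
Proof.
have := @measure_disjoint_const _ _ R
  (@lebesgue_measure R \x @lebesgue_measure R)%E _ (enum U) cell (side ^+ 2) (enum_uniq _) measurable_cell leb2_cell.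
by rewrite -cardE; apply => i j x; exact: cell_inj.
Qed.

Lemma boxE : box n = [set` `[- (rt / 2), rt / 2]%R] `*` [set` `[- (rt / 2), rt / 2]%R].
Proof.
by apply/seteqP; split => -[x y]; rewrite /box /= !in_itv /= !ler_norml => -[].
Qed.

Lemma measurable_box : measurable (box n : set (R * R)).
Proof. by rewrite boxE; apply: measurableX; exact: measurable_itv. Qed.

Lemma leb2_box : leb2 (box n) = (n%:R : R)%:E.
Proof.
have r0 : 0 < rt by rewrite sqrtr_gt0 ltr0n.
have e : lebesgue_measure [set` `[- (rt / 2), rt / 2]%R] = rt%:E.
  rewrite lebesgue_measure_itv /= lte_fin ifT; last lra.
  by rewrite -EFinB; congr (_%:E); lra.
by rewrite boxE (leb2_itvX e e) -expr2 sqr_sqrtr.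
Qed.

Lemma leb2_setC (B : set (R * R)) (a : R) : measurable B -> leb2 (B `&` box n) = a%:E ->
  leb2 (~` B `&` box n) = (n%:R - a)%:E.
Proof.
move=> mB hB.
have : leb2 (box n) = (leb2 (~` B `&` box n) + leb2 (B `&` box n))%E.
  rewrite (setIC (~` B)) (setIC B) -setDE.
  exact: (measureDI (@lebesgue_measure R \x @lebesgue_measure R)%E measurable_box mB).
rewrite leb2_box hB; case: (leb2 _) => [x| |] //=; rewrite -EFinD => -[->]; congr (_%:E); ring.
Qed.

Lemma region_subset_box U : region U `<=` box n.
Proof.
have s0 := side_gt0.
have h (k : 'I_M) (t : R) : t \in cell_itv k -> t \in `[- (rt / 2), rt / 2]%R.
  rewrite !in_itv /= => /andP[h1 h2].
  have h3 : k.+1%:R * side <= rt by rewrite -side_M ler_pM2r // ler_nat.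
  have h4 : 0 <= k%:R * side by rewrite mulr_ge0 // ltW.
  by apply/andP; split; lra.
by move=> x /regionP[p _ [c1 c2]]; rewrite boxE; split; [exact: h c1|exact: h c2].
Qed.

Lemma leb2_region_box U : leb2 (region U `&` box n) = (#|U|%:R * side ^+ 2)%:E.
Proof. by rewrite (setIidl (@region_subset_box U)) leb2_region. Qed.

Lemma leb2_outside : leb2 (~` region [set: 'I_M * 'I_M] `&` box n) = 0%E.
Proof.
rewrite (leb2_setC (measurable_region _) (leb2_region_box _)).
by rewrite cardsT card_prod card_ord natrM -expr2 side_sqr subrr.
Qed.
End CellGeometry.

(** * The exceptional events *)

Definition window (M l : nat) (c : 'I_M * 'I_M) : {set 'I_M * 'I_M} :=
  finset (fun p : 'I_M * 'I_M => dist_le l p.1 c.1 && dist_le l p.2 c.2).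

Lemma card_window M l (c : 'I_M * 'I_M) : (#|window l c| <= (2 * l + 1) ^ 2)%N.
Proof.
have sw x y : dist_le l x y = dist_le l y x by rewrite /dist_le andbC.
apply: (@leq_trans #|finset.setX (finset (fun i : 'I_M => dist_le l c.1 i)) (finset (fun i : 'I_M => dist_le l c.2 i))|).
  apply: subset_leq_card; apply/fintype.subsetP => -[p1 p2].
  by rewrite finset.in_setX !inE /= (sw p1) (sw p2).
by rewrite cardsX -mulnn leq_mul ?card_dist_le.
Qed.

Lemma card_near_wall M l : (#|[pred x : 'I_M | near_wall l M x]| <= 2 * l)%N.
Proof.
pose f (b : bool) (i : nat) : nat := if b then i else (M.-1 - i)%N.
apply: (@leq_trans #|[pred x : 'I_M | [exists p : bool * 'I_l, f p.1 p.2 == x]]|).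
  apply: subset_leq_card; apply/fintype.subsetP => x; rewrite !inE /near_wall => h.
  have xM := ltn_ord x; apply/existsP; case: (ltnP x l) => xl.
    by exists (true, Ordinal xl) => /=.
  have h2 : (M.-1 - x < l)%N by move: h; rewrite ltnNge xl /=; lia.
  by exists (false, Ordinal h2); rewrite /f /=; apply/eqP; lia.
have [M0|M0] := posnP M.
  by subst M; rewrite eq_card0 // => -[].
pose g (p : bool * 'I_l) : 'I_M := insubd (Ordinal M0) (f p.1 p.2).
apply: (@leq_trans #|codom g|).
  apply: subset_leq_card; apply/fintype.subsetP => x; rewrite !inE => /existsP[p /eqP fx].
  by apply/codomP; exists p; apply: val_inj; rewrite /g val_insubd fx ltn_ord.
by apply: leq_trans (card_size _) _; rewrite size_codom card_prod card_bool card_ord.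
Qed.

Section Events.
Context (R : realType) (d : measure_display) (Om : measurableType d) (P : probability Om R).
Variables (N : nat -> Om -> nat) (X : nat -> nat -> Om -> R * R).
Hypothesis hPPP : poisson_rgg_model P N X.
Variables (n M e : nat) (eta kap z C0 : R).
Hypotheses (n_gt0 : (0 < n)%N) (M_gt0 : (0 < M)%N) (e_gt0 : (0 < e)%N).
Hypotheses (eta_gt0 : 0 < eta) (z_gt0 : 0 < z) (z_lt1 : z < 1) (kap_lt1 : kap < 1).
(** The Chernoff exponent per unit of area for having at most a fraction [eta] of the expected
    points; for small [eta] it comes close to that of an empty region, which is -1. *)
Hypothesis z_kap : z - 1 - eta * ln z <= - (1 - kap).
Local Notation b := (4 * e)%N.
Local Notation l := (68 * b)%N.
Local Notation s2 := (side R n M ^+ 2).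
Local Notation sg := (s2 * (1 - kap)).
Local Notation q := #|quarter b|.

Definition ev_outside : set Om := [set w | (0 < count_in N X n (~` region n [set: 'I_M * 'I_M]) w)%N].
Definition ev_crowded (p : 'I_M * 'I_M) : set Om := [set w | C0 * s2 < (count_in N X n (cell n p) w)%:R].
(** Only the total count of [U] is tested: this follows when every cell is sparse, and a single tail
    bound applies. *)
Definition ev_sparse (U : {set 'I_M * 'I_M}) : set Om :=
  [set w | (count_in N X n (region n U) w)%:R < #|U|%:R * eta * s2].
Definition ev_few : set Om := [set w | (count_in N X n setT w)%:R <= eta * n%:R].

Definition ev_crowd : set Om := \big[setU/set0]_(p : 'I_M * 'I_M) ev_crowded p.
Definition ev_window : set Om := \big[setU/set0]_(c : 'I_M * 'I_M)
  \big[setU/set0]_(U : {set 'I_M * 'I_M} | (U \subset window l c) && (bad_limit e M c.1 c.2 <= #|U|)%N) ev_sparse U.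
Definition ev_fail : set Om := ev_outside `|` ev_crowd `|` ev_window `|` ev_few.

Let mcount B (Q : pred nat) : measurable B -> measurable [set w | Q (count_in N X n B w)].
Proof. exact: (measurable_count hPPP). Qed.

Let mcell (p : 'I_M * 'I_M) : measurable (@cell R n M p). Proof. exact: measurable_cell. Qed.
Let mreg U : measurable (@region R n M U). Proof. exact: measurable_region. Qed.

Let m_outside : measurable ev_outside.
Proof. by apply: (mcount (fun k => (0 < k)%N)); apply: measurableC. Qed.
Let m_crowded p : measurable (ev_crowded p).
Proof. exact: (mcount (fun k => C0 * s2 < k%:R)). Qed.
Let m_sparse U : measurable (ev_sparse U).
Proof. exact: (mcount (fun k => k%:R < #|U|%:R * eta * s2)). Qed.
Let m_few : measurable ev_few.
Proof. by apply: (mcount (fun k => k%:R <= eta * n%:R)). Qed.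
Let m_crowd : measurable ev_crowd.
Proof. by apply: bigsetU_measurable. Qed.
Let m_window : measurable ev_window.
Proof. by apply: bigsetU_measurable => c _; apply: bigsetU_measurable. Qed.

Lemma measurable_ev_fail : measurable ev_fail.
Proof. by apply: measurableU => //; apply: measurableU => //; apply: measurableU. Qed.

Let nR : (0 : R) < n%:R. Proof. by rewrite ltr0n. Qed.
Let s20 : 0 < s2. Proof. by rewrite exprn_gt0 // side_gt0. Qed.

Let region_le (U : {set 'I_M * 'I_M}) : #|U|%:R * s2 <= n%:R.
Proof.
rewrite -(side_sqr R n M_gt0) ler_pM2r // -natrX ler_nat.
by apply: leq_trans (max_card _) _; rewrite card_prod card_ord mulnn.
Qed.

(** The region has measure zero; taking [n] for both the tilt and the threshold in Chernoff's bound
    gives [1 / n]. *)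
Let P_outside : (P ev_outside <= (n%:R^-1)%:E)%E.
Proof.
have := @poisson_tail R d Om P N X hPPP n (~` region n [set: 'I_M * 'I_M]) (fun k => (0 < k)%N)
  0 n%:R n%:R n_gt0 (measurableC (mreg _)) (leb2_outside R n_gt0 M_gt0).
rewrite mul0r expR0 div1r subr0; apply => //.
  rewrite setCK; have -> := leb2_region_box R n_gt0 M_gt0 [set: 'I_M * 'I_M].
  by rewrite cardsT card_prod card_ord natrM -expr2 side_sqr.
by move=> k k0; rewrite -natrX ler_nat -{1}[n]expn1 leq_pexp2l.
Qed.

Let P_crowded p : (P (ev_crowded p) <= (expR (s2 * (expR 1 - 1 - C0)))%:E)%E.
Proof.
have cE : @cell R n M p = region n [set p]%SET.

  by apply/seteqP; split => x; rewrite regionP;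
    [move=> cx; exists p => //; rewrite inE|case=> p'; rewrite inE => /eqP->].
have a1 : leb2 (cell n p `&` box n) = s2%:E.
  by rewrite cE (leb2_region_box R n_gt0 M_gt0) cards1 mul1r.
have := @poisson_tail R d Om P N X hPPP n (cell n p) (fun k => C0 * s2 < k%:R)
  s2 (expR 1) (expR (C0 * s2)) n_gt0 (mcell p) a1 (leb2_setC n_gt0 (mcell p) a1).
rewrite -expRN -expRD (_ : s2 * (expR 1 - 1) + - (C0 * s2) = s2 * (expR 1 - 1 - C0)); last by ring.
apply; rewrite ?expR_ge0 ?expR_gt0 ?(ltW s20) //.
  by have := region_le [set p]%SET; rewrite cards1 mul1r.
move=> k hk; rewrite -expRM_natr mul1r ler_expR; exact: ltW.
Qed.

Let low_tail (a t : R) (k : nat) : k%:R <= eta * a -> expR (ln z * (eta * a)) <= z ^+ k.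
Proof.
move=> h; have lz : ln z < 0 by apply: ln_lt0; rewrite z_gt0.
rewrite -[X in X ^+ k](@lnK _ z) ?posrE // -expRM_natr ler_expR.
by rewrite ler_nM2l.
Qed.

Let P_low B (a : R) (Q : pred nat) : measurable B -> leb2 (B `&` box n) = a%:E -> 0 <= a -> a <= n%:R ->
  (forall k, Q k -> k%:R <= eta * a) ->
  (P [set w | Q (count_in N X n B w)] <= (expR (- (a * (1 - kap))))%:E)%E.
Proof.
move=> mB hB a0 an hQ.
have := @poisson_tail R d Om P N X hPPP n B Q a z (expR (ln z * (eta * a))) n_gt0 mB hB
   (leb2_setC n_gt0 mB hB) a0 an (ltW z_gt0) (expR_gt0 _) (fun k hk => low_tail 0 (hQ k hk)).
move=> h; apply: (le_trans h); rewrite lee_fin -expRN -expRD ler_expR.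
by have := ler_wpM2l a0 z_kap; lra.
Qed.

Let P_sparse U : (P (ev_sparse U) <= (expR (- (#|U|%:R * sg)))%:E)%E.
Proof.
have := @P_low (region n U) (#|U|%:R * s2) (fun k => k%:R < #|U|%:R * eta * s2) (mreg U)
   (leb2_region_box R n_gt0 M_gt0 U).
rewrite -[X in _ -> _ -> _ -> (_ <= (expR (- X))%:E)%E]mulrA; apply => //.
  by rewrite mulr_ge0 // ltW.
move=> k /ltW h; apply: (le_trans h).
by rewrite (_ : #|U|%:R * eta * s2 = eta * (#|U|%:R * s2)) //; ring.
Qed.

Let P_few : (P ev_few <= (expR (- (n%:R * (1 - kap))))%:E)%E.
Proof.
by apply: (P_low (Q := fun k => k%:R <= eta * n%:R)) => //; rewrite ?setTI ?leb2_box.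
Qed.

Let sg0 : 0 < sg. Proof. by rewrite mulr_gt0 // subr_gt0. Qed.

(* The slack [1/2] in the exponent makes the union bound over windows factor into
   the two coordinates. *)
Let w_far : R := expR (- ((2 * q%:R - 2^-1) * sg)).
Let w_near : R := expR (- (sg / 2)).

(** Give a coordinate the exponent [2 * q - 1/2] if far from the walls and [1/2] if near. The limits
    [4 * q], [2 * q] and 1 are at least the sums over the two coordinates. *)
Let bad_limit_weight (c : 'I_M * 'I_M) :
  expR (- ((bad_limit e M c.1 c.2)%:R * sg)) <=
  (if near_wall l M c.1 then w_near else w_far) * (if near_wall l M c.2 then w_near else w_far).
Proof.
rewrite /bad_limit; have s0 := ltW sg0.
case: ifP => _; case: ifP => _; rewrite -expRD ler_expR ?natrM; move: sg s0 => s s0; nra.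
Qed.

(** A window has at most [2 ^ ((2 * l + 1) ^ 2)] subsets, and the sum of the product weights over
    all centres is the square of a sum over one coordinate. *)
Let P_window : (P ev_window <= (2 ^+ ((2 * l + 1) ^ 2) * (M%:R * w_far + (2 * l)%:R * w_near) ^+ 2)%:E)%E.
Proof.
apply: (le_trans (measure_bigsetU_le _ _ _)); first by move=> c _; exact: bigsetU_measurable.
pose w x : R := if near_wall l M x then w_near else w_far.
have w0 x : 0 <= w x by rewrite /w; case: ifP => _; exact: expR_ge0.
apply: (@le_trans _ _ (\sum_(c : 'I_M * 'I_M) (2 ^+ ((2 * l + 1) ^ 2) * (w c.1 * w c.2))%:E)%E).
  apply: lee_sum => c _; apply: (le_trans (measure_bigsetU_le _ _ _)); first by move=> U _; exact: m_sparse.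
  apply: (@le_trans _ _ (\sum_(U : {set 'I_M * 'I_M} | U \subset window l c) (w c.1 * w c.2)%:E)%E).
    rewrite [leRHS]big_mkcond [leLHS]big_mkcond /=; apply: lee_sum => U _.
    case: (boolP (U \subset _)) => //= _; case: ifP => hU; last by rewrite lee_fin mulr_ge0.
    apply: (le_trans (P_sparse U)); rewrite lee_fin; apply: le_trans (bad_limit_weight c).
    by rewrite ler_expR lerN2 ler_pM2r // ler_nat.
  rewrite sumEFin lee_fin sumr_const -[leLHS]mulr_natl ler_wpM2r ?mulr_ge0 // -natrX ler_nat.
  have -> : #|[pred U : {set 'I_M * 'I_M} | U \subset window l c]| = #|powerset (window l c)|.
    by apply: eq_card => U; rewrite !inE.
  by rewrite card_powerset leq_exp2l // card_window.
rewrite sumEFin lee_fin -mulr_sumr ler_pM2l ?exprn_gt0 //.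
have -> : \sum_(c : 'I_M * 'I_M) w c.1 * w c.2 = (\sum_(x < M) w x) ^+ 2.
  by rewrite expr2 big_distrlr /= pair_big.
have h : \sum_(x < M) w x <= M%:R * w_far + (2 * l)%:R * w_near.
  apply: (@le_trans _ _ (\sum_(x < M) w_far + \sum_(x < M | near_wall l M x) w_near)).
    rewrite [X in _ + X]big_mkcond -big_split /=; apply: ler_sum => x _; rewrite /w.
    by case: ifP => _; rewrite ?addr0 // lerDr expR_ge0.
  apply: lerD; first by rewrite sumr_const card_ord mulr_natl.
  rewrite sumr_const -[leLHS]mulr_natl ler_wpM2r ?expR_ge0 // ler_nat.
  exact: card_near_wall.
by rewrite lerXn2r // nnegrE ?sumr_ge0 // addr_ge0 // mulr_ge0 ?expR_ge0.
Qed.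

Lemma P_ev_fail : (P ev_fail <= (n%:R^-1 + (M ^ 2)%:R * expR (s2 * (expR 1 - 1 - C0)) +
   2 ^+ ((2 * l + 1) ^ 2) * (M%:R * expR (- ((2 * q%:R - 2^-1) * sg)) + (2 * l)%:R * expR (- (sg / 2))) ^+ 2
   + expR (- (n%:R * (1 - kap))))%:E)%E.
Proof.
have P_crowd : (P ev_crowd <= ((M ^ 2)%:R * expR (s2 * (expR 1 - 1 - C0)))%:E)%E.
  apply: (le_trans (measure_bigsetU_le _ _ _)); first by move=> c _; exact: m_crowded.
  apply: (@le_trans _ _ (\sum_(p : 'I_M * 'I_M) (expR (s2 * (expR 1 - 1 - C0)))%:E)%E).
    by apply: lee_sum => p _; exact: P_crowded.
  by rewrite sumEFin lee_fin sumr_const card_prod card_ord mulnn mulr_natl.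
rewrite !EFinD.
apply: (le_trans (measureU2 _ _ _)) => //; first by apply: measurableU => //; apply: measurableU.
apply: leeD P_few; apply: (le_trans (measureU2 _ _ _)) => //; first by apply: measurableU.
apply: leeD P_window; apply: (le_trans (measureU2 _ _ _)) => //.
by apply: leeD.
Qed.

Section Good.
Variable w : Om.
Hypothesis w_good : ~ ev_fail w.
Let m := N n w.
Let pt (i : 'I_m) := X n i w.
Definition cx (i : 'I_m) : nat := idx n M (pt i).1.
Definition cy (i : 'I_m) : nat := idx n M (pt i).2.

Let in_region i : region n [set: 'I_M * 'I_M] (pt i).
Proof.
apply: contrapT => h; apply: w_good; left; left; left; rewrite /ev_outside /=.
rewrite /count_in lt0n sum_nat_eq0; apply/forallPn; exists i; rewrite asboolT //.
Qed.

Lemma pt_cell i : [/\ (cx i < M)%N, (cy i < M)%N, (pt i).1 \in cell_itv R n M (cx i)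
   & (pt i).2 \in cell_itv R n M (cy i)].
Proof.
have /regionP[p _ [c1 c2]] := in_region i.
rewrite /cx /cy (cell_itv_idx n_gt0 M_gt0 c1) (cell_itv_idx n_gt0 M_gt0 c2).
by split; rewrite ?ltn_ord.
Qed.

Lemma card_in_cell (p : 'I_M * 'I_M) : #|in_cell cx cy p.1 p.2| = count_in N X n (cell n p) w.
Proof.
rewrite -sum1_card big_mkcond /=; apply: eq_bigr => i _; rewrite inE.
have [_ _ c1 c2] := pt_cell i; case: asboolP => h.
  by case: h => h1 h2; rewrite /cx /cy (cell_itv_idx n_gt0 M_gt0 h1) (cell_itv_idx n_gt0 M_gt0 h2) !eqxx.
case: ifP => // /andP[/eqP e1 /eqP e2]; exfalso; apply: h; split.
  by rewrite -e1.
by rewrite -e2.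
Qed.

Lemma in_cell_le x y : (x < M)%N -> (y < M)%N -> (#|in_cell cx cy x y|)%:R <= C0 * s2.
Proof.
move=> hx hy; rewrite leNgt; apply/negP => h; apply: w_good; left; left; right.
rewrite /ev_crowd -bigcup_seq; exists (Ordinal hx, Ordinal hy); first by rewrite /= mem_index_enum.
by rewrite /ev_crowded /= -card_in_cell.
Qed.

Lemma points_gt : eta * n%:R < m%:R.
Proof.
rewrite ltNge; apply/negP => h; apply: w_good; right; rewrite /ev_few /=.
by have -> : count_in N X n setT w = m; [rewrite /count_in -[RHS]card_ord -sum1_card; apply: eq_bigr => i _; rewrite asboolT|].
Qed.

Lemma few_sparse_good (Lo : nat) : Lo%:R < eta * s2 + 1 -> forall c1 c2, (c1 < M)%N -> (c2 < M)%N ->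
  (#|window_bad e M (sparse Lo cx cy) c1 c2| < bad_limit e M c1 c2)%N.
Proof.
move=> hLo c1 c2 h1 h2; rewrite ltnNge; apply/negP => h; apply: w_good; left; right.
rewrite /ev_window -bigcup_seq; exists (Ordinal h1, Ordinal h2); first by rewrite /= mem_index_enum.
set U := window_bad e M (sparse Lo cx cy) c1 c2.
rewrite -bigcup_seq_cond; exists U => /=.
  rewrite mem_index_enum /= h andbT; apply/fintype.subsetP => p.
  by rewrite !inE => /and3P[_ -> ->].
have lim0 : (0 < bad_limit e M c1 c2)%N.
  have q0 := quarter_gt0 e_gt0.
  by rewrite /bad_limit; case: ifP => _; case: ifP => _ //; rewrite muln_gt0.
have U0 : (0 < #|U|)%N by exact: leq_trans lim0 h.
rewrite /ev_sparse /=.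
apply: (@le_lt_trans _ _ (\sum_(p in U) (count_in N X n (cell n p) w)%:R)).
  rewrite -natr_sum ler_nat /count_in exchange_big /=; apply: leq_sum => i _.
  case: asboolP => // /regionP[p pU cp]; rewrite (bigD1 p) //= asboolT //.
apply: (@lt_le_trans _ _ (\sum_(p in U) eta * s2)); last by rewrite sumr_const -[leLHS]mulr_natl mulrA.
have [p0 p0U] : exists p, p \in U by move/card_gt0P: U0.
(* Counts are integers: fewer than [Lo] points means at most [Lo - 1], which is below [eta * s2]. *)
have lt p : p \in U -> (count_in N X n (cell n p) w)%:R < eta * s2.
  rewrite inE => /and3P[sp _ _]; rewrite -card_in_cell.
  move: sp; rewrite /sparse -(ltr_nat R) => sp.
  have : (#|in_cell cx cy p.1 p.2|%:R + 1 : R) <= Lo%:R by rewrite natr1 ler_nat -(ltr_nat R).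
  lra.
rewrite (bigD1 p0) //= [ltRHS](bigD1 p0) //=; apply: ltr_leD; first exact: lt.
by apply: ler_sum => p /andP[/lt/ltW].
Qed.
End Good.
End Events.

(** * Cover time of a good configuration *)

Section Constants.
Variables (R : realType) (e : nat) (eta C0 hb : R).
Local Notation b := (4 * e)%N.

(** With [Lo >= eta * s2 / 2] and a harmonic sum of at most [hb * s2], the resistance is at most
    [res_const / s2]: [12 = 3 * 2 * 2] and [3480 = 3 * 290 * 4]. Below, [hit_const] and [comm_const]
    bound hitting and commute times per unit of [n], and [(2 * b + 3) ^ 2] counts the cells within
    reach of a point. *)
Definition res_const : R := 12 / eta + 3480 * hb * local_const R e / eta ^+ 2.
Definition hit_const : R := 1 + 2 * res_const * C0 ^+ 2 * ((2 * b + 3) ^ 2)%:R.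
Definition comm_const : R := eta ^+ 2 / (8 * ((2 * b + 3) ^ 2)%:R * C0).
Definition bucket_const : nat := (Num.truncn (2 * hit_const / comm_const)).+1.
End Constants.

Section GoodConfiguration.
Variables (R : realType) (n M e m : nat) (eta C0 hb r : R) (pt : 'I_m -> R * R) (cx cy : 'I_m -> nat).
Hypotheses (n_gt0 : (0 < n)%N) (M_gt0 : (0 < M)%N) (e_gt0 : (0 < e)%N).
Hypotheses (eta_gt0 : 0 < eta) (C0_ge1 : 1 <= C0) (hb_ge0 : 0 <= hb).
Local Notation b := (4 * e)%N.
Local Notation s2 := (side R n M ^+ 2).
Local Notation Lo := (Num.truncn (eta * s2)).
Local Notation Hi := (Num.truncn (C0 * s2)).
Local Notation adj := (rgg_adj pt r).
Hypothesis pt_in : forall i, [/\ (cx i < M)%N, (cy i < M)%N, (pt i).1 \in cell_itv R n M (cx i)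
   & (pt i).2 \in cell_itv R n M (cy i)].
Hypothesis r_ge : b%:R * side R n M <= r.
(** If [r] exceeds the side of the box, no multiple of the cell side bounds it; then the whole grid
    is within [b.+1] cells of every point. *)
Hypothesis r_le : (M <= b.+1)%N \/ r <= (b.+1)%:R * side R n M.
Hypothesis s2_ge : 2 <= eta * s2.
Hypothesis cell_le : forall x y, (x < M)%N -> (y < M)%N -> (#|in_cell cx cy x y|)%:R <= C0 * s2.
Hypothesis few_bad : forall c1 c2, (c1 < M)%N -> (c2 < M)%N ->
  (#|window_bad e M (sparse Lo cx cy) c1 c2| < bad_limit e M c1 c2)%N.
Hypothesis m_gt : eta * n%:R < m%:R.
Hypothesis harm_le : \sum_(k < 3 * M) (k.+1%:R^-1 : R) <= hb * s2.

Let side0 : 0 < side R n M. Proof. exact: side_gt0. Qed.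
Let s20 : 0 < s2. Proof. by rewrite exprn_gt0. Qed.
Let C00 : 0 < C0. Proof. exact: lt_le_trans C0_ge1. Qed.
Let nR : (0 : R) < n%:R. Proof. by rewrite ltr0n. Qed.
Let r0 : 0 <= r. Proof. by apply: le_trans r_ge; rewrite mulr_ge0 // ltW. Qed.
Let es0 : 0 <= eta * s2. Proof. by rewrite mulr_ge0 // ltW. Qed.

Let Lo_ge2 : (2 <= Lo)%N.
Proof. by rewrite truncn_ge_nat. Qed.

Let LoR : eta * s2 / 2 <= Lo%:R.
Proof.
have := truncnS_gt (eta * s2); rewrite -natr1; move: s2_ge; lra.
Qed.

Let adj_sym : symmetric adj.
Proof.
move=> i j; rewrite /rgg_adj eq_sym; congr (_ && (_ <= _)).
by rewrite -[X in X + _]sqrrN -[X in _ + X]sqrrN !opprB.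
Qed.

Let near_adj i j : i != j -> near_cells b (cx i) (cy i) (cx j) (cy j) -> adj i j.
Proof.
move=> ij nr; rewrite /rgg_adj ij /=.
have [_ _ xi yi] := pt_in i; have [_ _ xj yj] := pt_in j.
have hx := cell_itv_close n_gt0 M_gt0 xi xj; have hy := cell_itv_close n_gt0 M_gt0 yi yj.
have sq (u v : R) : `|u| <= v -> u ^+ 2 <= v ^+ 2.
  move=> h; rewrite -[u ^+ 2]real_normK ?num_real // lerXn2r // nnegrE //.
  exact: le_trans (normr_ge0 _) h.
apply: (@le_trans _ _ ((b%:R * side R n M) ^+ 2)); last first.
  by rewrite lerXn2r // nnegrE // mulr_ge0 // ltW.
apply: (le_trans (lerD (sq _ _ hx) (sq _ _ hy))).
move: side0; move: (side R n M) => sd sd0.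
by rewrite !exprMn -mulrDl ler_pM2r ?exprn_gt0 // -!natrX -natrD ler_nat.
Qed.

Let adj_near i j : adj i j -> dist_le b.+1 (cx i) (cx j) && dist_le b.+1 (cy i) (cy j).
Proof.
move=> /andP[_ h].
have [xiM yiM xi yi] := pt_in i; have [xjM yjM xj yj] := pt_in j.
case: r_le => [Mb|rs].
  by rewrite /dist_le; move: xiM yiM xjM yjM Mb; clear; lia.
have le (u v : R) : u ^+ 2 + v ^+ 2 <= r ^+ 2 -> `|u| <= r.
  move=> huv; rewrite -(@ler_pXn2r _ 2) ?nnegrE // real_normK ?num_real //.
  by apply: le_trans huv; rewrite lerDl sqr_ge0.
have hx := le_trans (le _ _ h) rs.
have hy : `|(pt i).2 - (pt j).2| <= b.+1%:R * side R n M.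
  by apply: le_trans rs; apply: (le _ ((pt i).1 - (pt j).1)); rewrite addrC.
rewrite /dist_le (cell_itv_far n_gt0 M_gt0 xi xj hx) (cell_itv_far n_gt0 M_gt0 yi yj hy) /=.
rewrite distrC in hx; rewrite distrC in hy.
by rewrite (cell_itv_far n_gt0 M_gt0 xj xi hx) (cell_itv_far n_gt0 M_gt0 yj yi hy).
Qed.

Let cxM i : (cx i < M)%N. Proof. by case: (pt_in i). Qed.
Let cyM i : (cy i < M)%N. Proof. by case: (pt_in i). Qed.
Let cl i : 'I_M * 'I_M := (Ordinal (cxM i), Ordinal (cyM i)).

Let cell_leN (p : 'I_M * 'I_M) : (#|in_cell cx cy p.1 p.2| <= Hi)%N.
Proof. by rewrite truncn_ge_nat ?cell_le // mulr_ge0 // ltW. Qed.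

Let count_le (A : pred 'I_m) (B : {set 'I_M * 'I_M}) : (forall i, A i -> cl i \in B) ->
  (#|A| <= #|B| * Hi)%N.
Proof.
move=> AB.
have -> : #|A| = (\sum_(p in B) \sum_(i | A i && (cl i == p)) 1)%N.
  by rewrite -sum1_card; apply: (@partition_big _ _ _ _ _ _ _ cl (mem B)).
rewrite -sum_nat_const.
apply: leq_sum => p _; apply: leq_trans (cell_leN p); rewrite sum1dep_card.
apply: subset_leq_card; apply/fintype.subsetP => i; rewrite !inE => /andP[_ /eqP <-] /=.
by rewrite !eqxx.
Qed.

Let dhi : nat := ((2 * b + 3) ^ 2 * Hi)%N.

Let deg_le i : (deg adj i <= dhi)%N.
Proof.
rewrite degE; apply: (leq_trans (@count_le _ (window b.+1 (cl i)) _)).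
  move=> j ij; have := adj_near ij; rewrite inE /= /dist_le.
  by move=> /andP[/andP[-> ->] /andP[-> ->]].
rewrite leq_mul2r; apply/orP; right; apply: leq_trans (card_window _ _) _.
by rewrite leq_sqr; clear; lia.
Qed.

Let deg_ge i : (Lo.-1 <= deg adj i)%N.
Proof.
exact: (@deg_ge_density R m e M Lo adj cx cy e_gt0 (ltnW Lo_ge2) cxM cyM near_adj few_bad).
Qed.

Let m_le : m%:R <= C0 * n%:R.
Proof.
have : (m <= #|[set: 'I_M * 'I_M]%SET| * Hi)%N.
  by rewrite -{1}[m]card_ord; apply: count_le => i _; rewrite inE.
rewrite cardsT card_prod card_ord mulnn -(ler_nat R) natrM natrX => h.
apply: (le_trans h); have -> : C0 * n%:R = M%:R ^+ 2 * (C0 * s2).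
  by rewrite -(side_sqr R n M_gt0); ring.
by rewrite ler_pM2l ?exprn_gt0 ?ltr0n // truncn_le mulr_ge0 // ltW.
Qed.

Let Rf := resistance_bound R e M Lo.

Let Rf_ge0 : 0 <= Rf.
Proof.
have H0 : (0 : R) <= \sum_(k < 3 * M) k.+1%:R^-1 by apply: sumr_ge0 => k _; rewrite invr_ge0.
have L0 : (0 : R) <= Lo%:R^-1 by rewrite invr_ge0.
have l0 : 0 <= local_const R e by exact: ler0n.
rewrite /Rf /resistance_bound; apply: mulr_ge0; first exact: ler0n.
apply: addr_ge0; first by apply: mulr_ge0 => //; exact: ler0n.
apply: mulr_ge0; last exact: sqr_ge0.
by apply: mulr_ge0 l0; apply: mulr_ge0 H0; exact: ler0n.
Qed.

Let Rf_le : Rf <= res_const e eta hb / s2.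
Proof.
have es : 0 < eta * s2 by rewrite mulr_gt0.
have L0 : (0 : R) < Lo%:R by rewrite ltr0n ltnW.
have L1 : (Lo%:R^-1 : R) <= 2 / (eta * s2).
  rewrite -[leRHS]invrK lef_pV2 ?posrE ?invr_gt0 ?divr_gt0 // invfM invrK mulrC; exact: LoR.
have Li0 : (0 : R) <= Lo%:R^-1 by rewrite invr_ge0 ltW.
have L2 : (Lo%:R^-1 : R) ^+ 2 <= (2 / (eta * s2)) ^+ 2.
  by rewrite lerXn2r // nnegrE // divr_ge0 // ltW.
have l0 : 0 <= local_const R e by exact: ler0n.
have -> : res_const e eta hb / s2 = 3 * (2 * (2 / (eta * s2)) +
    290 * (hb * s2) * local_const R e * (2 / (eta * s2)) ^+ 2).
  by rewrite /res_const; field; rewrite !gt_eqF.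
have H0 : (0 : R) <= \sum_(k < 3 * M) k.+1%:R^-1 by apply: sumr_ge0 => k _; rewrite invr_ge0.
rewrite /Rf /resistance_bound; apply: ler_wpM2l; first exact: ler0n.
apply: lerD; first by apply: ler_wpM2l L1; exact: ler0n.
apply: ler_pM L2; [|exact: sqr_ge0|].
  by apply: mulr_ge0 l0; apply: mulr_ge0 H0; exact: ler0n.
by apply: (ler_wpM2r l0); apply: ler_wpM2l harm_le; exact: ler0n.
Qed.

Let res0 : 0 <= res_const e eta hb.
Proof.
have l0 : 0 <= local_const R e by exact: ler0n.
rewrite /res_const; apply: addr_ge0; first by rewrite divr_ge0 // ltW.
apply: divr_ge0; last exact: sqr_ge0.
by apply: mulr_ge0 l0; apply: mulr_ge0 hb_ge0; exact: ler0n.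
Qed.

Let K0 := hit_const e eta C0 hb.
Let c0 := comm_const e eta C0.
Let J := bucket_const e eta C0 hb.

Let w2 : (0 : R) < ((2 * b + 3) ^ 2)%:R.
Proof. by rewrite ltr0n expn_gt0 addn_gt0 orbT. Qed.

Let c00 : 0 < c0.
Proof. by rewrite /c0 /comm_const divr_gt0 ?exprn_gt0 // !mulr_gt0. Qed.

Let K0_ge1 : 1 <= K0.
Proof.
rewrite /K0 /hit_const lerDl; apply: mulr_ge0 (ltW w2); apply: mulr_ge0 (sqr_ge0 _).
by apply: mulr_ge0 res0; exact: ler0n.
Qed.

Let K_ge1 : 1 <= K0 * n%:R.
Proof.
by apply: (le_trans K0_ge1); rewrite ler_peMr ?ler1n // (le_trans ler01).
Qed.

Let dhi_le : dhi%:R <= ((2 * b + 3) ^ 2)%:R * (C0 * s2).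
Proof. by rewrite /dhi natrM ler_pM2l // truncn_le mulr_ge0 // ltW. Qed.

Let K_ge : 2 * Rf * (m%:R * dhi%:R) <= K0 * n%:R.
Proof.
apply: (@le_trans _ _ (2 * (res_const e eta hb / s2) * ((C0 * n%:R) * (((2 * b + 3) ^ 2)%:R * (C0 * s2))))).
  apply: ler_pM.
  - by apply: mulr_ge0 Rf_ge0; exact: ler0n.
  - by apply: mulr_ge0; exact: ler0n.
  - by apply: ler_wpM2l Rf_le; exact: ler0n.
  - by apply: ler_pM m_le dhi_le; exact: ler0n.
have -> : 2 * (res_const e eta hb / s2) * ((C0 * n%:R) * (((2 * b + 3) ^ 2)%:R * (C0 * s2)))
   = (2 * res_const e eta hb * C0 ^+ 2 * ((2 * b + 3) ^ 2)%:R) * n%:R.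
  by field; rewrite gt_eqF.
by rewrite /K0 /hit_const ler_pM2r // lerDr.
Qed.

Let m_gt0 : (0 < m)%N.
Proof. by rewrite -(ltr_nat R); apply: lt_trans m_gt; rewrite mulr_gt0. Qed.

Lemma good_cover_le : (cover_time R adj <=
  (2 * K0 * n%:R * (ln C0 + ln n%:R) + 1 + 4 * K0 * n%:R)%:E)%E.
Proof.
have Lo1 : (0 < Lo.-1)%N by have := Lo_ge2; case: (Lo) => [|[]].
have := cover_time_le adj_sym m_gt0 Lo1 deg_ge deg_le Rf_ge0
  (resistance_le e_gt0 (ltnW Lo_ge2) cxM cyM near_adj few_bad) K_ge1 K_ge.
move=> h; apply: (le_trans h); rewrite lee_fin.
have -> : 4 * K0 * n%:R = 4 * (K0 * n%:R) by ring.
rewrite lerD2r lerD2r.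
have -> : 2 * K0 * n%:R * (ln C0 + ln n%:R) = 2 * (K0 * n%:R) * (ln C0 + ln n%:R) by ring.
apply: ler_wpM2l; first by apply: mulr_ge0; [exact: ler0n|exact: le_trans K_ge1].
by rewrite -lnM ?posrE // ler_ln ?posrE ?ltr0n ?mulr_gt0.
Qed.

Lemma good_cover_ge : ((c0 / 16 * n%:R * (ln (eta / J%:R) + ln n%:R))%:E <= cover_time R adj)%E.
Proof.
have Lo1 : (0 < Lo.-1)%N by have := Lo_ge2; case: (Lo) => [|[]].
have c_gt0 : 0 < c0 * n%:R by rewrite mulr_gt0.
have c_le : 2 * dhi%:R * (c0 * n%:R) <= m%:R * (Lo.-1)%:R.
  apply: (@le_trans _ _ (eta * n%:R * (eta * s2 / 4))).
    apply: (@le_trans _ _ (2 * (((2 * b + 3) ^ 2)%:R * (C0 * s2)) * (c0 * n%:R))).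
      by apply: (ler_wpM2r (ltW c_gt0)); apply: ler_wpM2l dhi_le; exact: ler0n.
    rewrite le_eqVlt; apply/orP; left; apply/eqP; rewrite /c0 /comm_const; field.
    by rewrite !gt_eqF.
  apply: ler_pM; [by rewrite mulr_ge0 // ltW|by rewrite divr_ge0|exact: ltW|].
  have := LoR; have : (2 : R) <= Lo%:R by rewrite ler_nat.
  have -> : (Lo.-1%:R : R) = Lo%:R - 1 by rewrite -{2}(prednK (ltnW Lo_ge2)) -natr1 addrK.
  lra.
have J_gt : K0 * n%:R < J%:R * (c0 * n%:R / 2).
  have := truncnS_gt (2 * K0 / c0); rewrite ltr_pdivrMr // -/J => h.
  have -> : J%:R * (c0 * n%:R / 2) = J%:R * c0 / 2 * n%:R by ring.
  by rewrite ltr_pM2r // ltr_pdivlMr // mulrC.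
have := cover_time_ge adj_sym m_gt0 Lo1 deg_ge deg_le Rf_ge0
  (resistance_le e_gt0 (ltnW Lo_ge2) cxM cyM near_adj few_bad) K_ge1 K_ge c_gt0 c_le J_gt.
move=> h; apply: le_trans h; rewrite lee_fin.
have -> : c0 / 16 * n%:R * (ln (eta / J%:R) + ln n%:R) = c0 * n%:R / 16 * (ln (eta / J%:R) + ln n%:R) by ring.
apply: ler_wpM2l; first by rewrite divr_ge0 // ltW.
have J0 : (0 : R) < J%:R by rewrite ltr0n.
have eJ : 0 < eta / J%:R by rewrite divr_gt0.
have mJ : 0 < m%:R / J%:R :> R by rewrite divr_gt0 ?ltr0n.
have Ji : 0 < J%:R^-1 :> R by rewrite invr_gt0.
have mR : (0 : R) < m%:R by rewrite ltr0n.
rewrite -lnM ?posrE // ler_ln ?posrE ?mulr_gt0 //.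
by rewrite mulrAC ler_pM2r // ltW.
Qed.
End GoodConfiguration.

(** * Asymptotics *)

Lemma expRN_le_inv (R : realType) (x : R) : 0 < x -> expR (- x) <= x^-1.
Proof.
move=> x0; rewrite expRN lef_pV2 ?posrE ?expR_gt0 //.
by apply: le_trans (expR_ge1Dx x); rewrite lerDr.
Qed.

Lemma ln_natr_le (R : realType) (n : nat) : (0 < n)%N -> ln (n%:R : R) <= n%:R - 1.
Proof.
move=> n0; have nR : (0 : R) < n%:R by rewrite ltr0n.
have {1}-> : (n%:R : R) = 1 + (n%:R - 1) by ring.
by apply: le_ln1Dx; lra.
Qed.

Lemma ln_natr_sqr_le (R : realType) (n : nat) : (0 < n)%N -> ln (n%:R : R) ^+ 2 <= 4 * n%:R.
Proof.
move=> n0; have nR : (0 : R) < n%:R by rewrite ltr0n.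
have s0 : (0 : R) < Num.sqrt n%:R by rewrite sqrtr_gt0.
have e : (n%:R : R) = Num.sqrt n%:R ^+ 2 by rewrite sqr_sqrtr // ltW.
have l1 : ln (Num.sqrt n%:R : R) <= Num.sqrt n%:R.
  move: s0; move: (Num.sqrt n%:R : R) => s s0; have {1}-> : s = 1 + (s - 1) by ring.
  by apply: (@le_trans _ _ (s - 1)); [apply: le_ln1Dx; lra|lra].
have l2 : ln (n%:R : R) <= 2 * Num.sqrt n%:R.
  have -> : ln (n%:R : R) = 2 * ln (Num.sqrt n%:R) by rewrite {1}e lnXn // mulr_natl.
  by rewrite ler_pM2l.
have l0 : 0 <= ln (n%:R : R) by rewrite ln_ge0 // ler1n.
have -> : 4 * (n%:R : R) = (2 * Num.sqrt n%:R) ^+ 2 by rewrite exprMn -e; ring.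
by rewrite lerXn2r // nnegrE // mulr_ge0 // ltW.
Qed.

(** The quotient bounds the area of a cell over [ln n] from below, so the product is the decay
    exponent, in powers of [n], of half a disc of sparse cells. It has to exceed the 1/2 coming from
    the at most [sqrt n] cells in each direction; as [2 * q] is about [pi * b ^ 2 / 2], it is about
    [(1 + eps) / 2]. *)
Lemma cell_constants (R : realType) (eps : R) : 0 < eps ->
  exists (e : nat) (eta kap z : R), [/\ (0 < e)%N, 0 < eta, 0 < kap < 1, 0 < z < 1
    & z - 1 - eta * ln z <= - (1 - kap)] /\
    2^-1 + eps / 4 <= (1 + eps) ^+ 2 / (pi * (4 * e).+1%:R ^+ 2) * (1 - kap) *
       (2 * #|quarter (4 * e)|%:R - 2^-1).
Proof.
move=> eps0; have e1 : 0 < 1 + eps by rewrite addr_gt0.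
pose kap := eps / (1 + eps).
have kap0 : 0 < kap by rewrite divr_gt0.
have kap1 : kap < 1 by rewrite ltr_pdivrMr // mul1r ltrDr.
(* so that [(1 + eps) ^+ 2 * (1 - kap) = 1 + eps] *)
have k1 : 1 - kap = (1 + eps)^-1 by rewrite /kap; field; rewrite gt_eqF.
(* With [eta = (kap / 2) / - ln z] the term [- eta * ln z] is [kap / 2] as well, and the exponent is
   exactly [- (1 - kap)]. *)
pose z := kap / 2.
have z0 : 0 < z by rewrite divr_gt0.
have z1 : z < 1 by rewrite /z; lra.
have lz : ln z < 0 by apply: ln_lt0; rewrite z0.
(* Large enough for the quadratic gain from [eps] to exceed the losses linear in [e]: they are at
   most [(24 + 21 * eps) * e < eps * e ^ 2]. *)
pose e := (Num.truncn ((24 + 21 * eps) / eps)).+1.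
exists e, (kap / 2 / - ln z), kap, z; split.
  split => //; rewrite ?z0 ?kap0 //.
    by rewrite divr_gt0 ?divr_gt0 // oppr_gt0.
  have -> : kap / 2 / - ln z * ln z = - (kap / 2) by field; rewrite lt_eqF.
  by rewrite /z; lra.
have he : (24 + 21 * eps) / eps < e%:R by exact: truncnS_gt.
move: he; rewrite ltr_pdivrMr // => he.
have e0 : (0 < 4 * e)%N by [].
have := @quarter_ge R (4 * e) e0.
have bR : ((4 * e)%:R : R) = 4 * e%:R by rewrite natrM.
have bS : ((4 * e).+1%:R : R) = 4 * e%:R + 1 by rewrite -natr1 natrM.
have pi2 := @pi_ge2 R; rewrite k1 bS bR.
have er : (1 : R) <= e%:R by rewrite ler1n.
move: (#|quarter _|%:R : R) (e%:R : R) (pi : R) he er pi2 => q b p he er p2 hq.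
have p0 : 0 < p by lra.
have b0 : 0 < 4 * b + 1 by lra.
have -> : (1 + eps) ^+ 2 / (p * (4 * b + 1) ^+ 2) * (1 + eps)^-1 * (2 * q - 2^-1) =
  (1 + eps) * (2 * q - 2^-1) / (p * (4 * b + 1) ^+ 2).
  by field; rewrite !gt_eqF.
rewrite ler_pdivlMr ?mulr_gt0 ?exprn_gt0 //.
(* Counting gives [2 * q - 1/2 >= 8 * p * b ^ 2 - 32 * b - 1/2]; as [p >= 2] and [b >= 1], the loss
   is at most [18 * p * b], so that [p] cancels. *)
apply: (@le_trans _ _ ((1 + eps) * (p * (8 * b ^+ 2 - 18 * b)))).
  have h : 0 <= (1 + eps) * (8 * b ^+ 2 - 18 * b) - (2^-1 + eps / 4) * (4 * b + 1) ^+ 2 by nra.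
  have := mulr_ge0 (ltW p0) h.
  by rewrite mulrBr subr_ge0 => h'; apply: le_trans (le_trans h' _);
    rewrite le_eqVlt; apply/orP; left; apply/eqP; ring.
rewrite ler_pM2l //; move: hq; rewrite exprMn => hq; nra.
Qed.

(** Rounding [b * sqrt n / rho] up, with [rho] the minimum of [r] and [sqrt n], puts the side
    between [rho / b.+1] and [rho / b]. If [r] exceeds [sqrt n], the quotient is exactly [b] and
    [M = b.+1]. *)
Lemma exists_cell_grid (R : realType) (n e : nat) (r t : R) : (0 < n)%N -> (0 < e)%N -> 0 < t ->
  t <= r -> t ^+ 2 <= n%:R ->
  exists M : nat, [/\ (0 < M)%N, (4 * e)%:R * side R n M <= r,
    (M <= (4 * e).+1)%N \/ r <= ((4 * e).+1)%:R * side R n M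
    & t ^+ 2 / (4 * e).+1%:R ^+ 2 <= side R n M ^+ 2].
Proof.
move=> n0 e0 t0 tr tn; have nR : (0 : R) < n%:R by rewrite ltr0n.
set b := (4 * e)%N; have b0 : (0 : R) < b%:R by rewrite ltr0n muln_gt0.
have b10 : (0 : R) < b.+1%:R by rewrite ltr0n.
pose rt : R := Num.sqrt n%:R.
have rt0 : 0 < rt by rewrite sqrtr_gt0.
have trt : t <= rt.
  by rewrite /rt -[t](ger0_norm (ltW t0)) -sqrtr_sqr ler_wsqrtr.
pose rho := Num.min r rt.
have r0 : 0 < r by apply: lt_le_trans tr.
have rho0 : 0 < rho by rewrite lt_min r0.
have rho_r : rho <= r by rewrite ge_min lexx.
have rho_rt : rho <= rt by rewrite ge_min lexx orbT.
have t_rho : t <= rho by rewrite le_min tr.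
pose x := b%:R * rt / rho.
have x0 : 0 <= x by rewrite /x divr_ge0 ?mulr_ge0 // ltW.
pose M := (Num.truncn x).+1.
have M0 : (0 : R) < M%:R by rewrite ltr0n.
have xM : x < M%:R by exact: truncnS_gt.
have Mx : M%:R <= x + 1 by rewrite /M -natr1 lerD2r truncn_le.
have bx : b%:R <= x by rewrite /x ler_pdivlMr // ler_pM2l.
have s_up : b%:R * side R n M <= rho.
  by rewrite /side -/rt mulrA ler_pdivrMr // [leRHS]mulrC -ler_pdivrMr // ltW.
have s_lo : rho <= b.+1%:R * side R n M.
  rewrite /side -/rt mulrA ler_pdivlMr //.
  have h : rho * (x + 1) <= b.+1%:R * rt.
    have -> : rho * (x + 1) = b%:R * rt + rho by rewrite /x; field; rewrite gt_eqF.
    by rewrite -natr1 mulrDl mul1r lerD2l.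
  by apply: le_trans h; rewrite ler_pM2l.
exists M; split => //; first exact: le_trans s_up rho_r.
  case: (leP r rt) => hr; [right|left].
    by move: s_lo; rewrite /rho (min_idPl hr).
  have xb : x = b%:R by rewrite /x /rho (min_idPr (ltW hr)) mulfK // gt_eqF.
  by rewrite /M xb natrK.
rewrite ler_pdivrMr ?exprn_gt0 // mulrC -exprMn lerXn2r ?nnegrE ?(ltW t0) //.
  exact: le_trans (ltW rho0) s_lo.
exact: le_trans t_rho s_lo.
Qed.

Lemma harmonic_grid_le (R : realType) (n M : nat) : (3 <= n)%N -> (0 < M)%N -> (M ^ 2 <= n)%N ->
  \sum_(k < 3 * M) (k.+1%:R^-1 : R) <= 1 + 2 * ln n%:R.
Proof.
move=> n3 M0 Mn.
have -> : (3 * M = (3 * M).-1.+1)%N by rewrite prednK // muln_gt0.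
rewrite big_ord_recl /= invr1 lerD2l.
have -> : \sum_(i < (3 * M).-1) ((bump 0 i).+1%:R^-1 : R) = \sum_(j < (3 * M).-1) j.+2%:R^-1.
  by apply: eq_bigr => i _; rewrite /bump add1n.
apply: (le_trans (harmonic_le_ln R _)).
rewrite prednK ?muln_gt0 // mulr_natl -lnXn ?ltr0n //; last exact: leq_trans n3.
rewrite ler_ln ?posrE ?exprn_gt0 ?ltr0n ?muln_gt0 //; try exact: leq_trans n3.
by rewrite -natrX ler_nat; nia.
Qed.

(** Each term decays at least like a power of [n]. The estimate [expR (- x) <= x^-1] weakens all of
    them to multiples of [1 / L], and [M <= expR (L / 2)] is beaten by the exponent [1/2 + del]. *)
Lemma fail_bound_le (R : realType) (n M l : nat) (L s2 lam kap C0 del qq W : R) :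
  (0 < n)%N -> L = ln n%:R -> 2 <= L -> 0 < lam -> 0 < del -> 0 < kap < 1 -> 0 <= W ->
  lam * L <= s2 -> M%:R ^+ 2 * s2 = n%:R -> 1 <= s2 -> C0 = expR 1 - 1 + 2 / lam ->
  2^-1 + del <= lam * (1 - kap) * qq ->
  n%:R^-1 + (M ^ 2)%:R * expR (s2 * (expR 1 - 1 - C0)) +
   W * (M%:R * expR (- (qq * (s2 * (1 - kap)))) + (2 * l)%:R * expR (- (s2 * (1 - kap) / 2))) ^+ 2
   + expR (- (n%:R * (1 - kap)))
  <= (2 + W * (del^-1 + (2 * l)%:R * (2 / (lam * (1 - kap)))) ^+ 2 + (1 - kap)^-1) / L.
Proof.
move=> n0 eL L2 lam0 del0 /andP[kap0 kap1] W0 hs e2 s1 eC hq.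
have nR : (0 : R) < n%:R by rewrite ltr0n.
have L0 : 0 < L by lra.
have k0 : 0 < 1 - kap by lra.
have Ln : L <= n%:R by have := ln_natr_le R n0; rewrite -eL; lra.
have nL : (n%:R^-1 : R) <= L^-1 by rewrite lef_pV2.
have nexp : (n%:R : R) = expR L by rewrite eL lnK.
have M2n : (M%:R : R) ^+ 2 <= n%:R by rewrite -e2 ler_peMr ?sqr_ge0.
have Mexp : (M%:R : R) <= expR (L / 2).
  rewrite -(@ler_pXn2r _ 2) ?nnegrE ?expR_ge0 // (le_trans M2n) // nexp -expRM_natr.
  by rewrite ler_expR; lra.
have q0 : 0 < qq.
  have h : 0 < lam * (1 - kap) * qq by lra.
  by move: h; rewrite pmulr_rgt0 // mulr_gt0.
have b2 : (M ^ 2)%:R * expR (s2 * (expR 1 - 1 - C0)) <= L^-1.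
  have -> : s2 * (expR 1 - 1 - C0) = - (2 * (s2 / lam)) by rewrite eC; field; rewrite gt_eqF.
  have h : L <= s2 / lam by rewrite ler_pdivlMr // mulrC.
  apply: (@le_trans _ _ (expR L * expR (- (2 * L)))).
    rewrite natrX -nexp ler_pM ?expR_ge0 ?sqr_ge0 // ler_expR lerN2 ler_pM2l //.
  rewrite -expRD (_ : L + - (2 * L) = - L); last by ring.
  exact: expRN_le_inv.
have b3a : M%:R * expR (- (qq * (s2 * (1 - kap)))) <= del^-1 / L.
  apply: (@le_trans _ _ (expR (L / 2) * expR (- ((2^-1 + del) * L)))).
    rewrite ler_pM ?expR_ge0 // ler_expR lerN2.
    apply: (@le_trans _ _ (lam * (1 - kap) * qq * L)); first by rewrite ler_pM2r.
    have -> : lam * (1 - kap) * qq * L = qq * ((lam * L) * (1 - kap)) by ring.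
    by rewrite ler_pM2l // ler_pM2r.
  rewrite -expRD (_ : L / 2 + - ((2^-1 + del) * L) = - (del * L)); last by ring.
  by rewrite -invfM mulrC expRN_le_inv // mulr_gt0.
have b3b : expR (- (s2 * (1 - kap) / 2)) <= 2 / (lam * (1 - kap)) / L.
  apply: (@le_trans _ _ (expR (- (lam * (1 - kap) / 2 * L)))).
    rewrite ler_expR lerN2.
    have -> : lam * (1 - kap) / 2 * L = (lam * L) * (1 - kap) / 2 by ring.
    by rewrite ler_pM2r ?invr_gt0 // ler_pM2r.
  have -> : 2 / (lam * (1 - kap)) / L = (lam * (1 - kap) / 2 * L)^-1.
    by field; rewrite !gt_eqF.
  by apply: expRN_le_inv; rewrite mulr_gt0 // divr_gt0 // mulr_gt0.
set A := del^-1 + _ * _.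
have A0 : 0 <= A.
  by rewrite /A addr_ge0 ?invr_ge0 ?(ltW del0) // mulr_ge0 // divr_ge0 // mulr_ge0 // ltW.
have b3 : (M%:R * expR (- (qq * (s2 * (1 - kap)))) + (2 * l)%:R * expR (- (s2 * (1 - kap) / 2))) ^+ 2
    <= A ^+ 2 / L.
  apply: (@le_trans _ _ ((A / L) ^+ 2)).
    apply: lerXn2r; rewrite ?nnegrE.
    - by apply: addr_ge0; apply: mulr_ge0; rewrite ?expR_ge0 ?ler0n.
    - by rewrite divr_ge0 // ltW.
    - by rewrite /A mulrDl; apply: lerD b3a _; rewrite -[leRHS]mulrA; apply: ler_wpM2l b3b; exact: ler0n.
  rewrite expr_div_n ler_wpM2l ?sqr_ge0 // lef_pV2 ?posrE ?exprn_gt0 // expr2 ler_peMl ?(ltW L0) //.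
  lra.
have b4 : expR (- (n%:R * (1 - kap))) <= (1 - kap)^-1 / L.
  apply: (@le_trans _ _ (n%:R * (1 - kap))^-1); first by rewrite expRN_le_inv // mulr_gt0.
  by rewrite invfM mulrC ler_pM2l // invr_gt0.
have -> : (2 + W * A ^+ 2 + (1 - kap)^-1) / L = L^-1 + L^-1 + W * (A ^+ 2 / L) + (1 - kap)^-1 / L by ring.
by apply: lerD b4; apply: lerD; [apply: lerD|apply: ler_wpM2l].
Qed.

Lemma cover_time_estimate (R : realType) (eps : R) (heps : 0 < eps) (r : nat -> R)
  (d : measure_display) (Om : measurableType d) (P : probability Om R)
  (N : nat -> Om -> nat) (X : nat -> nat -> Om -> R * R) (hPPP : poisson_rgg_model P N X) :
  exists c C Cf L0 : R, [/\ 0 < c, 0 < C, 0 < Cf & forall n : nat,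
    (1 + eps) * Num.sqrt (ln n%:R / pi) <= r n -> L0 <= ln n%:R -> 0 < ln (n%:R : R) /\
    exists F : set Om, [/\ measurable F, (P F <= (Cf / ln n%:R)%:E)%E & forall w, ~ F w ->
      ((c * n%:R * ln n%:R)%:E <=
            cover_time R (rgg_adj (fun i : 'I_(N n w) => X n i w) (r n)))%E /\
      (cover_time R (rgg_adj (fun i : 'I_(N n w) => X n i w) (r n)) <=
            (C * n%:R * ln n%:R)%:E)%E]].
Proof.
have [e [eta [kap [z [[e0 eta0 kap01 z01 zk] key]]]]] := cell_constants heps.
set b1 := (4 * e).+1 in key.
have pi1 : (1 : R) <= pi by have := @pi_ge2 R; lra.
have pi0 : (0 : R) < pi by lra.
have b10 : (0 : R) < b1%:R by rewrite ltr0n.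
have e1 : 0 < 1 + eps by lra.
pose lam : R := (1 + eps) ^+ 2 / (pi * b1%:R ^+ 2).
have lam0 : 0 < lam by rewrite divr_gt0 ?exprn_gt0 // mulr_gt0 ?exprn_gt0.
rewrite -/lam in key.
(* A cell is then crowded with probability at most [expR (- 2 * ln n)], which beats the at most [n]
   cells. *)
pose C0 : R := expR 1 - 1 + 2 / lam.
have C01 : 1 <= C0.
  have : 0 < 2 / lam by rewrite divr_gt0.
  by have := @expR_ge1Dx R 1; rewrite /C0; lra.
(* The harmonic sum is at most [1 + 2 * ln n <= 3 * ln n], and [lam * ln n] is at most the area of a
   cell. *)
pose hb : R := 3 / lam.
have hb0 : 0 <= hb by rewrite divr_ge0 // ltW.
pose K0 := hit_const e eta C0 hb; pose c0 := comm_const e eta C0; pose J := bucket_const e eta C0 hb.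
have w2 : (0 : R) < ((2 * (4 * e) + 3) ^ 2)%:R by rewrite ltr0n expn_gt0 addn_gt0 orbT.
have C00 : 0 < C0 by lra.
have c00 : 0 < c0 by rewrite /c0 /comm_const divr_gt0 ?exprn_gt0 // !mulr_gt0.
have l0 : 0 <= local_const R e by exact: ler0n.
have res0 : 0 <= res_const e eta hb.
  rewrite /res_const; apply: addr_ge0; first by rewrite divr_ge0 // ltW.
  apply: divr_ge0; last exact: sqr_ge0.
  by apply: mulr_ge0 l0; apply: mulr_ge0 hb0; exact: ler0n.
have K01 : 1 <= K0.
  rewrite /K0 /hit_const lerDl; apply: mulr_ge0 (ltW w2); apply: mulr_ge0 (sqr_ge0 _).
  by apply: mulr_ge0 res0; exact: ler0n.
have lnC0 : 0 <= ln C0 by rewrite ln_ge0.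
have K00 : 0 <= K0 by exact: le_trans ler01 K01.
have /andP[kap0 kap1] := kap01; have /andP[z0 z1] := z01.
pose W : R := 2 ^+ ((2 * (68 * (4 * e)) + 1) ^ 2).
have W0 : 0 < W by rewrite exprn_gt0.
pose del : R := eps / 4.
have del0 : 0 < del by rewrite divr_gt0.
pose Cf : R := 2 + W * (del^-1 + (2 * (68 * (4 * e)))%:R * (2 / (lam * (1 - kap)))) ^+ 2 + (1 - kap)^-1.
have Cf0 : 0 < Cf.
  apply: ltr_pwDl; last by rewrite invr_ge0 subr_ge0 ltW.
  by apply: ltr_pwDl => //; apply: mulr_ge0 (sqr_ge0 _); exact: ltW.
pose lJ := ln (eta / J%:R).
(* In order, the terms ensure that the threshold radius fits into the box, that [n >= 3], that a
   cell has area at least 1 and that [eta * s2 >= 2]; the last one keeps half of the logarithm in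
   the lower bound, hence [c0 / 32]. *)
pose L0 : R := 4 * (1 + eps) ^+ 2 + 2 + lam^-1 + 2 / (eta * lam) + 2 * `|lJ|.
exists (c0 / 32), (2 * K0 * (1 + ln C0) + 1 + 4 * K0), Cf, L0; split => //.
- by rewrite divr_gt0.
- apply: ltr_pwDr; first by rewrite mulr_gt0 // (lt_le_trans _ K01).
  by rewrite addr_ge0 // mulr_ge0 ?addr_ge0 // mulr_ge0.
move=> n hr hL; set L := ln (n%:R : R) in hr hL *.
have t1 : 0 <= 4 * (1 + eps) ^+ 2 by rewrite mulr_ge0 // sqr_ge0.
have t2 : 0 <= lam^-1 by rewrite invr_ge0 ltW.
have t3 : 0 <= 2 / (eta * lam) by rewrite divr_ge0 // mulr_ge0 // ltW.
have t4 : 0 <= 2 * `|lJ| by rewrite mulr_ge0.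
have [Leps L2 Llam Leta LJ] : [/\ 4 * (1 + eps) ^+ 2 <= L, 2 <= L, lam^-1 <= L,
    2 / (eta * lam) <= L & 2 * `|lJ| <= L].
  move: hL t1 t2 t3 t4; rewrite /L0.
  move: (4 * (1 + eps) ^+ 2) (lam^-1) (2 / (eta * lam)) (2 * `|lJ|) => u1 u2 u3 u4.
  by clear; move=> *; split; lra.
have n0 : (0 < n)%N.
  (* [ln 0] is 0 by convention, so [n = 0] contradicts [2 <= L]. *)
  by rewrite lt0n; apply/eqP => n0; move: L2; rewrite /L n0 ln0 // leNgt ltr0n.
have nR : (0 : R) < n%:R by rewrite ltr0n.
have Lpos : 0 < L by apply: lt_le_trans L2.
split => //.
have n3 : (3 <= n)%N by rewrite -(ler_nat R); have := ln_natr_le R n0; move: L2; rewrite -/L; clear; lra.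
pose t := (1 + eps) * Num.sqrt (L / pi).
have Lpi : 0 < L / pi by rewrite divr_gt0.
have t0 : 0 < t by rewrite mulr_gt0 ?sqrtr_gt0.
have t_sqr : t ^+ 2 = (1 + eps) ^+ 2 * (L / pi) by rewrite exprMn sqr_sqrtr // ltW.
have tn : t ^+ 2 <= n%:R.
  rewrite t_sqr; apply: (@le_trans _ _ ((1 + eps) ^+ 2 * L)).
    by rewrite ler_pM2l ?exprn_gt0 // ler_pdivrMr // ler_peMr // ltW.
  have := ln_natr_sqr_le R n0; rewrite -/L expr2 => h.
  by have := ler_wpM2r (ltW Lpos) Leps; move: h; clear; lra.
have [M [M0 sr rs s2lo]] := exists_cell_grid n0 e0 t0 hr tn.
have e2 := side_sqr R n M0.
set s2 := side R n M ^+ 2 in s2lo e2.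
have s2lam : lam * L <= s2.
  apply: le_trans s2lo; rewrite t_sqr -/b1 /lam le_eqVlt; apply/orP; left; apply/eqP.
  have pin : (pi : R) != 0 by rewrite gt_eqF.
  have b1n : (b1%:R : R) != 0 by rewrite gt_eqF.
  move: (b1%:R : R) (pi : R) pin b1n => B p pin b1n; field; rewrite pin b1n //.
have s21 : 1 <= s2 by apply: le_trans s2lam; rewrite mulrC -ler_pdivrMr // div1r.
have seta : 2 <= eta * s2.
  apply: (@le_trans _ _ (eta * (lam * L))); last by rewrite ler_pM2l.
  by rewrite mulrA mulrC -ler_pdivrMr // mulr_gt0.
have Mn : (M ^ 2 <= n)%N.
  by rewrite -(ler_nat R) natrX -e2 ler_peMr // sqr_ge0.
have harm : \sum_(k < 3 * M) (k.+1%:R^-1 : R) <= hb * s2.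
  apply: (le_trans (harmonic_grid_le R n3 M0 Mn)); rewrite -/L.
  apply: (@le_trans _ _ (hb * (lam * L))); last by rewrite ler_wpM2l.
  have -> : hb * (lam * L) = 3 * L by rewrite /hb; field; rewrite gt_eqF.
  by move: L2; clear; lra.
exists (ev_fail N X n M e eta C0); split.
- exact: (measurable_ev_fail hPPP).
- apply: (le_trans (P_ev_fail hPPP e C0 n0 M0 z0 z1 kap1 zk)).
  rewrite lee_fin -/s2 -/W; apply: (@fail_bound_le R n M (68 * (4 * e)) L s2 lam kap C0 del _ W) => //; exact: ltW.
move=> w wF.
have pc := pt_cell n0 M0 wF.
have pg := points_gt wF.
have ic := in_cell_le n0 M0 wF.
have fs := few_sparse_good n0 M0 e0 wF.
have LoL : (Num.truncn (eta * s2))%:R < eta * s2 + 1.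
  apply: (@le_lt_trans _ _ (eta * s2)); last by rewrite ltrDl.
  by rewrite truncn_le (le_trans _ seta).
split.
  have := good_cover_ge n0 M0 e0 eta0 C01 hb0 pc sr rs seta ic (fs _ LoL) pg harm.
  move=> h; apply: le_trans h; rewrite lee_fin -/L -/c0 -/J -/lJ.
  have -> : c0 / 32 * n%:R * L = c0 / 16 * n%:R * (L / 2) by field.
  have cn : 0 < c0 / 16 * n%:R by rewrite mulr_gt0 // divr_gt0.
  rewrite (ler_pM2l cn).
  by have := ler_norm (- lJ); rewrite normrN; move: LJ; clear; lra.
have := good_cover_le n0 M0 e0 eta0 C01 hb0 pc sr rs seta ic (fs _ LoL) pg harm.
move=> h; apply: le_trans; first exact: h.
rewrite lee_fin -/L -/K0.
have nL : 1 <= n%:R * L.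
  by rewrite (le_trans _ (ler_wpM2r (ltW Lpos) (_ : 1 <= n%:R))) ?ler1n // mul1r (le_trans _ L2) // ler1n.
have nL2 : n%:R <= n%:R * L by rewrite ler_peMr ?(ltW nR) // (le_trans _ L2) // ler1n.
have -> : (2 * K0 * (1 + ln C0) + 1 + 4 * K0) * n%:R * L =
   2 * K0 * (n%:R * L * (1 + ln C0)) + n%:R * L + 4 * K0 * (n%:R * L) by ring.
apply: lerD; last first.
  by rewrite -[leLHS]mulrA -[leRHS]mulrA ler_pM2l // ler_pM2l // (lt_le_trans _ K01).
apply: lerD nL; rewrite -[leLHS]mulrA; apply: ler_wpM2l; first by rewrite mulr_ge0 // (le_trans _ K01).
by have := ler_wpM2r lnC0 nL2; clear; lra.
Qed.

Theorem theorem2 (R : realType) (eps : R) (heps : 0 < eps) (r : nat -> R)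
  (hr : exists n0 : nat, forall n : nat, (n0 <= n)%N ->
          (1 + eps) * Num.sqrt (ln n%:R / pi) <= r n)
  (d : measure_display) (Om : measurableType d) (P : probability Om R)
  (N : nat -> Om -> nat) (X : nat -> nat -> Om -> R * R)
  (hPPP : poisson_rgg_model P N X) :
  exists c C : R, 0 < c /\ 0 < C /\
    exists A : nat -> set Om,
      (forall n, measurable (A n)) /\
      (forall n w, A n w ->
         ((c * n%:R * ln n%:R)%:E <=
            cover_time R (rgg_adj (fun i : 'I_(N n w) => X n i w) (r n)))%E /\
         (cover_time R (rgg_adj (fun i : 'I_(N n w) => X n i w) (r n)) <=
            (C * n%:R * ln n%:R)%:E)%E) /\
      (forall delta : R, 0 < delta ->
         exists n0 : nat, forall n : nat, (n0 <= n)%N -> ((1 - delta)%:E <= P (A n))%E).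
Proof.
have [c [C [Cf [L0 [c0 C0 Cf0 H]]]]] := cover_time_estimate heps r hPPP.
have [n0 hn0] := hr.
pose ok n := (n0 <= n)%N && (L0 <= ln (n%:R : R)).
have ex n : exists A : set Om, [/\ measurable A,
   forall w, A w -> ((c * n%:R * ln n%:R)%:E <=
            cover_time R (rgg_adj (fun i : 'I_(N n w) => X n i w) (r n)))%E /\
      (cover_time R (rgg_adj (fun i : 'I_(N n w) => X n i w) (r n)) <=
            (C * n%:R * ln n%:R)%:E)%E
   & ok n -> 0 < ln (n%:R : R) /\ ((1 - Cf / ln n%:R)%:E <= P A)%E].
  case: (boolP (ok n)) => [/andP[h1 h2]|nok]; last by exists set0; split.
  have [Lp [F [mF PF hF]]] := H n (hn0 n h1) h2.
  exists (~` F); split => [|w nF|_]; [exact: measurableC|exact: hF|split => //].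
  rewrite probability_setC // EFinB; apply: leeB => //.
exists c, C; split => //; split => //.
exists (fun n => projT1 (cid (ex n))); split.
  by move=> n; case: (projT2 (cid (ex n))).
split.
  by move=> n w; case: (projT2 (cid (ex n))) => _ h _; exact: h.
move=> delta delta0.
pose L1 := Num.max L0 (Cf / delta).
exists (maxn n0 (Num.truncn (expR L1)).+1) => n; rewrite geq_max => /andP[h1 h2].
have hL : L1 <= ln (n%:R : R).
  rewrite -[leLHS]expRK ler_ln ?posrE ?expR_gt0 ?ltr0n //; last exact: leq_ltn_trans h2.
  by apply: le_trans (_ : (Num.truncn (expR L1)).+1%:R <= _); [rewrite ltW // truncnS_gt|rewrite ler_nat].
have okn : ok n by rewrite /ok h1 (le_trans _ hL) // /L1 le_max lexx.
case: (projT2 (cid (ex n))) => _ _ /(_ okn)[Lp h].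
apply: le_trans h; rewrite lee_fin lerD2l lerN2 ler_pdivrMr //.
have h3 : Cf / delta <= ln (n%:R : R) by apply: le_trans hL; rewrite /L1 le_max lexx orbT.
by move: h3; rewrite ler_pdivrMr // mulrC.
Qed.
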